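(* Let $1\le p_1\le\infty$, $0<p_2<\infty$, $1\le q_1\le\infty$, $0<q_2\le\infty$, $r>0$, $s<0$, and assume $p_1\ne p_2$. Let $$\theta=\frac{r}{r-s},\qquad \frac1p=\frac{1-\theta}{p_1}+\frac{\theta}{p_2},\qquad \frac1q=\frac{1-\theta}{q_1}+\frac{\theta}{q_2}.$$ Then there is a constant $c$, not depending on $f$, such that for every $f\in S_0(\mathbb{R}^n)\cap\left(L^1(\mathbb{R}^n)+L^\infty(\mathbb{R}^n)\right)$, $$\|f\|_{p,q}\le c\,\|f\|_{\dot B^r_{p_1,q_1}}^{1-\theta}\,\|f\|_{\dot F^s_{p_2,q_2;\infty}}^{\theta}.$$
   Context: Conventions: $1/\infty=0$; the inequality is trivial when its right-hand side is infinite. $S_0(\mathbb{R}^n)$ is the class of measurable, almost everywhere finite functions $f$ on $\mathbb{R}^n$ with $\lambda_f(y)=|\{x:|f(x)|>y\}|<\infty$ for every $y>0$. For $f\in S_0(\mathbb{R}^n)$ the non-increasing rearrangement is $f^*(t)=\inf\{y>0:\lambda_f(y)<t\}$, $0<t<\infty$. Lorentz quasinorms: $\|f\|_{p,q}=\left(\int_0^\infty (t^{1/p}f^*(t))^q\,\frac{dt}{t}\right)^{1/q}$ for $0<p,q<\infty$, and $\|f\|_{p,\infty}=\sup_{t>0}t^{1/p}f^*(t)$ for $0<p\le\infty$. Let $p_h(y)=(4\pi h)^{-n/2}e^{-|y|^2/(4h)}$ and $P_hf(x)=\int_{\mathbb{R}^n}p_h(y)f(x-y)\,dy$, $h>0$.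 For $-\infty<s<\infty$ and a non-negative integer $m$ with $2m>s$: the homogeneous Besov quasinorm is, for $0<p,q\le\infty$, $$\|f\|_{\dot B^s_{p,q}}=\left(\int_0^\infty h^{(m-s/2)q}\left\|\frac{\partial^mP_hf}{\partial h^m}\right\|_p^q\frac{dh}{h}\right)^{1/q}$$ (for $q=\infty$: $\sup_{h>0}h^{m-s/2}\|\partial^mP_hf/\partial h^m\|_p$); the homogeneous Triebel-Lizorkin-Lorentz quasinorm with third index $\infty$ is, for $0<p<\infty$, $0<q\le\infty$, $$\|f\|_{\dot F^s_{p,q;\infty}}=\left\|\sup_{h>0}h^{m-s/2}\left|\frac{\partial^mP_hf}{\partial h^m}(\cdot)\right|\right\|_{p,q}.$$ One integer $m$ with $2m>r$ is fixed and used in both quasinorms in the statement; the constant may depend on $m$, $n$ and the parameters. *)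

(* Defs.v *)
From HB Require Import structures.
From mathcomp Require Import all_boot all_order all_algebra.
From mathcomp Require Import all_classical all_reals all_analysis.
From mathcomp Require Import measurable_realfun ess_sup_inf.

Set Implicit Arguments.
Unset Strict Implicit.
Unset Printing Implicit Defensive.

Import Order.TTheory GRing.Theory Num.Theory.
Import numFieldNormedType.Exports.

Local Open Scope classical_set_scope.
Local Open Scope ring_scope.

(** [n.-tuple R] carries the Borel (product) sigma-algebra. The Borel-Lebesgue
    measure on it is built by recursion on [n]: the product of the Lebesgue
    measure on the line with the measure on R^(n-1), transported along
    [consT]. *)

Section TupleMeasureStep.
Context {d} {T : measurableType d} {R : realType} {n : nat}.
Local Open Scope ereal_scope.

Definition consT (z : T * n.-tuple T) : n.+1.-tuple T :=
  [the n.+1.-tuple T of z.1 :: z.2].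

Lemma measurable_consT : measurable_fun setT consT.
Proof. exact: measurable_cons. Qed.

Variables (nu : {sigma_finite_measure set T -> \bar R})
  (mu : {sigma_finite_measure set (n.-tuple T) -> \bar R}).

Definition tuple_measure_step : set (n.+1.-tuple T) -> \bar R :=
  pushforward (nu \x mu) consT.

Let preimage_consT A : measurable A -> measurable (consT @^-1` A).
Proof. by move=> mA; rewrite -[X in measurable X]setTI; exact: measurable_consT. Qed.

Let step0 : tuple_measure_step set0 = 0.
Proof. by rewrite /tuple_measure_step /pushforward preimage_set0 measure0. Qed.

Let step_ge0 A : 0 <= tuple_measure_step A.
Proof. by apply: integral_ge0 => x _ /=; exact: measure_ge0. Qed.

Let step_sigma_additive : semi_sigma_additive tuple_measure_step.
Proof.
move=> F mF tF mUF; rewrite /tuple_measure_step /pushforward preimage_bigcup.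
apply: measure_semi_sigma_additive.
- by move=> k; exact: preimage_consT.
- apply/trivIsetP => /= i j _ _ ij; rewrite -preimage_setI.
  by move/trivIsetP : tF => /(_ _ _ _ _ ij) ->//; rewrite preimage_set0.
- by rewrite -preimage_bigcup; exact: preimage_consT.
Qed.

HB.instance Definition _ := isMeasure.Build _ _ _ tuple_measure_step
  step0 step_ge0 step_sigma_additive.

Lemma tuple_measure_step_sigma_finite : sigma_finite setT tuple_measure_step.
Proof.
have /sigma_finiteP[F [TF ndF Foo]] := sigma_finiteT nu.
have /sigma_finiteP[G [TG ndG Goo]] := sigma_finiteT mu.
pose h (x : n.+1.-tuple T) : n.-tuple T := [tuple of behead x].
exists (fun k => (fun x : n.+1.-tuple T => tnth x ord0) @^-1` F k `&`
                 h @^-1` G k).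
  rewrite predeqE => x; split => // _.
  have [i _ Fi] : (\bigcup_i F i) (tnth x ord0) by rewrite -TF.
  have [j _ Gj] : (\bigcup_i G i) (h x) by rewrite -TG.
  exists (maxn i j) => //; split => /=.
  - by move: Fi; exact/subsetPset/ndF/leq_maxl.
  - by move: Gj; exact/subsetPset/ndG/leq_maxr.
move=> k; have [mF Fk] := Foo k; have [mG Gk] := Goo k; split.
  apply: measurableI; rewrite -[X in measurable X]setTI.
    by apply: measurable_tnth.
  exact: measurable_behead.
rewrite /tuple_measure_step /pushforward (_ : consT @^-1` _ = F k `*` G k).
  by rewrite product_measure1E// lte_mul_pinfty// ge0_fin_numE.
apply/seteqP; split => -[x t] /= [Fx Gt]; split => //.
- by move: Gt; rewrite (_ : h _ = t)//; exact: val_inj.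
- by rewrite /= (_ : h _ = t)//; exact: val_inj.
Qed.

HB.instance Definition _ :=
  Measure_isSigmaFinite.Build _ _ _ tuple_measure_step
    tuple_measure_step_sigma_finite.

End TupleMeasureStep.

Fixpoint borel_leb (R : realType) (n : nat) :
    {sigma_finite_measure set (n.-tuple (measurableTypeR R)) -> \bar R} :=
  match n with
  | 0 => \d_([tuple] : 0.-tuple (measurableTypeR R))
  | k.+1 => tuple_measure_step (@lebesgue_measure R) (borel_leb R k)
  end.

(** [Rn R n] is [n.-tuple R] with the sigma-algebra of Lebesgue measurable sets,
    i.e. the completion of the Borel one. *)
Definition Rn (R : realType) (n : nat) : Type := n.-tuple R.

HB.instance Definition _ (R : realType) (n : nat) :=
  Measurable.copy (Rn R n) (caratheodory_type (mu_ext (borel_leb R n))).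

Definition lebn (R : realType) (n : nat) : {measure set (Rn R n) -> \bar R} :=
  @completed_measure_extension _ _ _ (borel_leb R n).

Section Spaces.
Context {R : realType} {n : nat}.
Implicit Types (f : Rn R n -> \bar R) (x y : Rn R n) (h s t : R) (m : nat)
  (p q : \bar R).

Definition subT x y : Rn R n := [tuple tnth x i - tnth y i | i < n].

Definition sqnorm y : R := \sum_(i < n) tnth y i ^+ 2.

Definition lambda f (a : R) : \bar R := lebn R n [set x | (a%:E < `|f x|)%E].

Definition S0 f : Prop :=
  [/\ measurable_fun [set: Rn R n] f,
      {ae lebn R n, forall x, f x \is a fin_num} &
      forall a : R, 0 < a -> (lambda f a < +oo)%E].

Definition L1_plus_Loo f : Prop :=
  exists g k : Rn R n -> R,
    [/\ g \in Lfun (lebn R n) 1%E, k \in Lfun (lebn R n) +oo%E &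
        {ae lebn R n, forall x, f x = (g x + k x)%:E}].

Definition rearrangement f t : \bar R :=
  ereal_inf [set a%:E | a in [set a : R | 0 < a /\ (lambda f a < t%:E)%E]].

(** The exponent 1/p is [fine p^-1], which is 0 when [p = +oo]. *)
Definition lorentz_norm p q f : \bar R :=
  (match q with
   | q'%:E =>
       (\int[lebesgue_measure]_(t in `]0%R, +oo[)
          (((t `^ fine p^-1)%:E * rearrangement f t) `^ q' * (t^-1)%:E))
         `^ q'^-1
   | +oo =>
       ereal_sup [set (t `^ fine p^-1)%:E * rearrangement f t
                 | t in [set t : R | (0 < t)%R]]
   | -oo => 0
   end)%E.

Definition heat_kernel h y : R :=
  (4 * pi * h) `^ (- (n%:R / 2)) * expR (- (sqnorm y / (4 * h))).

Definition heat h f x : \bar R :=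
  (\int[lebn R n]_y ((heat_kernel h y)%:E * f (subT x y)))%E.

(** For [f] in L^1 + L^oo, [heat h f x] is finite for all [h > 0] and all [x], so
    [fine] loses nothing. *)
Definition dheat m h f x : R := derive1n m (fun k => fine (heat k f x)) h.

Definition besov_norm m s p q f : \bar R :=
  (match q with
   | q'%:E =>
       (\int[lebesgue_measure]_(h in `]0%R, +oo[)
          ((h `^ ((m%:R - s / 2) * q'))%:E *
           'N[lebn R n]_p [EFin \o dheat m h f] `^ q' * (h^-1)%:E))
         `^ q'^-1
   | +oo =>
       ereal_sup [set (h `^ (m%:R - s / 2))%:E *
                      'N[lebn R n]_p [EFin \o dheat m h f]
                 | h in [set h : R | (0 < h)%R]]
   | -oo => 0
   end)%E.

Definition triebel_lizorkin_lorentz_norm m s p q f : \bar R :=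
  lorentz_norm p q (fun x =>
    ereal_sup [set (h `^ (m%:R - s / 2) * `|dheat m h f x|)%:E
              | h in [set h : R | 0 < h]]).

End Spaces.

(* Main.v *)
Require Import Defs.
From HB Require Import structures.
From mathcomp Require Import all_boot all_order all_algebra.
From mathcomp Require Import all_classical all_reals all_analysis.
From mathcomp Require Import measurable_realfun ess_sup_inf.
From mathcomp Require Import lra ring.

(** The proof discretises both sides on geometric grids; its only analytic input
    is one estimate on distribution functions.

    Let u_h = P_h f, let N(h) be the L^p1 norm of the m-th derivative of u_h in
    h, let G(x) be the supremum inside the Triebel-Lizorkin-Lorentz quasinorm,
    and H_l = H0 2^l. Taylor's formula, with the expansion time moved along the
    H_l to infinity, where all h^i u_h^(i) vanish ([heat_deriv_decay]), bounds
    |u_(H_l)(x)| by the sum over i >= l of H_i^m times the supremum of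
    |u_h^(m)(x)| on the i-th dyadic block ([taylor_telescope]). Fix j. On the
    blocks i > j that supremum is at most G(x) H_i^(s/2-m). On the blocks i <= j
    the semigroup property bounds it by an average of |u_(h')^(m)| for a time h'
    in an earlier block with N(h') small, and averages are of weak type
    (p1, p1), so the bound holds off a small set ([block_exceptional_set]).
    Since r > 0 > s, both halves of the sum are geometric around i = j. As |f|
    is a.e. at most the supremum of |u_h| over any sequence of times tending to
    0 ([ae_le_heat_deriv]), this gives, for all t, g and all j
    ([level_set_estimate]),

      lambda_f (C (b t^(-1/p1) H_j^(r/2) + g H_j^(s/2))) <= t + lambda_G g,

    where b bounds h^(m-r/2) N(h) near h = H_j, and hence a bound for f^*(2t)
    whenever g > G^*(t).

    Put L = 2^((r-s)/2), d = 1/p1 - 1/p2, t_k = L^(4k/d), and choose H0 so that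
    the two quasinorms are normalised. Then t_k^(1/p) f^*(2 t_k) is at most a
    constant times L^(theta(j-4k)) b_j + L^(-(1-theta)(j-4k)) g_k for every j,
    where b_j and g_k sample the two quasinorms. Balancing the two terms by
    L^j b_j ~ L^(4k) g_k leaves b_j^(1-theta) g_k^theta. After b and g are
    replaced by slowly varying majorants ([smoothing]), L^(4k) g_k grows in k
    much faster than L^j b_j does in j, so that k determines j = j(k)
    injectively ([selection]), and the l^q bound of b_(j(k))^(1-theta) g_k^theta
    follows from those of b and g ([lq_bound_interpolate]). Here p1 <> p2 is
    what makes the t_k a grid.

    When one of the quasinorms of f vanishes, so does the other
    ([Lnorm_dheat_eq0], [supheat_null]); so the product on the right is never of
    the form 0 * oo, and then f^* = 0 follows by letting the bounds tend to 0. *)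

Set Implicit Arguments.
Unset Strict Implicit.
Unset Printing Implicit Defensive.

Import Order.TTheory GRing.Theory Num.Theory.
Import numFieldNormedType.Exports.

Local Open Scope classical_set_scope.
Local Open Scope ring_scope.

(** * Reflections preserve Lebesgue measure *)

Lemma eq_imp_le d (T : porderType d) (x y : T) : x = y -> (x <= y)%O.
Proof. by move->. Qed.

Section reflection.
Context {R : realType}.
Local Notation T := (measurableTypeR R).
Local Notation mu := (@lebesgue_measure R).

Definition reflect (a : R) : T -> T := fun y => a - y.

Lemma measurable_reflect (a : R) : measurable_fun [set: T] (reflect a).
Proof. by apply: measurable_funB. Qed.

Lemma lebesgue_measure_reflect (a : R) (A : set T) : measurable A ->
  mu (reflect a @^-1` A) = mu A.
Proof.
move=> mA.
have mr := measurable_reflect a.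
rewrite -[LHS]/(pushforward mu (reflect a) A).
apply/esym.
pose mf : {mfun T >-> T} := mfun_Sub (mem_set mr).
apply: (@lebesgue_measure_unique R (pushforward mu mf)) => // X /ocitvP[->|].
  by rewrite !measure0.
move=> [x xlt ->].
have E : reflect a @^-1` `]x.1, x.2] = `[a - x.2, a - x.1[%classic.
  apply/seteqP; split => y /=; rewrite /reflect !in_itv/= => /andP[h1 h2]; apply/andP; split; lra.
change (mu `]x.1, x.2]%classic = mu (reflect a @^-1` `]x.1, x.2])); rewrite E.
rewrite !lebesgue_measure_itv/= !lte_fin ltrD2l ltrN2; case: ifP => // _.
by rewrite -!EFinD; congr EFin; lra.
Qed.

End reflection.

Section tuple_invariance.
Context {R : realType}.
Local Notation TR := (measurableTypeR R).

Lemma measurable_subT_aux n (x : Rn R n) :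
  measurable_fun [set: n.-tuple TR] (subT x : n.-tuple TR -> n.-tuple TR).
Proof.
apply/measurable_fun_tnthP => i.
have -> : (fun t => tnth t i) \o (subT x : n.-tuple TR -> n.-tuple TR) =
   reflect (tnth x i) \o (fun t : n.-tuple TR => tnth t i).
  by apply/funext => y /=; rewrite /subT tnth_mktuple.
by apply: measurableT_comp; [exact: measurable_reflect|exact: measurable_tnth].
Qed.

(** By induction on the dimension: [consT] intertwines the reflection at x with
    the product of the reflections at its head and at its tail, and product
    measures are determined by their values on rectangles. *)
Lemma borel_leb_subT n (x : Rn R n) (A : set (n.-tuple TR)) : measurable A ->
  borel_leb R n ((subT x : n.-tuple TR -> n.-tuple TR) @^-1` A) = borel_leb R n A.
Proof.
elim: n x A => [|n IH] x A mA.
  by congr (borel_leb R 0 _); apply/seteqP; split => t /=; rewrite (tuple0 t) (tuple0 (subT _ _)).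
pose x0 : R := thead x; pose x' : Rn R n := [tuple of behead x].
pose psi (z : TR * n.-tuple TR) : TR * n.-tuple TR := (reflect x0 z.1, subT x' z.2).
have mpsi : measurable_fun setT psi.
  apply/measurable_fun_pairP; split.
    exact: (measurableT_comp (measurable_reflect x0) measurable_fst).
  exact: (measurableT_comp (measurable_subT_aux x') measurable_snd).
have comm z : subT x (consT z) = consT (psi z).
  apply: eq_from_tnth => i; rewrite tnth_mktuple.
  case: (unliftP ord0 i) => [j ->|->].
    rewrite !tnthS /= tnth_mktuple; congr (_ - _).
    by rewrite [in LHS](tuple_eta x) tnthS.
  by [].
rewrite /=.
rewrite /tuple_measure_step /pushforward.
have -> : consT @^-1` ((subT x : n.+1.-tuple TR -> n.+1.-tuple TR) @^-1` A) = psi @^-1` (consT @^-1` A).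
  by apply/seteqP; split => z /=; rewrite comm.
have mcA : measurable (consT @^-1` A : set (TR * n.-tuple TR)).
  by rewrite -[X in measurable X]setTI; exact: measurable_consT.
pose mf : {mfun (TR * n.-tuple TR)%type >-> (TR * n.-tuple TR)%type} := mfun_Sub (mem_set mpsi).
rewrite [RHS](@product_measure_unique _ _ _ _ _ _ _ (pushforward (@lebesgue_measure R \x borel_leb R n)%E mf))//.
move=> B C mB mC; change ((@lebesgue_measure R \x borel_leb R n) (psi @^-1` (B `*` C)) = lebesgue_measure B * borel_leb R n C)%E.
have -> : psi @^-1` (B `*` C) = (reflect x0 @^-1` B) `*` ((subT x' : n.-tuple TR -> n.-tuple TR) @^-1` C).
  by apply/seteqP; split => z.
rewrite product_measure1E; last 2 first.
- by rewrite -[X in measurable X]setTI; exact: measurable_reflect.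
- by rewrite -[X in measurable X]setTI; exact: measurable_subT_aux.
by congr (_ * _)%E; [exact: lebesgue_measure_reflect|exact: IH].
Qed.

End tuple_invariance.

(** * Lebesgue measure on R^n *)

Section Rn_measure.
Context {R : realType} {n : nat}.
Local Notation TR := (measurableTypeR R).
Local Notation BT := (n.-tuple TR).

Lemma subTK (x : Rn R n) : involutive (subT x : Rn R n -> Rn R n).
Proof.
by move=> y; apply: eq_from_tnth => i; rewrite !tnth_mktuple; lra.
Qed.

Lemma lebn_outerE (A : set (Rn R n)) : lebn R n A = mu_ext (borel_leb R n) A.
Proof. by []. Qed.

(** The reflection is an involution, so one inequality suffices; it maps covers
    by Borel sets to covers of the same total measure. *)
Lemma lebn_subT (x : Rn R n) (A : set (Rn R n)) :
  lebn R n (subT x @^-1` A) = lebn R n A.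
Proof.
suff H B : (lebn R n (subT x @^-1` B) <= lebn R n B)%E.
  have K : subT x @^-1` (subT x @^-1` A) = A.
    by apply/seteqP; split => y /=; rewrite subTK.
  by apply/eqP; rewrite eq_le H/= -[X in (lebn R n X <= _)%E]K H.
rewrite !lebn_outerE.
apply: le_ereal_inf_tmp => _ [F [mF BF] <-].
apply: ereal_inf_lbound; exists (fun k => subT x @^-1` F k).
  split => [k|y /= /BF [k _ Fk]]; last by exists k.
  by rewrite -[X in measurable X]setTI; exact: measurable_subT_aux.
by apply: eq_eseriesr => k _; exact: borel_leb_subT.
Qed.

Lemma measurable_subT (x : Rn R n) :
  measurable_fun [set: Rn R n] (subT x : Rn R n -> Rn R n).
Proof.
move=> _ E mE; rewrite setTI.
have {}mE : caratheodory_measurable (mu_ext (borel_leb R n)) E by [].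
suff : caratheodory_measurable (mu_ext (borel_leb R n)) (subT x @^-1` E) by [].
move=> X; have := mE (subT x @^-1` X).
rewrite -!lebn_outerE lebn_subT => ->.
congr (_ + _)%E.
  rewrite -[RHS](lebn_subT x); congr (lebn R n _).
  by apply/seteqP; split => y /=; rewrite subTK.
rewrite -[RHS](lebn_subT x); congr (lebn R n _).
by apply/seteqP; split => y /=; rewrite subTK.
Qed.

Lemma borel_measurable_Rn (A : set BT) : measurable A -> measurable (A : set (Rn R n)).
Proof. exact: caratheodory_measurable_mu_ext. Qed.

Lemma lebn_borel (A : set BT) : measurable A -> lebn R n A = borel_leb R n A.
Proof. by move=> mA; rewrite lebn_outerE measurable_mu_extE. Qed.

Lemma lebn_sigma_finite : sigma_finite [set: Rn R n] (lebn R n).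
Proof. exact/completed_measure_extension_sigma_finite/sigma_finiteT. Qed.

HB.instance Definition _ := @Measure_isSigmaFinite.Build _ _ _
  (@completed_measure_extension _ _ _ (borel_leb R n)) lebn_sigma_finite.

(** The same measure as [lebn], with the sigma-finite structure that Fubini's
    theorem asks for. *)
Definition lebn_sf : {sigma_finite_measure set (Rn R n) -> \bar R} :=
  @completed_measure_extension _ _ _ (borel_leb R n).

(** The identity, seen as a map from the complete sigma-algebra to the Borel one;
    integrals of Borel functions are transported along it. *)
Definition to_borel (x : Rn R n) : BT := x.

Lemma measurable_to_borel : measurable_fun [set: Rn R n] to_borel.
Proof. by move=> _ A mA; rewrite setTI; exact: borel_measurable_Rn. Qed.

Lemma ge0_integral_lebn_borel (g : BT -> \bar R) : measurable_fun setT g ->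
  (forall x, 0 <= g x)%E ->
  (\int[lebn R n]_x g x = \int[borel_leb R n]_x g x)%E.
Proof.
move=> mg g0.
rewrite (eq_measure_integral (pushforward (lebn R n) (mfun_Sub (mem_set measurable_to_borel)))); last first.
  by move=> A mA _; rewrite /pushforward/= -lebn_borel.
by rewrite ge0_integral_pushforward.
Qed.

Lemma ge0_integral_lebn_subT x (g : Rn R n -> \bar R) : measurable_fun setT g ->
  (forall x, 0 <= g x)%E ->
  (\int[lebn R n]_y g (subT x y) = \int[lebn R n]_y g y)%E.
Proof.
move=> mg g0.
rewrite [RHS](eq_measure_integral (pushforward (lebn R n) (mfun_Sub (mem_set (measurable_subT x))))); last first.
  by move=> A mA _; exact/esym/lebn_subT.
by rewrite [RHS]ge0_integral_pushforward.
Qed.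

Lemma integral_lebn_subT x (g : Rn R n -> \bar R) : measurable_fun setT g ->
  (\int[lebn R n]_y g (subT x y) = \int[lebn R n]_y g y)%E.
Proof.
move=> mg; rewrite integralE [RHS]integralE; congr (_ - _)%E.
  rewrite -(ge0_integral_lebn_subT x (measurable_funepos mg)); first by apply: eq_integral => y _; exact: (congr1 (@^~ y) (funepos_comp g (subT x))).
  exact: funepos_ge0.
rewrite -(ge0_integral_lebn_subT x (measurable_funeneg mg)); first by apply: eq_integral => y _; exact: (congr1 (@^~ y) (funeneg_comp g (subT x))).
exact: funeneg_ge0.
Qed.

Lemma measurable_sqnorm_sub :
  measurable_fun [set: Rn R n * Rn R n] (fun z => sqnorm (subT z.1 z.2)).
Proof.
have E : (fun z : Rn R n * Rn R n => sqnorm (subT z.1 z.2)) =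
   (fun z => \sum_(i < n) (tnth z.1 i - tnth z.2 i) ^+ 2).
  by apply/funext => z; apply: eq_bigr => i _; rewrite tnth_mktuple.
rewrite E; apply: measurable_sum => i.
have mt : measurable_fun [set: Rn R n] (fun x => tnth x i : R).
  exact: (measurableT_comp (measurable_tnth i) measurable_to_borel).
apply: measurable_funX; apply: measurable_funB.
  exact: (measurableT_comp mt measurable_fst).
exact: (measurableT_comp mt measurable_snd).
Qed.

End Rn_measure.

(** * The heat kernel *)

Section heat_kernel_Rn.
Context {R : realType}.
Local Notation TR := (measurableTypeR R).

Lemma heat_kernel_ge0 n (h : R) (y : Rn R n) : 0 <= heat_kernel h y.
Proof. by rewrite mulr_ge0 ?powR_ge0 ?expR_ge0. Qed.

Lemma heat_kernel1E (h y : R) : 0 < h ->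
  (4 * pi * h) `^ (- (1 / 2)) * expR (- (y ^+ 2 / (4 * h))) =
  normal_pdf 0 (Num.sqrt (2 * h)) y.
Proof.
move=> h0.
have s0 : Num.sqrt (2 * h) != 0 by rewrite gt_eqF// sqrtr_gt0 mulr_gt0.
rewrite normal_pdfE// /normal_peak /normal_fun sqr_sqrtr ?mulr_ge0 ?(ltW h0)//.
congr (_ * _).
  rewrite powRN mul1r powR12_sqrt; last by rewrite !mulr_ge0 ?pi_ge0 ?ltW.
  by congr (Num.sqrt _)^-1; rewrite -mulr_natr; ring.
by rewrite subr0 -mulr_natr mulNr; congr (expR (- (_ / _))); ring.
Qed.

(** The heat kernel of R^(n+1) factors through the normal density with variance
    2h, which gives its mass by induction on the dimension. *)
Lemma heat_kernel_consT n (h : R) (z : TR * n.-tuple TR) : 0 < h ->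
  heat_kernel h (consT z : Rn R n.+1) =
  normal_pdf 0 (Num.sqrt (2 * h)) z.1 * heat_kernel h (z.2 : Rn R n).
Proof.
move=> h0; rewrite -heat_kernel1E// /heat_kernel.
have hp : 0 < 4 * pi * h :> R by rewrite !mulr_gt0 ?pi_gt0.
rewrite mulrACA; congr (_ * _).
  rewrite -powRD; last by rewrite (gt_eqF hp) implybT.
  by congr powR; rewrite -natr1; lra.
rewrite -expRD; congr expR; rewrite -opprD -mulrDl /sqnorm big_ord_recl.
by congr (- ((_ + _) / _)); apply: eq_bigr => i _; rewrite tnthS.
Qed.

Lemma measurable_heat_kernel n (h : R) :
  measurable_fun [set: n.-tuple TR] (fun y => heat_kernel h (y : Rn R n)).
Proof.
apply: measurable_funM => //; apply: measurableT_comp => //.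
apply: measurableT_comp => //; apply: measurable_funM => //.
apply: measurable_sum => i; apply: measurable_funX.
exact: measurable_tnth.
Qed.

Lemma integral_heat_kernel_borel n (h : R) : 0 < h ->
  (\int[borel_leb R n]_y (heat_kernel h (y : Rn R n))%:E = 1)%E.
Proof.
move=> h0; elim: n => [|n IH].
  rewrite /= integral_dirac//; last first.
    by apply/measurable_EFinP; exact: measurable_heat_kernel.
  by rewrite diracT mul1e /heat_kernel /sqnorm big_ord0 mul0r oppr0 powRr0 mul0r oppr0 expR0 mul1r.
rewrite (eq_measure_integral (pushforward ((@lebesgue_measure R) \x borel_leb R n)%E (mfun_Sub (mem_set measurable_consT)))); last by [].
have mk := @measurable_heat_kernel n.+1 h.
rewrite ge0_integral_pushforward//=; last 2 first.
- exact/measurable_EFinP.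
- by move=> y _; rewrite lee_fin heat_kernel_ge0.
have mk1 : measurable_fun setT (fun z : TR * n.-tuple TR => normal_pdf 0 (Num.sqrt (2 * h)) z.1 * heat_kernel h (z.2 : Rn R n)).
  apply: measurable_funM.
    exact: (measurableT_comp (measurable_normal_pdf _ _) measurable_fst).
  exact: (measurableT_comp (measurable_heat_kernel _) measurable_snd).
rewrite preimage_setT.
under eq_integral do rewrite /= heat_kernel_consT//.
rewrite (@fubini_tonelli1 _ _ _ _ _ _ _ (fun z : TR * n.-tuple TR => (normal_pdf 0 (Num.sqrt (2 * h)) z.1 * heat_kernel h (z.2 : Rn R n))%:E)); last 2 first.
- exact/measurable_EFinP.
- by move=> z; rewrite lee_fin mulr_ge0 ?normal_pdf_ge0 ?heat_kernel_ge0.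
rewrite /fubini_F/= -(integral_normal_pdf 0 (Num.sqrt (2 * h))).
apply: eq_integral => x _; under eq_integral do rewrite EFinM.
rewrite ge0_integralZl//; last 3 first.
- by apply/measurable_EFinP; exact: measurable_heat_kernel.
- by move=> y _; rewrite lee_fin heat_kernel_ge0.
- by rewrite lee_fin normal_pdf_ge0.
by rewrite IH mule1.
exact: measurable_consT.
Qed.

Lemma integral_heat_kernel n (h : R) : 0 < h ->
  (\int[lebn R n]_y (heat_kernel h y)%:E = 1)%E.
Proof.
move=> h0; rewrite -(integral_heat_kernel_borel n h0).
apply: (@ge0_integral_lebn_borel _ _ (fun y : n.-tuple TR => (heat_kernel h (y : Rn R n))%:E)).
  by apply/measurable_EFinP; exact: measurable_heat_kernel.
by move=> x; rewrite lee_fin heat_kernel_ge0.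
Qed.

Lemma measurable_heat_kernel_Rn n (h : R) :
  measurable_fun [set: Rn R n] (heat_kernel h : Rn R n -> R).
Proof. exact: (measurableT_comp (measurable_heat_kernel h) measurable_to_borel). Qed.

Lemma integral_heat_kernel_sub n (h : R) (x : Rn R n) : 0 < h ->
  (\int[lebn R n]_y (heat_kernel h (subT x y))%:E = 1)%E.
Proof.
move=> h0; rewrite -(integral_heat_kernel n h0).
apply: (ge0_integral_lebn_subT x (g := fun y => (heat_kernel h y)%:E)).
  by apply/measurable_EFinP; exact: measurable_heat_kernel_Rn.
by move=> y; rewrite lee_fin heat_kernel_ge0.
Qed.

Lemma sqnorm_subC n (x y : Rn R n) : sqnorm (subT x y) = sqnorm (subT y x).
Proof. by apply: eq_bigr => i _; rewrite !tnth_mktuple -sqrrN opprB. Qed.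

(** Completing the square: as a function of z, the product of the two kernels is
    again a Gaussian, centred at the weighted mean of x and y. *)
Lemma heat_kernel_mul n (h k : R) (x y z : Rn R n) : 0 < h -> 0 < k ->
  heat_kernel h (subT x z) * heat_kernel k (subT z y) =
  heat_kernel (h + k) (subT x y) * heat_kernel (h * k / (h + k))
    (subT ([tuple (k * tnth x i + h * tnth y i) / (h + k) | i < n] : Rn R n) z).
Proof.
move=> h0 k0; have hk : 0 < h + k by rewrite addr_gt0.
rewrite /heat_kernel mulrACA [RHS]mulrACA; congr (_ * _).
  have p0 : 0 <= 4 * pi :> R by rewrite mulr_ge0 ?pi_ge0.
  rewrite -!powRM ?mulr_ge0 ?invr_ge0 ?pi_ge0 ?(ltW h0) ?(ltW k0) ?(ltW hk)//.
  by congr powR; field; rewrite gt_eqF.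
rewrite -!expRD; congr expR; rewrite -!opprD; congr (- _).
rewrite /sqnorm !mulr_suml -!big_split/=; apply: eq_bigr => i _.
rewrite !tnth_mktuple; field.
by rewrite !gt_eqF.
Qed.

Lemma heat_kernel_semigroup n (h k : R) (x y : Rn R n) : 0 < h -> 0 < k ->
  (\int[lebn R n]_z (heat_kernel h (subT x z) * heat_kernel k (subT z y))%:E =
   (heat_kernel (h + k) (subT x y))%:E)%E.
Proof.
move=> h0 k0.
under eq_integral do rewrite heat_kernel_mul// EFinM.
rewrite ge0_integralZl; last 4 first.
- exact: measurableT.
- apply/measurable_EFinP.
  exact: (measurableT_comp (measurable_heat_kernel_Rn _) (measurable_subT _)).
- by move=> z _; rewrite lee_fin heat_kernel_ge0.
- by rewrite lee_fin heat_kernel_ge0.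
by rewrite integral_heat_kernel_sub ?mule1// divr_gt0 ?mulr_gt0 ?addr_gt0.
Qed.

End heat_kernel_Rn.

(** * Derivatives of the Gaussian in the time variable *)

Section gauss_profile.
Context {R : realType}.
Implicit Types (nu h c z a : R) (Q : {poly R}).

(** The recursion that d/dh imposes on the polynomial factor of
    h^(-nu-i) Q(c/h) exp(-c/h). *)
Fixpoint gpoly nu (i : nat) : {poly R} :=
  if i is i'.+1 then
    ('X - (nu + i'%:R)%:P) * gpoly nu i' - 'X * (gpoly nu i')^`()
  else 1.

(** The i-th derivative in h of h^(-nu) exp(-c/h). *)
Definition gprof nu i c h : R :=
  h `^ (- nu - i%:R) * ((gpoly nu i).[c / h] * expR (- (c / h))).

Lemma is_derive_gprof nu i c h : 0 < h ->
  is_derive h 1 (gprof nu i c) (gprof nu i.+1 c h).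
Proof.
move=> h0.
have h0' : h != 0 by rewrite gt_eqF.
pose z (k : R) := c * k^-1.
have dz : is_derive h 1 z (- (c * h ^- 2)).
  have dV := @is_deriveV R id h 1 1 h0' (is_derive_id _ _).
  apply: (is_derive_eq (@is_deriveZ R R R (fun k => k^-1) c h 1 _ dV)).
  by rewrite /= !scaleNr !scalerN /GRing.scale/= mulr1.
have dQ := @is_derive1_comp R (horner (gpoly nu i)) z h _ _ (is_derive_poly _ _) dz.
have dE := @is_derive1_comp R expR (fun k => - z k) h _ _ (is_derive_expR _) (@is_deriveN R R R z h 1 _ dz).
have dP := @is_derive1_powR R (- nu - i%:R) h h0.
have D := @is_deriveM R R _ _ h 1 _ _ dP (@is_deriveM R R _ _ h 1 _ _ dQ dE).
apply: (is_derive_eq D).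
rewrite /gprof /= /GRing.scale/= !fctE /z.
rewrite !(hornerD, hornerN, hornerM, hornerX, hornerC).
have -> : h `^ (- nu - i%:R) = h * h `^ (- nu - i.+1%:R).
  rewrite -[X in X * _](powRr1 (ltW h0)) -powRD; last by rewrite h0' implybT.
  by congr powR; rewrite -natr1; ring.
have -> : - nu - i%:R - 1 = - nu - i.+1%:R by rewrite -natr1; ring.
by field.
Qed.

Lemma horner_le_expR Q a : 0 < a ->
  exists2 C : R, 0 <= C & forall z, 0 <= z -> `|Q.[z]| <= C * expR (a * z).
Proof.
elim/poly_ind: Q a => [|Q c IH] a a0.
  by exists 0 => // z _; rewrite horner0 normr0 mul0r.
have [C C0 HC] := IH (a / 2) (divr_gt0 a0 (ltr0Sn _ _)).
exists (C * (2 / a) + `|c|) => [|z z0].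
  by rewrite addr_ge0 ?mulr_ge0 ?invr_ge0 ?(ltW a0).
rewrite hornerMXaddC (le_trans (ler_normD _ _))// mulrDl lerD//.
  rewrite normrM (ger0_norm z0).
  have zE : z <= 2 / a * expR (a / 2 * z).
    rewrite -ler_pdivrMl ?divr_gt0// invf_div.
    by apply: le_trans (expR_ge1Dx _); rewrite lerDr.
  apply: (le_trans (ler_pM (normr_ge0 _) z0 (HC _ z0) zE)).
  rewrite mulrACA -expRD ler_wpM2l ?mulr_ge0 ?invr_ge0 ?(ltW a0)//.
  by rewrite ler_expR; lra.
rewrite ler_peMr// -[leLHS]expR0 ler_expR mulr_ge0// ltW//.
Qed.

(** Half of the exponential absorbs the polynomial factor, which doubles the time
    in the remaining Gaussian. *)
Lemma gprof_bound nu i : exists2 C : R, 0 <= C & forall c h, 0 <= c -> 0 < h ->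
  `|gprof nu i c h| <= C * h `^ (- i%:R) * ((2 * h) `^ (- nu) * expR (- (c / (2 * h)))).
Proof.
have [C C0 HC] := @horner_le_expR (gpoly nu i) (2^-1) ltac:(by rewrite invr_gt0).
exists (C * 2 `^ nu) => [|c h c0 h0]; first by rewrite mulr_ge0 ?powR_ge0.
have z0 : 0 <= c / h by rewrite divr_ge0// ltW.
rewrite /gprof normrM (ger0_norm (powR_ge0 _ _)) normrM (ger0_norm (expR_ge0 _)).
have h0' : h != 0 by rewrite gt_eqF.
rewrite powRD ?h0' ?implybT//.
have -> : C * 2 `^ nu * h `^ (- i%:R) * ((2 * h) `^ (- nu) * expR (- (c / (2 * h)))) =
   h `^ (- nu) * h `^ (- i%:R) * (C * expR (- (c / (2 * h)))).
  rewrite powRM ?(ltW h0)// [2 `^ (- nu)]powRN.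
  by field; rewrite gt_eqF// powR_gt0.
rewrite ler_wpM2l ?mulr_ge0 ?powR_ge0//.
apply: (le_trans (ler_wpM2r (expR_ge0 _) (HC _ z0))).
rewrite -mulrA -expRD ler_wpM2l// ler_expR.
have -> : c / (2 * h) = 2^-1 * (c / h) by field.
by lra.
Qed.

End gauss_profile.

(** * Convolution with an abstract Gaussian kernel *)

Section gaussian_kernel.
Context {R : realType} d {T : measurableType d}.
Variable mu : {sigma_finite_measure set T -> \bar R}.
Variables (q : T -> T -> R) (nu : R).
Implicit Types (h k a : R) (x y : T) (i : nat) (w : T -> R).

(** The heat kernel with |x-y|^2 and n/2 replaced by abstract [q] and [nu]. The
    proofs below then only see the properties in [gauss_kernel]. *)
Definition gker h x y := (4 * pi * h) `^ (- nu) * expR (- (q x y / (4 * h))).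

Record gauss_kernel : Prop := GaussKernel {
  gauss_ge0 : forall x y, 0 <= q x y ;
  gauss_sym : forall x y, q x y = q y x ;
  gauss_measurable : measurable_fun [set: T * T] (fun z => q z.1 z.2) ;
  gauss_dim_ge0 : 0 <= nu ;
  gauss_mass : forall h x, 0 < h -> (\int[mu]_y (gker h x y)%:E = 1)%E ;
  gauss_conv : forall h k (x y : T), 0 < h -> 0 < k ->
    (\int[mu]_z (gker h x z * gker k z y)%:E = (gker (h + k) x y)%:E)%E }.

Hypothesis gaussP : gauss_kernel.
Let q_ge0 := gauss_ge0 gaussP.
Let qC := gauss_sym gaussP.
Let mq := gauss_measurable gaussP.
Let nu_ge0 := gauss_dim_ge0 gaussP.
Let int_gker := gauss_mass gaussP.
Let gker_conv := gauss_conv gaussP.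

(** The i-th derivative of [gker] in h. *)
Definition dgker i h x y := (4 * pi) `^ (- nu) * gprof nu i (q x y / 4) h.

Lemma gkerC h x y : gker h x y = gker h y x.
Proof. by rewrite /gker qC. Qed.

Lemma gker_ge0 h x y : 0 <= gker h x y.
Proof. by rewrite mulr_ge0 ?powR_ge0 ?expR_ge0. Qed.

Lemma gker_gt0 h x y : 0 < h -> 0 < gker h x y.
Proof. by move=> h0; rewrite mulr_gt0 ?expR_gt0 ?powR_gt0 ?mulr_gt0 ?pi_gt0. Qed.

Lemma dgkerC i h x y : dgker i h x y = dgker i h y x.
Proof. by rewrite /dgker qC. Qed.

Lemma dgker0 h x y : 0 < h -> dgker 0 h x y = gker h x y.
Proof.
move=> h0; rewrite /dgker /gprof /gker subr0 hornerC mul1r mulrA.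
rewrite -powRM ?mulr_ge0 ?pi_ge0 ?(ltW h0)//.
by congr (_ * expR (- _)); field; rewrite gt_eqF.
Qed.

Lemma is_derive_dgker i h x y : 0 < h ->
  is_derive h 1 (fun h => dgker i h x y) (dgker i.+1 h x y).
Proof.
move=> h0.
exact: (is_derive_eq (@is_deriveZ R R R _ ((4 * pi) `^ (- nu)) h 1 _ (is_derive_gprof nu i (q x y / 4) h0))).
Qed.

(** Passing to a later time costs only the ratio of the normalising factors. *)
Lemma gker_le h k x y : 0 < h -> h <= k -> gker h x y <= (k / h) `^ nu * gker k x y.
Proof.
move=> h0 hk; have k0 : 0 < k by exact: lt_le_trans hk.
have -> : (k / h) `^ nu * gker k x y = (4 * pi * h) `^ (- nu) * expR (- (q x y / (4 * k))).
  rewrite mulrA; congr (_ * _); rewrite !powRN.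
  have -> : 4 * pi * k = k / h * (4 * pi * h) by field; rewrite gt_eqF.
  rewrite [(_ / _ * _) `^ _]powRM ?divr_ge0 ?mulr_ge0 ?pi_ge0 ?(ltW h0) ?(ltW k0)//.
  field; rewrite !gt_eqF// powR_gt0 ?divr_gt0 ?mulr_gt0 ?pi_gt0//.
rewrite ler_wpM2l ?powR_ge0// ler_expR lerN2 ler_wpM2l//.
by rewrite lef_pV2 ?posrE ?mulr_gt0// ler_pM2l.
Qed.

Lemma gker_sup h x y : 0 < h -> gker h x y <= (4 * pi * h) `^ (- nu).
Proof.
move=> h0; rewrite ler_piMr ?powR_ge0// -[leRHS]expR0 ler_expR oppr_le0.
by rewrite divr_ge0 ?mulr_ge0 ?(ltW h0).
Qed.

Lemma dgker_bound i : exists2 C, 0 <= C & forall h x y, 0 < h ->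
  `|dgker i h x y| <= C * h `^ (- i%:R) * gker (2 * h) x y.
Proof.
have [C C0 HC] := gprof_bound nu i.
exists C => // h x y h0; rewrite /dgker normrM (ger0_norm (powR_ge0 _ _)).
apply: (le_trans (ler_wpM2l (powR_ge0 _ _) (HC _ _ _ h0))); first by rewrite divr_ge0.
apply: eq_imp_le.
rewrite /gker -[4 * pi * (2 * h)]/((4 * pi) * (2 * h)).
rewrite [in RHS]powRM ?mulr_ge0 ?pi_ge0 ?(ltW h0)//.
have -> : q x y / 4 / (2 * h) = q x y / (4 * (2 * h)).
  by field; rewrite gt_eqF.
by ring.
Qed.

Lemma measurable_gker2 h : measurable_fun [set: T * T] (fun z => gker h z.1 z.2).
Proof.
apply: measurable_funM => //; apply: measurableT_comp => //.
by apply: measurableT_comp => //; apply: measurable_funM.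
Qed.

Lemma measurable_dgker2 i h : measurable_fun [set: T * T] (fun z => dgker i h z.1 z.2).
Proof.
apply: measurable_funM => //; apply: measurable_funM => //.
have mqh : measurable_fun [set: T * T] (fun z => q z.1 z.2 / 4 / h).
  by apply: measurable_funM => //; apply: measurable_funM.
apply: measurable_funM.
  apply: (measurableT_comp _ mqh); apply: continuous_measurable_fun.
  move=> t; apply/differentiable_continuous/derivable1_diffP.
  exact: (@ex_derive _ _ _ _ _ _ _ (is_derive_poly (gpoly nu i) t)).
by apply: measurableT_comp => //; apply: measurableT_comp.
Qed.

Lemma measurable_gker h x : measurable_fun setT (gker h x).
Proof. exact: (measurableT_comp (measurable_gker2 h) (pair1_measurable x)). Qed.

Lemma measurable_dgker i h x : measurable_fun setT (dgker i h x).
Proof. exact: (measurableT_comp (measurable_dgker2 i h) (pair1_measurable x)). Qed.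

(** Extended-real valued, so that it can be handled before any integrability is
    known; at time h it dominates the heat evolution of w, and at time 2h its
    derivatives at time h, up to a factor C h^(-i). *)
Definition heat_abs h (w : T -> R) x : \bar R := (\int[mu]_y (gker h x y * `|w y|)%:E)%E.

Definition admissible (w : T -> R) := measurable_fun setT w /\
  forall h x, 0 < h -> (heat_abs h w x < +oo)%E.

(** The i-th derivative in h of the heat evolution of w. *)
Definition heat_deriv i h (w : T -> R) x : R := \int[mu]_y (dgker i h x y * w y).

Lemma measurable_gker_norm h x (w : T -> R) : measurable_fun setT w ->
  measurable_fun setT (fun y => (gker h x y * `|w y|)%:E).
Proof.
move=> mw; apply/measurable_EFinP; apply: measurable_funM; first exact: measurable_gker.
exact: measurableT_comp.
Qed.

Lemma heat_abs_ge0 h w x : (0 <= heat_abs h w x)%E.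
Proof. by apply: integral_ge0 => y _; rewrite lee_fin mulr_ge0 ?gker_ge0. Qed.

Lemma dgker_integral_bound i : exists2 C, 0 <= C & forall h w x, 0 < h ->
  measurable_fun setT w ->
  (\int[mu]_y `|(dgker i h x y * w y)%:E| <= (C * h `^ (- i%:R))%:E * heat_abs (2 * h) w x)%E.
Proof.
have [C C0 HC] := dgker_bound i; exists C => // h w x h0 mw.
rewrite -ge0_integralZl//; last 3 first.
- exact: measurable_gker_norm.
- by move=> y _; rewrite lee_fin mulr_ge0 ?gker_ge0.
- by rewrite lee_fin mulr_ge0 ?powR_ge0.
apply: ge0_le_integral => //.
- apply/measurable_EFinP; apply: measurableT_comp => //.
  by apply: measurable_funM => //; exact: measurable_dgker.
- by apply: measurable_funeM; exact: measurable_gker_norm.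
move=> y _; rewrite -EFinM lee_fin normrM mulrA ler_wpM2r//; exact: HC.
Qed.

Lemma admissible_integrable i h w x : admissible w -> 0 < h ->
  mu.-integrable setT (fun y => (dgker i h x y * w y)%:E).
Proof.
move=> [mw aw] h0; have [C C0 HC] := dgker_integral_bound i.
apply/integrableP; split.
  by apply/measurable_EFinP/measurable_funM => //; exact: measurable_dgker.
apply: (le_lt_trans (HC h w x h0 mw)).
by rewrite lte_mul_pinfty// ?lee_fin ?mulr_ge0 ?powR_ge0// aw// mulr_gt0.
Qed.

Lemma heat_deriv_bound i : exists2 C, 0 <= C & forall h w x, 0 < h -> admissible w ->
  (`|heat_deriv i h w x|%:E <= (C * h `^ (- i%:R))%:E * heat_abs (2 * h) w x)%E.
Proof.
have [C C0 HC] := dgker_integral_bound i; exists C => // h w x h0 aw.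
apply: le_trans (HC h w x h0 aw.1).
rewrite EFin_normr_Rintegral//; last exact: admissible_integrable.
apply: le_abse_integral => //.
by apply/measurable_EFinP/measurable_funM; [exact: measurable_dgker|exact: aw.1].
Qed.

(** Differentiation under the integral sign: for k near h the derivative of the
    kernel at time k is dominated by a Gaussian at a fixed later time. *)
Lemma is_derive_heat_deriv i h w x : 0 < h -> admissible w ->
  is_derive h 1 (fun h => heat_deriv i h w x) (heat_deriv i.+1 h w x).
Proof.
move=> h0 aw.
have [C C0 HC] := dgker_bound i.+1.
pose f (k : R) y := dgker i k x y * w y.
pose G y := C * (h / 2) `^ (- i.+1%:R) * 4 `^ nu * (gker (4 * h) x y * `|w y|).
have h2 : 0 < h / 2 by rewrite divr_gt0.
have df (k : R) y : 0 < k -> is_derive k 1 (f ^~ y) (dgker i.+1 k x y * w y).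
  move=> k0.
  have := @is_deriveZ R R R _ (w y) k 1 _ (is_derive_dgker i x y k0).
  rewrite (_ : (w y \*: (fun k => dgker i k x y)) = f ^~ y); last first.
    by apply/funext => z; rewrite /f mulrC.
  by rewrite mulrC.
have Ih : `](h / 2), (2 * h)[%classic h by rewrite /= in_itv/=; apply/andP; split; lra.
have intf k : `](h / 2), (2 * h)[%classic k -> mu.-integrable setT (EFin \o f k).
  rewrite /= in_itv/= => /andP[k1 _]; apply: admissible_integrable => //; exact: lt_trans k1.
have derf k y : `](h / 2), (2 * h)[%classic k -> setT y -> derivable (f ^~ y) k 1.
  rewrite /= in_itv/= => /andP[k1 _] _.
  exact: (@ex_derive _ _ _ _ _ _ _ (df k y (lt_trans h2 k1))).
have G0 y : 0 <= G y by rewrite /G !mulr_ge0 ?powR_ge0 ?gker_ge0.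
have intG : mu.-integrable setT (EFin \o G).
  apply: (eq_integrable measurableT (fun y => (C * (h / 2) `^ (- i.+1%:R) * 4 `^ nu)%:E * (gker (4 * h) x y * `|w y|)%:E)%E) => //.
  apply: integrableZl => //; apply/integrableP; split.
    by apply: measurable_gker_norm; exact: aw.1.
  have -> : (\int[mu]_y `|(gker (4 * h) x y * `|w y|)%:E| = heat_abs (4 * h) w x)%E.
    by apply: eq_integral => y _; rewrite gee0_abs// lee_fin mulr_ge0 ?gker_ge0.
  by apply: aw.2; rewrite mulr_gt0.
have Gub k y : `](h / 2), (2 * h)[%classic k -> setT y ->
    `|partial1of2 f k y| <= G y.
  rewrite /= in_itv/= => /andP[k1 k2] _.
  have k0 : 0 < k by exact: lt_trans k1.
  rewrite partial1of2E (@derive_val _ _ _ _ _ _ _ (df k y k0)).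
  rewrite normrM /G mulrA ler_wpM2r//.
  apply: (le_trans (HC k x y k0)).
  rewrite -!mulrA ler_wpM2l//; apply: ler_pM; rewrite ?powR_ge0 ?gker_ge0//.
    by rewrite !powRN lef_pV2 ?posrE ?powR_gt0// ge0_ler_powR ?nnegrE ?(ltW k0) ?(ltW k1) ?(ltW h2).
  apply: (le_trans (@gker_le _ (4 * h) _ _ _ _)); [by rewrite mulr_gt0|lra|].
  rewrite ler_wpM2r ?gker_ge0// ge0_ler_powR ?nnegrE ?divr_ge0 ?mulr_ge0 ?(ltW k0) ?(ltW h0)//.
  by rewrite ler_pdivrMr ?mulr_gt0//; lra.
have D1 := @derivable_under_integral R d T mu f setT measurableT h (h / 2) (2 * h) Ih intf derf G G0 intG Gub.
have D2 := @differentiation_under_integral R d T mu f setT measurableT h (h / 2) (2 * h) Ih intf derf G G0 intG Gub.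
apply: DeriveDef => //.
rewrite -derive1E D2; apply: eq_Rintegral => y _.
by rewrite partial1of2E (@derive_val _ _ _ _ _ _ _ (df h y h0)).
Qed.

Lemma measurable_gker_norm2 h w : measurable_fun setT w ->
  measurable_fun [set: T * T] (fun z => (gker h z.1 z.2 * `|w z.2|)%:E).
Proof.
move=> mw; apply/measurable_EFinP; apply: measurable_funM; first exact: measurable_gker2.
by apply: measurableT_comp => //; exact: (measurableT_comp mw measurable_snd).
Qed.

Lemma measurable_heat_abs h w : measurable_fun setT w -> measurable_fun setT (heat_abs h w).
Proof.
move=> mw.
apply: (@measurable_fun_fubini_tonelli_F _ _ _ _ _ mu (fun z => (gker h z.1 z.2 * `|w z.2|)%:E)).
  exact: measurable_gker_norm2.
by move=> z; rewrite lee_fin mulr_ge0 ?gker_ge0.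
Qed.

Lemma heat_abs_semigroup h k w x : 0 < h -> 0 < k -> measurable_fun setT w ->
  (\int[mu]_z ((gker h x z)%:E * heat_abs k w z) = heat_abs (h + k) w x)%E.
Proof.
move=> h0 k0 mw.
have mg := measurable_gker_norm2 k mw.
transitivity (\int[mu]_z \int[mu]_y ((gker h x z)%:E * (gker k z y * `|w y|)%:E))%E.
  apply: eq_integral => z _; rewrite ge0_integralZl//.
  - exact: measurable_gker_norm.
  - by move=> y _; rewrite lee_fin mulr_ge0 ?gker_ge0.
  - by rewrite lee_fin gker_ge0.
rewrite (@fubini_tonelli _ _ _ _ _ mu mu (fun z => (gker h x z.1)%:E * (gker k z.1 z.2 * `|w z.2|)%:E)%E); last 2 first.
- apply: emeasurable_funM => //; apply/measurable_EFinP.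
  exact: (measurableT_comp (measurable_gker h x) measurable_fst).
- by move=> z; rewrite mule_ge0// lee_fin ?gker_ge0// mulr_ge0 ?gker_ge0.
apply: eq_integral => y _ /=; rewrite EFinM muleC -gker_conv// -ge0_integralZl//.
- by apply: eq_integral => z _; rewrite -!EFinM; congr EFin; ring.
- apply/measurable_EFinP/measurable_funM; first exact: measurable_gker.
  by under eq_fun do rewrite gkerC; exact: measurable_gker.
- by move=> z _; rewrite lee_fin mulr_ge0 ?gker_ge0.
Qed.

Lemma integral_heat_abs h w : 0 < h -> measurable_fun setT w ->
  (\int[mu]_x heat_abs h w x = \int[mu]_x `|w x|%:E)%E.
Proof.
move=> h0 mw.
rewrite (@fubini_tonelli _ _ _ _ _ mu mu (fun z => (gker h z.1 z.2 * `|w z.2|)%:E)); last 2 first.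
- exact: measurable_gker_norm2.
- by move=> z; rewrite lee_fin mulr_ge0 ?gker_ge0.
apply: eq_integral => y _ /=.
rewrite -[RHS]mule1 -(int_gker y h0) -ge0_integralZl//.
- by apply: eq_integral => z _; rewrite -EFinM gkerC mulrC.
- by apply/measurable_EFinP; exact: measurable_gker.
- by move=> z _; rewrite lee_fin gker_ge0.
Qed.

Lemma heat_abs_le h k w x : 0 < h -> h <= k -> measurable_fun setT w ->
  (heat_abs h w x <= ((k / h) `^ nu)%:E * heat_abs k w x)%E.
Proof.
move=> h0 hk mw; rewrite -ge0_integralZl//; last 3 first.
- exact: measurable_gker_norm.
- by move=> y _; rewrite lee_fin mulr_ge0 ?gker_ge0.
- by rewrite lee_fin powR_ge0.
apply: ge0_le_integral => //.
- by move=> y _; rewrite lee_fin mulr_ge0 ?gker_ge0.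
- exact: measurable_gker_norm.
- by apply: measurable_funeM; exact: measurable_gker_norm.
by move=> y _; rewrite -EFinM lee_fin mulrA ler_wpM2r// gker_le.
Qed.

Lemma admissible_gker k x : 0 < k -> admissible (gker k x).
Proof.
move=> k0; split=> [|h z h0]; first exact: measurable_gker.
have -> : heat_abs h (gker k x) z = (gker (h + k) z x)%:E; last by rewrite ltry.
rewrite -gker_conv//; apply: eq_integral => y _.
by rewrite ger0_norm ?gker_ge0// (gkerC k).
Qed.

(** Differentiating the semigroup identity of the kernels in h. *)
Lemma heat_deriv_gker i h k x y : 0 < h -> 0 < k ->
  heat_deriv i h (gker k x) y = dgker i (h + k) y x.
Proof.
move=> + k0; elim: i h => [|i IH] h h0.
  rewrite dgker0 ?addr_gt0//.
  transitivity (fine (\int[mu]_z (gker h y z * gker k z x)%:E)%E); last by rewrite gker_conv.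
  by congr fine; apply: eq_integral => z _; rewrite dgker0// (gkerC k).
have D1 := is_derive_heat_deriv i y h0 (admissible_gker x k0).
have hk : 0 < h + k by rewrite addr_gt0.
have D2 : is_derive h 1 (fun h => dgker i (h + k) y x) (dgker i.+1 (h + k) y x).
  have := @is_derive1_comp R (fun h => dgker i h y x) (fun h => h + k) h _ _
    (is_derive_dgker i y x hk) (is_deriveD (is_derive_id h 1) (is_derive_cst k h 1)).
  by rewrite addr0 mulr1.
rewrite -(@derive_val _ _ _ _ _ _ _ D1) -(@derive_val _ _ _ _ _ _ _ D2).
by apply: near_eq_derive; near=> t; apply: IH; near: t; exact: lt_nbhsr.
Unshelve. end_near. Qed.

Lemma measurable_heat_deriv i h w : admissible w -> 0 < h -> measurable_fun setT (heat_deriv i h w).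
Proof.
move=> aw h0.
pose f (z : T * T) := (dgker i h z.1 z.2 * w z.2)%:E.
have mf : measurable_fun setT f.
  apply/measurable_EFinP/measurable_funM; first exact: measurable_dgker2.
  exact: (measurableT_comp aw.1 measurable_snd).
apply: (measurableT_comp (f := fine)) => //.
rewrite (_ : (fun x => _) = (fun x => \int[mu]_y (f^\+ (x, y)) - \int[mu]_y (f^\- (x, y))))%E.
  apply: emeasurable_funB.
    apply: (@measurable_fun_fubini_tonelli_F _ _ _ _ _ mu (f^\+)%E) => //; exact: measurable_funepos.
  apply: (@measurable_fun_fubini_tonelli_F _ _ _ _ _ mu (f^\-)%E) => //; exact: measurable_funeneg.
apply/funext => x; rewrite integralE; congr (_ - _)%E.
  by apply: eq_integral => y _; rewrite unlock.
by apply: eq_integral => y _; rewrite unlock.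
Qed.

(** The i-th derivative at time h + k is the heat evolution over a further time k
    of the i-th derivative at time h, by [heat_deriv_gker] and Fubini's theorem. *)
Lemma heat_deriv_semigroup_le i h k w x : admissible w -> 0 < h -> 0 < k ->
  (`|heat_deriv i (h + k) w x|%:E <= heat_abs k (heat_deriv i h w) x)%E.
Proof.
move=> aw h0 k0.
pose phi (p : T * T) := (gker k x p.2 * (dgker i h p.2 p.1 * w p.1))%:E.
have mphi : measurable_fun setT phi.
  apply/measurable_EFinP/measurable_funM.
    exact: (measurableT_comp (measurable_gker k x) measurable_snd).
  apply: measurable_funM; last exact: (measurableT_comp aw.1 measurable_fst).
  rewrite (_ : (fun p : T * T => _) = (fun p => dgker i h p.1 p.2)); first exact: measurable_dgker2.
  by apply/funext => p; rewrite dgkerC.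
have [C C0 HC] := dgker_bound i.
have iphi : (mu \x mu)%E.-integrable setT phi.
  apply/integrable12ltyP => //.
  apply: (@le_lt_trans _ _ ((C * h `^ (- i%:R))%:E * heat_abs (k + 2 * h) w x)%E); last first.
    by rewrite lte_mul_pinfty ?lee_fin ?mulr_ge0 ?powR_ge0// aw.2 ?addr_gt0 ?mulr_gt0.
  rewrite -ge0_integralZl//; last 3 first.
  - by apply: measurable_gker_norm; exact: aw.1.
  - by move=> y _; rewrite lee_fin mulr_ge0 ?gker_ge0.
  - by rewrite lee_fin mulr_ge0 ?powR_ge0.
  apply: ge0_le_integral => //.
  - by move=> y _; exact: integral_ge0.
  - apply: (@measurable_fun_fubini_tonelli_F _ _ _ _ _ mu (fun p => `|phi p|%E)) => //.
    exact: measurableT_comp.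
  - by apply: measurable_funeM; apply: measurable_gker_norm; exact: aw.1.
  move=> y _.
  have -> : ((C * h `^ (- i%:R))%:E * (gker (k + 2 * h) x y * `|w y|)%:E)%E =
      ((C * h `^ (- i%:R) * `|w y|)%:E * (gker (k + 2 * h) x y)%:E)%E.
    by rewrite -!EFinM; congr EFin; ring.
  rewrite -gker_conv ?mulr_gt0// -ge0_integralZl//; last 3 first.
  - apply/measurable_EFinP/measurable_funM; first exact: measurable_gker.
    by under eq_fun do rewrite gkerC; exact: measurable_gker.
  - by move=> z _; rewrite lee_fin mulr_ge0 ?gker_ge0.
  - by rewrite lee_fin !mulr_ge0 ?powR_ge0.
  apply: ge0_le_integral => //.
  - by apply: measurableT_comp => //; exact: (measurableT_comp mphi (pair1_measurable y)).
  - apply: measurable_funeM; apply/measurable_EFinP.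
    apply: measurable_funM; first exact: measurable_gker.
    by under eq_fun do rewrite gkerC; exact: measurable_gker.
  move=> z _; rewrite -EFinM lee_fin /= normrM (ger0_norm (gker_ge0 _ _ _)) normrM.
  have -> : C * h `^ (- i%:R) * `|w y| * (gker k x z * gker (2 * h) z y) =
      gker k x z * (C * h `^ (- i%:R) * gker (2 * h) z y * `|w y|) by ring.
  by rewrite ler_wpM2l ?gker_ge0// ler_wpM2r//; exact: HC.
have hk : 0 < h + k by rewrite addr_gt0.
have E : (heat_deriv i (h + k) w x)%:E = (\int[mu]_z (gker k x z * heat_deriv i h w z)%:E)%E.
  rewrite /heat_deriv /Rintegral fineK; last first.
    by apply: integrable_fin_num => //; exact: admissible_integrable.
  transitivity (\int[mu]_y \int[mu]_z phi (y, z))%E.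
    apply: eq_integral => y _; rewrite (dgkerC i _ x y) -(heat_deriv_gker i x y h0 k0) /phi/=.
    have iy := admissible_integrable i y (admissible_gker x k0) h0.
    rewrite EFinM /heat_deriv /Rintegral fineK; last exact: integrable_fin_num.
    rewrite -integralZr//; apply: eq_integral => z _.
    by rewrite -EFinM (dgkerC i h z); congr EFin; ring.
  rewrite Fubini//; apply: eq_integral => z _; rewrite /phi/=.
  have iz := admissible_integrable i z aw h0.
  rewrite EFinM fineK; last exact: integrable_fin_num.
  by rewrite -integralZl.
rewrite [leLHS](_ : _ = `|(heat_deriv i (h + k) w x)%:E|%E)// E.
have mk : measurable_fun setT (fun z => (gker k x z * heat_deriv i h w z)%:E).
  apply/measurable_EFinP/measurable_funM; first exact: measurable_gker.
  exact: measurable_heat_deriv.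
apply: (le_trans (le_abse_integral mu measurableT mk)).
apply: eq_imp_le; apply: eq_integral => z _.
by rewrite /= normrM (ger0_norm (gker_ge0 _ _ _)).
Qed.

Lemma measure_gt_le (g : T -> \bar R) (b : R) : 0 < b ->
  measurable_fun setT g -> (forall x, 0 <= g x)%E ->
  (b%:E * mu [set x | (b%:E < g x)%E] <= \int[mu]_x g x)%E.
Proof.
move=> b0 mg g0.
have mE : measurable [set x | (b%:E < g x)%E].
  rewrite -[X in measurable X]setTI; exact: emeasurable_fun_o_infty.
rewrite -integral_cst//.
apply: (@le_trans _ _ (\int[mu]_(x in [set x | (b%:E < g x)%E]) g x)%E).
  apply: ge0_le_integral => //.
  - by move=> x _; rewrite lee_fin ltW.
  - exact: measurable_funTS.
  - by move=> x /= /ltW.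
by apply: ge0_subset_integral.
Qed.

(** Jensen's inequality, in a form that needs no finiteness: integrate the
    tangent line of u |-> u^p at a against the kernel. *)
Lemma heat_abs_powR p h w x a : 1 <= p -> 0 < h -> 0 < a -> measurable_fun setT w ->
  (a%:E < heat_abs h w x)%E ->
  ((a `^ p)%:E < heat_abs h (fun y => (`|w y| `^ p)%R) x)%E.
Proof.
move=> p1 h0 a0 mw aw.
have p0 : 0 < p by exact: lt_le_trans p1.
have mwp : measurable_fun setT (fun y => `|w y| `^ p).
  by apply: (measurableT_comp (measurable_powR p)); exact: measurableT_comp.
(* Young's inequality for u and a^(p-1) is the tangent line inequality at a. *)
have tan u : 0 <= u -> a `^ p + p * a `^ (p - 1) * (u - a) <= u `^ p.
  move=> u0.
  have aE : a `^ p = a * a `^ (p - 1).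
    transitivity (a `^ (1 + (p - 1))); first by congr (_ `^ _); ring.
    by rewrite powRD ?powRr1 ?ltW// (gt_eqF a0) implybT.
  have [->|p_neq1] := eqVneq p 1.
    by rewrite subrr powRr0 !powRr1//; lra.
  have p10 : 0 < p - 1 by rewrite subr_gt0 lt_neqAle eq_sym p_neq1.
  have q0 : 0 < p / (p - 1) by rewrite divr_gt0.
  have pq : p^-1 + (p / (p - 1))^-1 = 1 by field; rewrite !gt_eqF.
  have := @conjugate_powR R u (a `^ (p - 1)) p (p / (p - 1)) u0 (powR_ge0 _ _) p0 q0 pq.
  rewrite -powRrM (_ : (p - 1) * (p / (p - 1)) = p); last by field; rewrite gt_eqF.
  rewrite invf_div -(ler_pM2l p0) => H.
  have E1 : p * (u `^ p / p + a `^ p * ((p - 1) / p)) = u `^ p + (p - 1) * a `^ p.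
    by field; rewrite gt_eqF.
  rewrite E1 in H; rewrite aE in H *; nra.
have [->|fin] := eqVneq (heat_abs h (fun y => (`|w y| `^ p)%R) x) +oo%E; first by rewrite ltry.
have wpE y : `| `|w y| `^ p| = `|w y| `^ p by rewrite ger0_norm ?powR_ge0.
pose c := p * a `^ (p - 1).
have c0 : 0 < c by rewrite mulr_gt0 ?powR_gt0.
have key : (c%:E * heat_abs h w x + (a `^ p)%:E <= heat_abs h (fun y => (`|w y| `^ p)%R) x + (c * a)%:E)%E.
  have intE (v : T -> R) r s : measurable_fun setT v -> 0 <= r -> 0 <= s ->
    (r%:E * heat_abs h v x + s%:E = \int[mu]_y (gker h x y * (r * `|v y| + s))%:E)%E.
    move=> mv r0 s0; rewrite -[s%:E]mule1 -(int_gker x h0) -!ge0_integralZl//.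
    - rewrite -ge0_integralD//.
      + by apply: eq_integral => y _; rewrite -!EFinM -EFinD; congr EFin; ring.
      + by move=> y _; rewrite mule_ge0 ?lee_fin// mulr_ge0 ?gker_ge0.
      + by apply: measurable_funeM; exact: measurable_gker_norm.
      + by move=> y _; rewrite mule_ge0 ?lee_fin// gker_ge0.
      + by apply: measurable_funeM; apply/measurable_EFinP; exact: measurable_gker.
    - by apply/measurable_EFinP; exact: measurable_gker.
    - by move=> y _; rewrite lee_fin gker_ge0.
    - exact: measurable_gker_norm.
    - by move=> y _; rewrite lee_fin mulr_ge0 ?gker_ge0.
  rewrite -[X in (_ <= X + _)%E]mul1e !intE ?powR_ge0 ?(ltW c0)// ?(mulr_ge0 (ltW c0) (ltW a0))//.
  apply: ge0_le_integral => //.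
  - by move=> y _; rewrite lee_fin mulr_ge0 ?gker_ge0// addr_ge0 ?powR_ge0// mulr_ge0// ltW.
  - apply/measurable_EFinP/measurable_funM; first exact: measurable_gker.
    by apply: measurable_funD => //; apply: measurable_funM => //; exact: measurableT_comp.
  - apply/measurable_EFinP/measurable_funM; first exact: measurable_gker.
    by apply: measurable_funD => //; apply: measurable_funM => //; exact: measurableT_comp.
  move=> y _; rewrite lee_fin ler_wpM2l ?gker_ge0// wpE mul1r.
  by have := tan _ (normr_ge0 (w y)); rewrite /c; lra.
have gfin : heat_abs h (fun y => (`|w y| `^ p)%R) x \is a fin_num.
  by rewrite fin_numE fin andbT gt_eqF// (lt_le_trans _ (heat_abs_ge0 _ _ _)).
have wfin : heat_abs h w x \is a fin_num.
  rewrite fin_numE gt_eqF ?(lt_le_trans _ (heat_abs_ge0 _ _ _))//=.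
  apply/negP => /eqP E; move: key; rewrite E gt0_muley ?lte_fin// addye// -(fineK gfin).
  by rewrite -EFinD leye_eq.
move: key aw; rewrite -(fineK gfin) -(fineK wfin) -EFinM -!EFinD lee_fin !lte_fin.
by move=> k1 k2; have := c0; nra.
Qed.

Lemma Lnorm_pow (p N : R) w : 0 < p -> 0 <= N ->
  ('N[mu]_p%:E [EFin \o w] <= N%:E)%E ->
  (\int[mu]_x (`|w x| `^ p)%:E <= (N `^ p)%:E)%E.
Proof.
move=> p0 N0; rewrite unlock.
have -> : (\int[mu]_x `|(EFin \o w) x| `^ p = \int[mu]_x (`|w x| `^ p)%:E)%E.
  by apply: eq_integral => x _ /=.
set I := (\int[mu]_x _)%E.
have I0 : (0 <= I)%E by apply: integral_ge0 => x _; rewrite lee_fin powR_ge0.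
move=> H.
have -> : (I = (I `^ p^-1) `^ p)%E.
  by rewrite -poweRrM mulVf ?gt_eqF// poweRe1.
rewrite -poweR_EFin; apply: gt0_ler_poweR => //; first exact: ltW.
- by rewrite in_itv/= leey andbT poweR_ge0.
- by rewrite in_itv/= leey andbT lee_fin.
Qed.

(** Chebyshev's inequality for the average of |w|^p, which dominates the p-th
    power of the average of |w|. For p = oo the average never exceeds the
    essential supremum, so the set is null. *)
Lemma heat_abs_weak_type (p : \bar R) h w (N t : R) : (1 <= p)%E -> 0 < h ->
  measurable_fun setT w -> 0 < N -> 0 < t ->
  ('N[mu]_p [EFin \o w] <= N%:E)%E ->
  (mu [set x | ((N * t `^ (- fine p^-1))%:E < heat_abs h w x)%E] <= t%:E)%E.
Proof.
move=> p1 h0 mw N0 t0 HN; case: p p1 HN => [p| |//] p1 HN.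
  rewrite lee_fin in p1; have p0 : 0 < p by exact: lt_le_trans p1.
  rewrite inver gt_eqF//=.
  set a := N * _; have a0 : 0 < a by rewrite mulr_gt0 ?powR_gt0.
  have mwp : measurable_fun setT (fun y => `|w y| `^ p).
    by apply: (measurableT_comp (measurable_powR p)); exact: measurableT_comp.
  have apE : a `^ p = N `^ p / t.
    rewrite /a powRM ?powR_ge0 ?(ltW N0)// -powRrM mulNr mulVf ?gt_eqF//.
    by rewrite powR_inv1 ?ltW.
  have ap0 : 0 < a `^ p by rewrite powR_gt0.
  have H1 := measure_gt_le ap0 (measurable_heat_abs h mwp) (fun x => heat_abs_ge0 h _ x).
  have H2 : (mu [set x | a%:E < heat_abs h w x] <=
      mu [set x | (a `^ p)%:E < heat_abs h (fun y => (`|w y| `^ p)%R) x])%E.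
    apply: le_measure; rewrite ?inE.
    - rewrite -[X in measurable X]setTI; apply: emeasurable_fun_o_infty => //.
      exact: measurable_heat_abs.
    - rewrite -[X in measurable X]setTI; apply: emeasurable_fun_o_infty => //.
      exact: measurable_heat_abs.
    - by move=> x /=; exact: heat_abs_powR.
  apply: (le_trans H2).
  rewrite -(@lee_pmul2l _ (a `^ p)%:E)// ?lte_fin//.
  apply: (le_trans H1); rewrite integral_heat_abs// -EFinM apE divfK ?gt_eqF//.
  apply: (le_trans _ (Lnorm_pow p0 (ltW N0) HN)).
  apply: eq_imp_le; apply: eq_integral => y _.
  by rewrite ger0_norm ?powR_ge0.
rewrite invey/= oppr0 powRr0 mulr1.
suff : mu [set x | (N%:E < heat_abs h w x)%E] = 0%E by move=> ->; rewrite lee_fin ltW.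
move: HN; rewrite unlock; case: ifPn => [mT HN|]; last first.
  rewrite -leNgt => mT _; apply/eqP; rewrite eq_le measure_ge0 andbT.
  apply: le_trans mT; apply: le_measure; rewrite ?inE//.
  rewrite -[X in measurable X]setTI; apply: emeasurable_fun_o_infty => //.
  exact: measurable_heat_abs.
suff -> : [set x | (N%:E < heat_abs h w x)%E] = set0 by rewrite measure0.
apply/seteqP; split => // x /=; apply/negP; rewrite -leNgt.
move/ess_supP : HN => HN.
have -> : (N%:E = \int[mu]_y (N%:E * (gker h x y)%:E))%E.
  rewrite ge0_integralZl//.
  - by rewrite int_gker// mule1.
  - by apply/measurable_EFinP; exact: measurable_gker.
  - by move=> y _; rewrite lee_fin gker_ge0.
  - by rewrite lee_fin ltW.
apply: ae_ge0_le_integral => //.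
- by move=> y _; rewrite lee_fin mulr_ge0 ?gker_ge0.
- exact: measurable_gker_norm.
- by move=> y _; rewrite mule_ge0// lee_fin ?gker_ge0// ltW.
- by apply: measurable_funeM; apply/measurable_EFinP; exact: measurable_gker.
apply: filterS HN => y /=; rewrite !lee_fin mulrC => wN _.
by rewrite ler_wpM2r ?gker_ge0.
Qed.

(** Shared by the functions of L^1 + L^oo with finite distribution function
    ([level_integrable_split]). It makes the heat evolution tend to 0 as the time
    tends to infinity, which fails for bounded functions in general. *)
Definition level_integrable w := measurable_fun setT w /\ forall e : R, 0 < e ->
  (\int[mu]_(y in [set y | (e < `|w y|)%R]) `|w y|%:E < +oo)%E.

Lemma level_integrable_split w (g : T -> R) (K : R) : measurable_fun setT w ->
  (forall e : R, 0 < e -> (mu [set y | (e < `|w y|)%R] < +oo)%E) ->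
  mu.-integrable setT (EFin \o g) -> 0 <= K ->
  {ae mu, forall y, `|w y| <= `|g y| + K} -> level_integrable w.
Proof.
move=> mw wfin ig K0 wg; split => // e e0.
set E := [set y | _].
have mnw : measurable_fun setT (fun y => `|w y|) by exact: measurableT_comp.
have mE : measurable E.
  rewrite -[X in measurable X]setTI.
  by have := @measurable_fun_ltr _ _ _ setT (cst e) _ (@measurable_cst _ _ _ _ setT e) mnw measurableT [set true] _; apply.
have /integrableP[mg gfin] := ig.
have mng : measurable_fun setT (fun y => `|g y|%:E).
  by apply/measurable_EFinP; apply: measurableT_comp => //; apply/measurable_EFinP.
apply: (@le_lt_trans _ _ (\int[mu]_(y in E) (`|g y|%:E + cst K%:E y))%E).
  apply: ae_ge0_le_integral => //.
  - by apply/measurable_EFinP/measurable_funTS.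
  - by move=> y _; rewrite adde_ge0// lee_fin.
  - by apply: emeasurable_funD => //; exact: measurable_funTS.
  by apply: filterS wg => y wgy _; rewrite -EFinD lee_fin.
rewrite ge0_integralD//; last exact: measurable_funTS.
rewrite lte_add_pinfty//; last first.
  by rewrite integral_cst// lte_mul_pinfty ?lee_fin// wfin.
by apply: le_lt_trans gfin; apply: ge0_subset_integral.
Qed.

Lemma heat_deriv0_fine (f : T -> \bar R) h x : 0 < h -> measurable_fun setT f ->
  {ae mu, forall y, f y \is a fin_num} ->
  fine (\int[mu]_y ((gker h x y)%:E * f y))%E = heat_deriv 0 h (fine \o f) x.
Proof.
move=> h0 mf ff; congr fine.
have mgk : measurable_fun setT (fun y => (gker h x y)%:E).
  by apply/measurable_EFinP; exact: measurable_gker.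
apply: ae_eq_integral => //.
- exact: emeasurable_funM.
- apply/measurable_EFinP/measurable_funM; first exact: measurable_dgker.
  exact: measurableT_comp.
by apply: filterS ff => y fy _; rewrite -[in LHS](fineK fy) -EFinM /= dgker0.
Qed.

(** The whole block h' + k <= h <= h' + K is controlled by one average of the
    derivative at time h', which is what turns a bound at one time into a bound
    on the supremum over the block. *)
Lemma heat_deriv_block i h h' k K w x : admissible w -> 0 < h' -> 0 < k -> h' + k <= h -> h <= h' + K ->
  (`|heat_deriv i h w x|%:E <= ((K / k) `^ nu)%:E * heat_abs K (heat_deriv i h' w) x)%E.
Proof.
move=> aw h'0 k0 hk hK.
have hh : 0 < h - h' by lra.
have mk := measurable_heat_deriv i aw h'0.
have -> : h = h' + (h - h') by ring.
apply: (le_trans (heat_deriv_semigroup_le i x aw h'0 hh)).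
have hhK : h - h' <= K by lra.
apply: (le_trans (heat_abs_le x hh hhK mk)).
rewrite lee_wpmul2r ?heat_abs_ge0// lee_fin ge0_ler_powR ?nnegrE//.
- by rewrite divr_ge0; lra.
- by rewrite divr_ge0; lra.
by rewrite ler_pM2l ?lef_pV2 ?posrE//; lra.
Qed.

(** Split w at level e: the small part averages to at most e, and the large part
    is integrable while the kernel is at most (4 pi h)^(-nu). *)
Lemma heat_abs_level_integrable w e : level_integrable w -> 0 < e ->
  exists2 A, 0 <= A & forall h x, 0 < h -> (heat_abs h w x <= (e + A * h `^ (- nu))%:E)%E.
Proof.
move=> [mw sw] e0.
set E := [set y | (e < `|w y|)%R].
have mnw : measurable_fun setT (fun y => `|w y|) by exact: measurableT_comp.
have mE : measurable E.
  rewrite -[X in measurable X]setTI.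
  by have := @measurable_fun_ltr _ _ _ setT (cst e) _ (@measurable_cst _ _ _ _ setT e) mnw measurableT [set true] _; apply.
set I := (\int[mu]_(y in E) `|w y|%:E)%E.
have I0 : (0 <= I)%E by apply: integral_ge0 => y _; rewrite lee_fin.
have Ifin : I \is a fin_num by rewrite ge0_fin_numE// sw.
exists ((4 * pi) `^ (- nu) * fine I) => [|h x h0]; first by rewrite mulr_ge0 ?powR_ge0 ?fine_ge0.
have mEw : measurable_fun setT (fun y => `|w y| * \1_E y).
  by apply: measurable_funM => //; exact: measurable_indic.
apply: (@le_trans _ _ (\int[mu]_y (e%:E * (gker h x y)%:E +
    ((4 * pi * h) `^ (- nu))%:E * (`|w y| * \1_E y)%:E))%E).
  apply: ge0_le_integral => //.
  - by move=> y _; rewrite lee_fin mulr_ge0 ?gker_ge0.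
  - exact: measurable_gker_norm.
  - apply: emeasurable_funD.
      by apply: measurable_funeM; apply/measurable_EFinP; exact: measurable_gker.
    by apply: measurable_funeM; apply/measurable_EFinP.
  move=> y _; rewrite -!EFinM -EFinD lee_fin indicE.
  have [yE|yE] := boolP (y \in E).
    rewrite mulr1; apply: ler_wpDl; first by rewrite mulr_ge0 ?(ltW e0) ?gker_ge0.
    by rewrite ler_wpM2r// gker_sup.
  rewrite !mulr0 addr0 mulrC ler_wpM2r ?gker_ge0// leNgt; apply/negP => H.
  by move/negP: yE; apply; rewrite inE.
rewrite ge0_integralD//; last 4 first.
- by move=> y _; rewrite mule_ge0// lee_fin ?gker_ge0// ltW.
- by apply: measurable_funeM; apply/measurable_EFinP; exact: measurable_gker.
- by move=> y _; rewrite mule_ge0// lee_fin ?powR_ge0// mulr_ge0// indicE.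
- by apply: measurable_funeM; apply/measurable_EFinP.
rewrite ge0_integralZl//; last 3 first.
- by apply/measurable_EFinP; exact: measurable_gker.
- by move=> y _; rewrite lee_fin gker_ge0.
- by rewrite lee_fin ltW.
rewrite int_gker// mule1 ge0_integralZl//; last 2 first.
- exact/measurable_EFinP.
- by rewrite lee_fin powR_ge0.
have -> : (\int[mu]_y (`|w y| * \1_E y)%:E = I)%E.
  rewrite /I [RHS]integral_mkcond; apply: eq_integral => y _.
  by rewrite patchE indicE; case: ifP => _; rewrite ?mulr1 ?mulr0.
rewrite -[X in (_ + _ * X)%E](fineK Ifin) -EFinM -EFinD lee_fin lerD2l.
by rewrite powRM ?mulr_ge0 ?pi_ge0 ?(ltW h0)// mulrAC.
Qed.

Lemma level_integrable_admissible w : level_integrable w -> admissible w.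
Proof.
move=> sw; split; first exact: sw.1.
move=> h x h0; have [A _ HA] := heat_abs_level_integrable sw ltr01.
by apply: (le_lt_trans (HA h x h0)); rewrite ltry.
Qed.

(** The derivative gains h^(-i) over the evolution itself, and the latter tends to
    0 by [heat_abs_level_integrable]. *)
Lemma heat_deriv_decay i w x : 0 < nu -> level_integrable w ->
  forall e : R, 0 < e -> exists2 M, 0 < M & forall h, M < h -> h ^+ i * `|heat_deriv i h w x| <= e.
Proof.
move=> nu0 sw e e0.
have [C C0 HC] := heat_deriv_bound i.
have e1 : 0 < e / (2 * (C + 1)) by rewrite divr_gt0 ?mulr_gt0 ?ltr_wpDl.
have [A A0 HA] := heat_abs_level_integrable sw e1.
(* At this time the part A h^(-nu) has become as small as the level. *)
pose M := (((A + 1) / (e / (2 * (C + 1)))) `^ nu^-1).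
have B0 : 0 < (A + 1) / (e / (2 * (C + 1))) by rewrite divr_gt0 ?ltr_wpDl.
exists M => [|h Mh]; first by rewrite powR_gt0.
have h0 : 0 < h by apply: lt_trans Mh; rewrite powR_gt0.
have h20 : 0 < 2 * h by rewrite mulr_gt0.
have := HC h w x h0 (level_integrable_admissible sw).
move/le_trans/(_ (lee_wpmul2l _ (HA _ x h20))); rewrite lee_fin => /(_ (mulr_ge0 C0 (powR_ge0 _ _))).
rewrite -EFinM lee_fin => H.
rewrite -(ler_pM2l (exprn_gt0 i h0)) in H; apply: (le_trans H).
rewrite (powR_invn i (ltW h0)) mulrA mulrCA mulfV ?mulr1 ?gt_eqF ?exprn_gt0//.
have Ah : A * (2 * h) `^ (- nu) <= e / (2 * (C + 1)).
  have h2nu : 0 < (2 * h) `^ nu by rewrite powR_gt0.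
  rewrite powRN ler_pdivrMr// mulrC -ler_pdivrMr//.
  apply: (@le_trans _ _ ((A + 1) / (e / (2 * (C + 1))))).
    by rewrite ler_pM2r ?invr_gt0// lerDl.
  have -> : (A + 1) / (e / (2 * (C + 1))) = M `^ nu.
    by rewrite /M -powRrM mulVf ?gt_eqF// powRr1// ltW.
  by rewrite ge0_ler_powR ?nnegrE ?powR_ge0 ?(ltW nu0) ?(ltW h20)//; lra.
apply: (le_trans (ler_wpM2l C0 (lerD (lexx _) Ah))).
have -> : C * (e / (2 * (C + 1)) + e / (2 * (C + 1))) = e * (C / (C + 1)).
  by field; rewrite gt_eqF// ltr_wpDl.
by rewrite ler_piMr ?(ltW e0)// ler_pdivrMr ?ltr_wpDl// mul1r lerDl.
Qed.

Lemma heat_abs_mono h w1 w2 x : measurable_fun setT w1 -> measurable_fun setT w2 ->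
  (forall y, `|w1 y| <= `|w2 y|) -> (heat_abs h w1 x <= heat_abs h w2 x)%E.
Proof.
move=> m1 m2 w12; apply: ge0_le_integral => //.
- by move=> y _; rewrite lee_fin mulr_ge0 ?gker_ge0.
- exact: measurable_gker_norm.
- exact: measurable_gker_norm.
by move=> y _; rewrite lee_fin ler_wpM2l ?gker_ge0.
Qed.

Lemma heat_abs_add h w1 w2 x : measurable_fun setT w1 -> measurable_fun setT w2 ->
  (heat_abs h (fun y => (w1 y + w2 y)%R) x <= heat_abs h w1 x + heat_abs h w2 x)%E.
Proof.
move=> m1 m2; rewrite /heat_abs -ge0_integralD//; last 4 first.
- by move=> y _; rewrite lee_fin mulr_ge0 ?gker_ge0.
- exact: measurable_gker_norm.
- by move=> y _; rewrite lee_fin mulr_ge0 ?gker_ge0.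
- exact: measurable_gker_norm.
apply: ge0_le_integral => //.
- by move=> y _; rewrite lee_fin mulr_ge0 ?gker_ge0.
- by apply: (measurable_gker_norm h x (w := fun y => w1 y + w2 y)); exact: measurable_funD.
- by apply: emeasurable_funD; exact: measurable_gker_norm.
move=> y _; rewrite -EFinD lee_fin -mulrDr ler_wpM2l ?gker_ge0//.
exact: ler_normD.
Qed.

Lemma heat_abs_scale h c w x : measurable_fun setT w ->
  (heat_abs h (fun y => (c * w y)%R) x = `|c|%:E * heat_abs h w x)%E.
Proof.
move=> mw; rewrite /heat_abs -ge0_integralZl//; last 2 first.
- exact: measurable_gker_norm.
- by move=> y _; rewrite lee_fin mulr_ge0 ?gker_ge0.
by apply: eq_integral => y _; rewrite -EFinM normrM mulrCA.
Qed.

Lemma admissible_le w1 w2 : measurable_fun setT w1 -> admissible w2 ->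
  (forall y, `|w1 y| <= `|w2 y|) -> admissible w1.
Proof.
move=> m1 a2 w12; split => // h x h0.
by apply: (le_lt_trans (heat_abs_mono h x m1 a2.1 w12)); exact: a2.2.
Qed.

Lemma admissible_add w1 w2 : admissible w1 -> admissible w2 -> admissible (fun y => w1 y + w2 y).
Proof.
move=> a1 a2; split=> [|h x h0]; first exact: measurable_funD a1.1 a2.1.
apply: (le_lt_trans (heat_abs_add h x a1.1 a2.1)).
by rewrite lte_add_pinfty// ?a1.2// a2.2.
Qed.

Lemma admissible_scale c w : admissible w -> admissible (fun y => c * w y).
Proof.
move=> aw; split=> [|h x h0]; first by apply: measurable_funM => //; exact: aw.1.
by rewrite (heat_abs_scale _ _ _ aw.1) lte_mul_pinfty// aw.2.
Qed.

Lemma admissible_indic (A : set T) : measurable A -> admissible \1_A.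
Proof.
move=> mA; split=> [|h x h0]; first exact: measurable_indic.
apply: (@le_lt_trans _ _ 1%E); last by rewrite ltry.
rewrite -(int_gker x h0); apply: ge0_le_integral => //.
- by move=> y _; rewrite lee_fin mulr_ge0 ?gker_ge0.
- by apply: measurable_gker_norm; exact: measurable_indic.
- by apply/measurable_EFinP; exact: measurable_gker.
move=> y _; rewrite lee_fin ler_piMr ?gker_ge0// indicE.
by case: (_ \in _); rewrite ?normr1 ?normr0.
Qed.

Lemma heat_abs_indic_le h (D : set T) w x : 0 < h -> measurable D ->
  measurable_fun setT w -> (forall y, `|w y| = \1_D y) ->
  (heat_abs h w x <= ((4 * pi * h) `^ (- nu))%:E * mu D)%E.
Proof.
move=> h0 mD mw wD; rewrite -[X in (_ <= _ * mu X)%E]setIT -integral_indic//.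
have mi : measurable_fun setT (fun y => (\1_D y)%:E : \bar R).
  by apply/measurable_EFinP; exact: measurable_indic.
rewrite -ge0_integralZl//; last by rewrite lee_fin powR_ge0.
apply: ge0_le_integral => //.
- by move=> y _; rewrite lee_fin mulr_ge0 ?gker_ge0.
- exact: measurable_gker_norm.
- exact: measurable_funeM.
by move=> y _; rewrite -EFinM lee_fin wD ler_wpM2r ?gker_sup// indicE.
Qed.

Lemma heat_deriv_add i h w1 w2 x : 0 < h -> admissible w1 -> admissible w2 ->
  heat_deriv i h (fun y => w1 y + w2 y) x = heat_deriv i h w1 x + heat_deriv i h w2 x.
Proof.
move=> h0 a1 a2; rewrite /heat_deriv -RintegralD//; try exact: admissible_integrable.
by apply: eq_Rintegral => y _; rewrite mulrDr.
Qed.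

Lemma heat_deriv_scale i h c w x : 0 < h -> admissible w ->
  heat_deriv i h (fun y => c * w y) x = c * heat_deriv i h w x.
Proof.
move=> h0 aw; rewrite /heat_deriv -RintegralZl//; last exact: admissible_integrable.
by apply: eq_Rintegral => y _; rewrite mulrCA.
Qed.

Lemma heat_deriv0_le_heat_abs h w x : 0 < h -> admissible w -> (`|heat_deriv 0 h w x|%:E <= heat_abs h w x)%E.
Proof.
move=> h0 aw; rewrite EFin_normr_Rintegral//; last exact: admissible_integrable.
apply: (le_trans (le_abse_integral mu measurableT _)).
  by apply/measurable_EFinP/measurable_funM; [exact: measurable_dgker|exact: aw.1].
apply: eq_imp_le; apply: eq_integral => y _ /=.
by rewrite dgker0// normrM (ger0_norm (gker_ge0 _ _ _)).
Qed.

Lemma heat_deriv0_ge0 h w x : 0 < h -> (forall y, 0 <= w y) -> 0 <= heat_deriv 0 h w x.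
Proof.
by move=> h0 w0; apply: Rintegral_ge0 => y _; rewrite dgker0// mulr_ge0 ?gker_ge0.
Qed.

Lemma heat_deriv0_le h w1 w2 x : 0 < h -> admissible w1 -> admissible w2 ->
  (forall y, w1 y <= w2 y) -> heat_deriv 0 h w1 x <= heat_deriv 0 h w2 x.
Proof.
move=> h0 a1 a2 w12; apply: le_Rintegral => //; try exact: admissible_integrable.
by move=> y _; rewrite dgker0// ler_wpM2l ?gker_ge0.
Qed.

Lemma heat_deriv0_1 h x : 0 < h -> heat_deriv 0 h (cst 1) x = 1.
Proof.
move=> h0; rewrite -[RHS]/(fine (1%:E : \bar R)) -(int_gker x h0).
by congr fine; apply: eq_integral => y _; rewrite dgker0//= mulr1.
Qed.

Section approximate_identity.
Variables (o : T) (eta : nat -> R).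
Hypothesis eta_gt0 : forall k : nat, 0 < eta k.
Hypothesis eta_le1 : forall k : nat, eta k <= 1.

(** The L^1 distance between w and its evolution at the small time [eta k],
    against the finite measure with density [gker 1 o]. *)
Definition recovery_error (k : nat) w : \bar R :=
  (\int[mu]_x (gker 1 o x * `|heat_deriv 0 (eta k) w x - w x|)%:E)%E.

(** Convergence of w_(eta k) to w in L^1 of a Gaussian weight. This is weaker than
    the Lebesgue differentiation theorem, but stable under the operations that
    generate all functions, and it suffices for [ae_le_heat_deriv]. *)
Definition recoverable w := admissible w /\ forall e : R, 0 < e ->
  \forall k \near \oo, (recovery_error k w <= e%:E)%E.

Lemma measurable_recovery_error (k : nat) w : admissible w ->
  measurable_fun setT (fun x => heat_deriv 0 (eta k) w x - w x).
Proof. by move=> aw; apply: measurable_funB; [exact: measurable_heat_deriv|exact: aw.1]. Qed.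

Lemma recovery_error_mono (k : nat) w1 w2 : admissible w1 -> admissible w2 ->
  (forall x, `|heat_deriv 0 (eta k) w1 x - w1 x| <= `|heat_deriv 0 (eta k) w2 x - w2 x|) ->
  (recovery_error k w1 <= recovery_error k w2)%E.
Proof. by move=> a1 a2 H; apply: heat_abs_mono; rewrite //; exact: measurable_recovery_error. Qed.

Lemma recovery_error_add (k : nat) w1 w2 w3 : admissible w1 -> admissible w2 -> admissible w3 ->
  (forall x, `|heat_deriv 0 (eta k) w3 x - w3 x| <=
     `|heat_deriv 0 (eta k) w1 x - w1 x| + `|heat_deriv 0 (eta k) w2 x - w2 x|) ->
  (recovery_error k w3 <= recovery_error k w1 + recovery_error k w2)%E.
Proof.
move=> a1 a2 a3 H.
rewrite /recovery_error -ge0_integralD//; last 4 first.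
- by move=> y _; rewrite lee_fin mulr_ge0 ?gker_ge0.
- by apply: measurable_gker_norm; exact: measurable_recovery_error.
- by move=> y _; rewrite lee_fin mulr_ge0 ?gker_ge0.
- by apply: measurable_gker_norm; exact: measurable_recovery_error.
apply: ge0_le_integral => //.
- by move=> y _; rewrite lee_fin mulr_ge0 ?gker_ge0.
- by apply: measurable_gker_norm; exact: measurable_recovery_error.
- by apply: emeasurable_funD; apply: measurable_gker_norm; exact: measurable_recovery_error.
by move=> y _; rewrite -EFinD lee_fin -mulrDr ler_wpM2l ?gker_ge0.
Qed.

(** The semigroup moves the weight from time 1 to time 1 + eta k <= 2, so that the
    error is bounded uniformly in k. *)
Lemma recovery_error_le (k : nat) w : admissible w -> (recovery_error k w <= (2 * 2 `^ nu)%:E * heat_abs 2 w o)%E.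
Proof.
move=> aw.
apply: (@le_trans _ _ (heat_abs (1 + eta k) w o + heat_abs 1 w o)%E).
  rewrite -(heat_abs_semigroup _ _ _ aw.1)// /heat_abs -ge0_integralD//; last 4 first.
  - by move=> y _; rewrite mule_ge0 ?heat_abs_ge0// lee_fin gker_ge0.
  - apply: emeasurable_funM; last by apply: measurable_heat_abs; exact: aw.1.
    by apply/measurable_EFinP; exact: measurable_gker.
  - by move=> y _; rewrite lee_fin mulr_ge0 ?gker_ge0.
  - by apply: measurable_gker_norm; exact: aw.1.
  apply: ge0_le_integral => //.
  - by move=> y _; rewrite lee_fin mulr_ge0 ?gker_ge0.
  - by apply: measurable_gker_norm; exact: measurable_recovery_error.
  - apply: emeasurable_funD; last by apply: measurable_gker_norm; exact: aw.1.
    apply: emeasurable_funM; last by apply: measurable_heat_abs; exact: aw.1.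
    by apply/measurable_EFinP; exact: measurable_gker.
  move=> y _; rewrite [X in (_ <= _ + X)%E]EFinM -ge0_muleDr ?heat_abs_ge0//.
  rewrite EFinM lee_wpmul2l ?lee_fin ?gker_ge0//.
  apply: (@le_trans _ _ (`|heat_deriv 0 (eta k) w y|%:E + `|w y|%:E)%E).
    by rewrite -EFinD lee_fin ler_normB.
  by rewrite leeD2r// heat_deriv0_le_heat_abs.
have e2 : 1 + eta k <= 2 by have := eta_le1 k; lra.
have e1 : 0 < 1 + eta k by rewrite addr_gt0.
have -> : ((2 * 2 `^ nu)%:E * heat_abs 2 w o = (2 `^ nu)%:E * heat_abs 2 w o + (2 `^ nu)%:E * heat_abs 2 w o)%E.
  by rewrite -ge0_muleDl ?lee_fin ?powR_ge0// -EFinD; congr (_%:E * _)%E; ring.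
apply: leeD.
  apply: (le_trans (heat_abs_le o e1 e2 aw.1)); rewrite lee_wpmul2r ?heat_abs_ge0// lee_fin.
  rewrite ge0_ler_powR ?nnegrE ?divr_ge0 ?(ltW e1)// ler_pdivrMr//.
  by have := eta_gt0 k; lra.
have := @heat_abs_le 1 2 w o ltr01; rewrite divr1; apply; first by lra.
exact: aw.1.
Qed.

(** By [recovery_error_le] the recoverable functions are closed in the weighted
    L^1 norm. *)
Lemma recoverable_approx w : admissible w ->
  (forall e : R, 0 < e -> exists2 w', recoverable w' & (heat_abs 2 (fun y => (w y - w' y)%R) o <= e%:E)%E) ->
  recoverable w.
Proof.
move=> aw H; split => // e e0.
have c0 : 0 < 2 * 2 `^ nu :> R by rewrite mulr_gt0 ?powR_gt0.
have [w' [aw' cw'] Hw'] := H _ (divr_gt0 e0 (mulr_gt0 (ltr0Sn R 1) c0)).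
have e20 : 0 < e / 2 by rewrite divr_gt0.
have ad : admissible (fun y => w y - w' y).
  have := admissible_add aw (admissible_scale (-1) aw').
  by rewrite (_ : (fun y => w y + -1 * w' y) = (fun y => w y - w' y))//; apply/funext => y; rewrite mulN1r.
near=> k.
apply: (@le_trans _ _ (recovery_error k w' + recovery_error k (fun y => (w y - w' y)%R))%E).
  apply: recovery_error_add => // x.
  have -> : heat_deriv 0 (eta k) w x = heat_deriv 0 (eta k) w' x + heat_deriv 0 (eta k) (fun y => w y - w' y) x.
    rewrite -heat_deriv_add//; congr (heat_deriv _ _ _ _); apply/funext => y; ring.
  by rewrite (le_trans _ (ler_normD _ _))//; apply: eq_imp_le; congr `| _ |; ring.
apply: (@le_trans _ _ ((e / 2)%:E + (e / 2)%:E)%E); last by rewrite -EFinD lee_fin; lra.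
apply: leeD; first by near: k; exact: cw'.
apply: (le_trans (recovery_error_le k ad)).
apply: (le_trans (lee_wpmul2l _ Hw')); first by rewrite lee_fin ltW.
rewrite -EFinM lee_fin; apply: eq_imp_le; field.
by rewrite gt_eqF ?powR_gt0.
Unshelve. all: end_near. Qed.

Lemma recoverable_dct w (W : nat -> T -> R) : admissible w ->
  (forall n, measurable_fun setT (W n)) -> (forall n, recoverable (W n)) ->
  (forall n y, `|W n y| <= `|w y|) -> (forall y, W n y @[n --> \oo] --> w y) -> recoverable w.
Proof.
move=> aw mW cW Ww Wcv; apply: recoverable_approx => // e e0.
have mD n : measurable_fun setT (fun y => w y - W n y).
  by apply: measurable_funB => //; exact: aw.1.
have aw2 : admissible (fun y => 2 * w y) by exact: admissible_scale.
have ig : mu.-integrable setT (fun y => (gker 2 o y * `|2 * w y|)%:E).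
  apply/integrableP; split; first exact: measurable_gker_norm aw2.1.
  apply: le_lt_trans (aw2.2 2 o _) => //.
  by apply: eq_imp_le; apply: eq_integral => y _; rewrite gee0_abs// lee_fin mulr_ge0 ?gker_ge0.
have [] // := @dominated_convergence _ _ _ mu setT measurableT
  (fun n y => (gker 2 o y * `|w y - W n y|)%:E) (cst 0%E) (fun y => (gker 2 o y * `|2 * w y|)%:E) _ _ _ ig _.
- by move=> n; exact: measurable_gker_norm (mD n).
- apply: aeW => y _; apply/fine_cvgP; split; first exact: nearW.
  rewrite /comp/= -[X in _ --> X](mulr0 (gker 2 o y)).
  apply: cvgMr; apply/norm_cvg0P; rewrite -(subrr (w y)).
  by apply: cvgB; [exact: cvg_cst|exact: Wcv].
- apply: aeW => y n _; rewrite gee0_abs ?lee_fin ?(mulr_ge0 (gker_ge0 _ _ _) (normr_ge0 _))//.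
  rewrite ler_wpM2l ?gker_ge0// normrM ger0_norm//.
  by rewrite (le_trans (ler_normB _ _))//; have := Ww n y; lra.
move=> _ /fine_cvgP[fin cv0] _.
have /cvgrPdist_le /(_ e e0) near1 := cv0.
have [n [fn ne]] : exists n, (\int[mu]_x `|(gker 2 o x * `|w x - W n x|)%:E - cst 0 x| \is a fin_num)%E /\
   (`|0 - fine (\int[mu]_x `|(gker 2 o x * `|w x - W n x|)%:E - cst 0 x|)%E| <= e).
  have [n _ /(_ n (leqnn n)) Hn] := filterI fin near1.
  by exists n.
exists (W n) => //.
move: fn ne; have -> : (\int[mu]_x `|(gker 2 o x * `|w x - W n x|)%:E - cst 0 x| = heat_abs 2 (fun y => (w y - W n y)%R) o)%E.
  by apply: eq_integral => y _; rewrite /cst sube0 gee0_abs// lee_fin mulr_ge0 ?gker_ge0.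
move=> fn; rewrite sub0r normrN ger0_norm ?fine_ge0 ?heat_abs_ge0// -lee_fin fineK//.
Qed.

Definition recoverable_set (A : set T) := measurable A /\ recoverable \1_A.

Lemma recoverable_set0 : recoverable_set set0.
Proof.
split => //; split => [|e e0]; first exact: admissible_indic.
near=> k; rewrite /recovery_error; apply: (@le_trans _ _ 0%E); last by rewrite lee_fin ltW.
apply: eq_imp_le; apply: integral0_eq => x _; rewrite indic0 /=.
have -> : heat_deriv 0 (eta k) (cst 0) x = 0.
  by rewrite /heat_deriv /Rintegral integral0_eq// => y _; rewrite /= mulr0.
by rewrite subrr normr0 mulr0.
Unshelve. all: end_near. Qed.

Lemma recoverable_setC A : recoverable_set A -> recoverable_set (~` A).
Proof.
move=> [mA [aA cA]]; have mC := measurableC mA.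
split => //; split => [|e e0]; first exact: admissible_indic.
apply: filterS (cA e e0) => k; apply: le_trans.
apply: recovery_error_mono; [exact: admissible_indic|exact: aA|] => x.
have a1 : admissible (cst 1) by rewrite -indicT; exact: admissible_indic.
have E y : \1_(~` A) y = 1 + -1 * \1_A y :> R.
  by rewrite !indicE in_setC; case: (y \in A); rewrite /= ?mulr0 ?addr0 ?mulr1 ?subrr.
have -> : heat_deriv 0 (eta k) \1_(~` A) x = 1 - heat_deriv 0 (eta k) \1_A x.
  rewrite (_ : \1_(~` A) = (fun y => cst 1 y + -1 * \1_A y)); last by apply/funext => y; rewrite E.
  rewrite heat_deriv_add//; last exact: admissible_scale.
  by rewrite heat_deriv_scale// heat_deriv0_1// mulN1r.
by rewrite E -normrN; apply: eq_imp_le; congr `| _ |; ring.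
Qed.

(** Being between the maximum and the sum of the two evolutions, the evolution of
    the indicator of a union errs by at most the sum of the two errors. *)
Lemma recoverable_setU A B : recoverable_set A -> recoverable_set B -> recoverable_set (A `|` B).
Proof.
move=> [mA [aA cA]] [mB [aB cB]]; have mU := measurableU _ _ mA mB.
have aU := admissible_indic mU.
split => //; split => // e e0.
have e20 : 0 < e / 2 by rewrite divr_gt0.
near=> k.
apply: (@le_trans _ _ ((e / 2)%:E + (e / 2)%:E)%E); last by rewrite -EFinD lee_fin; lra.
apply: (@le_trans _ _ (recovery_error k \1_A + recovery_error k \1_B)%E); last first.
  by apply: leeD; near: k; [exact: cA|exact: cB].
apply: recovery_error_add => // x.
have i01 (D : set T) y : 0 <= (\1_D y : R) <= 1 by rewrite indicE; case: (y \in D); rewrite /= ?lexx ?ler01.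
have u0 : 0 <= heat_deriv 0 (eta k) \1_(A `|` B) x by apply: heat_deriv0_ge0 => // y; case/andP: (i01 (A `|` B) y).
have u1 : heat_deriv 0 (eta k) \1_(A `|` B) x <= 1.
  rewrite -(heat_deriv0_1 x (eta_gt0 k)); apply: heat_deriv0_le => // [|y].
    by rewrite -indicT; exact: admissible_indic.
  by case/andP: (i01 (A `|` B) y).
have uA : heat_deriv 0 (eta k) \1_A x <= heat_deriv 0 (eta k) \1_(A `|` B) x.
  apply: heat_deriv0_le => // y; rewrite !indicE in_setU; case: (y \in A) => //=; exact: ler0n.
have uB : heat_deriv 0 (eta k) \1_B x <= heat_deriv 0 (eta k) \1_(A `|` B) x.
  apply: heat_deriv0_le => // y; rewrite !indicE in_setU orbC; case: (y \in B) => //=; exact: ler0n.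
have uAB : heat_deriv 0 (eta k) \1_(A `|` B) x <= heat_deriv 0 (eta k) \1_A x + heat_deriv 0 (eta k) \1_B x.
  rewrite -heat_deriv_add//; apply: heat_deriv0_le => // [|y]; first exact: admissible_add.
  rewrite !indicE in_setU; case: (y \in A); case: (y \in B); rewrite /=; lra.
have A0 : 0 <= heat_deriv 0 (eta k) \1_A x by apply: heat_deriv0_ge0 => // y; case/andP: (i01 A y).
have B0 : 0 <= heat_deriv 0 (eta k) \1_B x by apply: heat_deriv0_ge0 => // y; case/andP: (i01 B y).
rewrite !indicE in_setU.
have [xA|xA] := boolP (x \in A) => /=.
  rewrite [leLHS]ler0_norm; last by lra.
  by rewrite [X in _ <= X + _]ler0_norm; [have := normr_ge0 (heat_deriv 0 (eta k) \1_B x - (x \in B)%:R); lra|lra].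
have [xB|xB] := boolP (x \in B) => /=.
  rewrite [leLHS]ler0_norm; last by lra.
  by rewrite [X in _ <= _ + X]ler0_norm; [have := normr_ge0 (heat_deriv 0 (eta k) \1_A x - 0%:R); rewrite /=; lra|lra].
by rewrite !subr0 !ger0_norm.
Unshelve. all: end_near. Qed.

Lemma recoverable_set_bigcup (A : nat -> set T) : (forall n, recoverable_set (A n)) -> recoverable_set (\bigcup_n A n).
Proof.
move=> gA.
have gU n : recoverable_set (\big[setU/set0]_(i < n) A i).
  elim: n => [|n IH]; first by rewrite big_ord0; exact: recoverable_set0.
  by rewrite big_ord_recr/=; exact: recoverable_setU.
have mU : measurable (\bigcup_n A n) by apply: bigcup_measurable => n _; exact: (gA n).1.
split => //.
apply: (recoverable_dct (W := fun n => \1_(\big[setU/set0]_(i < n) A i))).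
- exact: admissible_indic.
- by move=> n; apply: measurable_indic; exact: (gU n).1.
- by move=> n; exact: (gU n).2.
- move=> n y; rewrite !ger0_norm ?indicE// ler_nat -bigcup_mkord.
  case: (boolP (y \in \bigcup_(i < n) A i)) => // /set_mem [i _ Ai].
  by rewrite mem_set//; exists i.
move=> y; rewrite indicE; have [/set_mem [i _ Ai]|yN] := boolP (y \in \bigcup_n A n).
  apply: cvg_near_cst; near=> n.
  rewrite indicE mem_set//= -bigcup_mkord; exists i => //=.
  by near: n; exact: nbhs_infty_gt.
apply: cvg_near_cst; near=> n; rewrite indicE memNset//=.
rewrite -bigcup_mkord => -[i _ Ai]; move/negP: yN; apply; apply/mem_set; by exists i.
Unshelve. all: end_near. Qed.

(** One half of the exponential absorbs the factor q. *)
Lemma gker_q_le h x y : 0 < h -> gker h x y * q x y <= 8 * h * 2 `^ nu * gker (2 * h) x y.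
Proof.
move=> h0.
have -> : 8 * h * 2 `^ nu * gker (2 * h) x y =
    (4 * pi * h) `^ (- nu) * (8 * h * expR (- (q x y / (8 * h)))).
  rewrite /gker.
  have -> : 4 * pi * (2 * h) = 2 * (4 * pi * h) by ring.
  rewrite powRM ?mulr_ge0 ?pi_ge0 ?(ltW h0)// [2 `^ (- nu)]powRN.
  have -> : 4 * (2 * h) = 8 * h by ring.
  by field; rewrite gt_eqF ?powR_gt0.
rewrite /gker -mulrA ler_wpM2l ?powR_ge0//.
have h80 : 0 < 8 * h by rewrite mulr_gt0.
have -> : q x y / (4 * h) = q x y / (8 * h) + q x y / (8 * h) by field; rewrite gt_eqF.
rewrite opprD expRD; set E := expR _.
have Eq : E * q x y <= 8 * h.
  rewrite /E expRN ler_pdivrMl ?expR_gt0// mulrC -ler_pdivrMl// mulrC.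
  by apply: le_trans (expR_ge1Dx _); rewrite lerDr.
by rewrite -mulrA mulrC ler_wpM2r ?expR_ge0.
Qed.

(** The variance of the kernel at time h is of order h, so a Lipschitz function
    differs from its evolution by O(sqrt h); the inequality
    a <= e/2 + a^2/(e/2) replaces the Cauchy-Schwarz inequality. *)
Lemma recoverable_lipschitz w (L : R) : (eta k @[k --> \oo] --> 0) -> admissible w -> 0 <= L ->
  (forall x y, (w y - w x) ^+ 2 <= L * q x y) -> recoverable w.
Proof.
move=> eta0 aw L0 Lw; split => // e e0.
have e20 : 0 < e / 2 by rewrite divr_gt0.
pose c := L / (e / 2) * 8 * 2 `^ nu.
have c0 : 0 <= c by rewrite !mulr_ge0 ?invr_ge0 ?powR_ge0 ?(ltW e20).
have ce : 0 < e / 2 / (c + 1) by rewrite divr_gt0 ?ltr_wpDl.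
near=> k.
have ek : eta k <= e / 2 / (c + 1).
  have : `|0 - eta k| <= e / 2 / (c + 1).
    near: k; have /cvgrPdist_le H := eta0; exact: H.
  by rewrite sub0r normrN ger0_norm ?(ltW (eta_gt0 _)).
have h0 := eta_gt0 k.
apply: (@le_trans _ _ (\int[mu]_x (e%:E * (gker 1 o x)%:E))%E); last first.
  rewrite ge0_integralZl//.
  - by rewrite int_gker// mule1.
  - by apply/measurable_EFinP; exact: measurable_gker.
  - by move=> y _; rewrite lee_fin gker_ge0.
  - by rewrite lee_fin ltW.
apply: ge0_le_integral => //.
- by move=> y _; rewrite lee_fin mulr_ge0 ?gker_ge0.
- by apply: measurable_gker_norm; exact: measurable_recovery_error.
- by apply: measurable_funeM; apply/measurable_EFinP; exact: measurable_gker.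
move=> x _; rewrite -EFinM lee_fin mulrC ler_wpM2r ?gker_ge0//.
have a1 : admissible (cst 1) by rewrite -indicT; exact: admissible_indic.
have ac : admissible (fun y => w y + (- w x) * cst 1 y) by apply: admissible_add => //; exact: admissible_scale.
have -> : heat_deriv 0 (eta k) w x - w x = heat_deriv 0 (eta k) (fun y => w y + (- w x) * cst 1 y) x.
  rewrite heat_deriv_add//; last exact: admissible_scale.
  by rewrite heat_deriv_scale// heat_deriv0_1// mulr1.
rewrite -lee_fin; apply: (le_trans (heat_deriv0_le_heat_abs x h0 ac)).
apply: (@le_trans _ _ (\int[mu]_y ((e / 2)%:E * (gker (eta k) x y)%:E +
    (c * eta k)%:E * (gker (2 * eta k) x y)%:E))%E).
  apply: ge0_le_integral => //.
  - by move=> y _; rewrite lee_fin mulr_ge0 ?gker_ge0.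
  - exact: measurable_gker_norm ac.1.
  - by apply: emeasurable_funD; apply: measurable_funeM; apply/measurable_EFinP; exact: measurable_gker.
  move=> y _; rewrite -!EFinM -EFinD lee_fin /= mulr1.
  set a := `|w y - w x|.
  have a0 : 0 <= a by rewrite normr_ge0.
  have aL : a ^+ 2 <= L * q x y by rewrite real_normK ?num_real.
  have ad : a <= e / 2 + a ^+ 2 / (e / 2).
    have -> : e / 2 + a ^+ 2 / (e / 2) = (e / 2) ^-1 * ((e / 2) ^+ 2 + a ^+ 2) by field; rewrite gt_eqF.
    by rewrite ler_pdivlMl//; nra.
  have ad2 : a <= e / 2 + L * q x y / (e / 2).
    by apply: (le_trans ad); rewrite lerD2l ler_pM2r ?invr_gt0.
  apply: (le_trans (ler_wpM2l (gker_ge0 _ _ _) ad2)).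
  rewrite mulrDr mulrC lerD2l.
  have -> : gker (eta k) x y * (L * q x y / (e / 2)) = L / (e / 2) * (gker (eta k) x y * q x y) by ring.
  have -> : c * eta k * gker (2 * eta k) x y = L / (e / 2) * (8 * eta k * 2 `^ nu * gker (2 * eta k) x y) by rewrite /c; ring.
  by rewrite ler_wpM2l ?gker_q_le// divr_ge0// ltW.
have Ig h : 0 < h -> forall r, 0 <= r -> (\int[mu]_y (r%:E * (gker h x y)%:E) = r%:E)%E.
  move=> hh r r0; rewrite ge0_integralZl//.
  - by rewrite int_gker// mule1.
  - by apply/measurable_EFinP; exact: measurable_gker.
  - by move=> y _; rewrite lee_fin gker_ge0.
have ck : 0 <= c * eta k by rewrite mulr_ge0 ?(ltW h0).
rewrite ge0_integralD//; last 4 first.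
- by move=> y _; rewrite mule_ge0// lee_fin ?gker_ge0// ltW.
- by apply: measurable_funeM; apply/measurable_EFinP; exact: measurable_gker.
- by move=> y _; rewrite mule_ge0// lee_fin ?gker_ge0//.
- by apply: measurable_funeM; apply/measurable_EFinP; exact: measurable_gker.
rewrite !Ig ?mulr_gt0 ?(ltW e20)// -EFinD lee_fin.
have : c * eta k <= e / 2.
  apply: (@le_trans _ _ ((c + 1) * eta k)); first by rewrite ler_pM2r// lerDl.
  by rewrite mulrC -ler_pdivlMr ?ltr_wpDl.
by lra.
Unshelve. all: end_near. Qed.

Lemma recoverable_add w1 w2 : recoverable w1 -> recoverable w2 -> recoverable (fun y => w1 y + w2 y).
Proof.
move=> [a1 c1] [a2 c2]; have a12 := admissible_add a1 a2; split => // e e0.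
have e20 : 0 < e / 2 by rewrite divr_gt0.
near=> k.
apply: (@le_trans _ _ ((e / 2)%:E + (e / 2)%:E)%E); last by rewrite -EFinD lee_fin; lra.
apply: (@le_trans _ _ (recovery_error k w1 + recovery_error k w2)%E); last first.
  by apply: leeD; near: k; [exact: c1|exact: c2].
apply: recovery_error_add => // x; rewrite heat_deriv_add// (le_trans _ (ler_normD _ _))//.
by apply: eq_imp_le; congr `| _ |; ring.
Unshelve. all: end_near. Qed.

Lemma recoverable_scale c w : recoverable w -> recoverable (fun y => c * w y).
Proof.
move=> [aw cw]; have ac := admissible_scale c aw; split => // e e0.
have e1 : 0 < e / (`|c| + 1) by rewrite divr_gt0// ltr_wpDl.
near=> k.
have -> : recovery_error k (fun y => c * w y) = (`|c|%:E * recovery_error k w)%E.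
  rewrite /recovery_error -[RHS](heat_abs_scale 1 c o (measurable_recovery_error k aw)).
  apply: eq_integral => y _; congr ((_ * `| _ |)%:E).
  by rewrite heat_deriv_scale// mulrBr.
apply: (@le_trans _ _ (`|c|%:E * (e / (`|c| + 1))%:E)%E).
  by rewrite lee_wpmul2l ?lee_fin//; near: k; exact: cw.
rewrite -EFinM lee_fin mulrCA ler_piMr ?(ltW e0)//.
by rewrite ler_pdivrMr ?ltr_wpDl// mul1r lerDl.
Unshelve. all: end_near. Qed.

Hypothesis allgood : forall A : set T, measurable A -> recoverable_set A.

Import HBNNSimple.

Lemma recoverable_nnsfun (f : {nnsfun T >-> R}) : recoverable f.
Proof.
have -> : (f : T -> R) = (fun x => \sum_(y <- finmap.enum_fset (fset_set (range f))) (y * \1_(f @^-1` [set y]) x)).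
  by apply/funext => x; rewrite {1}fimfunE fsbig_finite.
elim: (finmap.enum_fset _) => [|y s IH].
  rewrite (_ : (fun _ => _) = \1_set0); first exact: recoverable_set0.2.
  by apply/funext => x; rewrite big_nil indic0.
rewrite (_ : (fun _ => _) = (fun x => y * \1_(f @^-1` [set y]) x + \sum_(z <- s) (z * \1_(f @^-1` [set z]) x))).
  apply: recoverable_add => //; apply: recoverable_scale.
  by apply: (allgood _).2; exact: measurable_funPTI.
by apply/funext => x; rewrite big_cons.
Qed.

Lemma recoverable_ge0 w : admissible w -> (forall y, 0 <= w y) -> recoverable w.
Proof.
move=> aw w0.
have mw : measurable_fun setT (EFin \o w) by apply/measurable_EFinP; exact: aw.1.
pose W := nnsfun_approx measurableT mw.
have W0 : forall y, setT y -> (0 <= (EFin \o w) y)%E by move=> y _; rewrite lee_fin.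
apply: (recoverable_dct (W := W)) => //.
- by move=> n; exact: recoverable_nnsfun.
- move=> n y; rewrite !ger0_norm// -lee_fin.
  by rewrite /W nnsfun_approxE; exact: le_approx.
move=> y; have := @cvg_nnsfun_approx _ _ _ _ measurableT _ mw W0 y I.
by move/fine_cvgP => [_].
Qed.

Lemma recoverable_admissible w : admissible w -> recoverable w.
Proof.
move=> aw.
have mp : measurable_fun setT (fun y => Num.max (w y) 0).
  by apply: measurable_funTS; apply: measurable_maxr => //; exact: aw.1.
have mn : measurable_fun setT (fun y => Num.max (- w y) 0).
  by apply: measurable_maxr => //; apply: measurableT_comp => //; exact: aw.1.
have ap : admissible (fun y => Num.max (w y) 0).
  apply: (admissible_le mp aw) => y; rewrite ger0_norm ?le_max ?lexx ?orbT//.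
  by rewrite ge_max ler_norm normr_ge0.
have an : admissible (fun y => Num.max (- w y) 0).
  apply: (admissible_le mn aw) => y; rewrite ger0_norm ?le_max ?lexx ?orbT//.
  by rewrite ge_max -normrN ler_norm normr_ge0.
have := recoverable_add (recoverable_ge0 ap _) (recoverable_scale (-1) (recoverable_ge0 an _)).
rewrite (_ : (fun y => _) = w); last first.
  by apply/funext => y; rewrite mulN1r; case: (leP (w y) 0) => h1; case: (leP (- w y) 0) => h2; lra.
by apply => y; rewrite le_max lexx orbT.
Qed.

(** Where |w| exceeds sup_k |w_(eta k)| by 1/(n+1), the error stays at least
    1/(n+1) for every k; since the weight is positive, this set is null. *)
Lemma ae_le_heat_deriv w : admissible w -> {ae mu, forall x, forall B : R,
  (forall k : nat, `|heat_deriv 0 (eta k) w x| <= B) -> `|w x| <= B}.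
Proof.
move=> aw; have [_ cw] := recoverable_admissible aw.
pose E (n : nat) := [set x | forall k : nat, `|heat_deriv 0 (eta k) w x| + n.+1%:R^-1 <= `|w x|].
have mE n : measurable (E n).
  rewrite (_ : E n = \bigcap_k [set x | `|heat_deriv 0 (eta k) w x| + n.+1%:R^-1 <= `|w x|]); last first.
    by apply/seteqP; split => [x Ex k _|x Ex k]; [exact: Ex|exact: Ex].
  apply: bigcap_measurable => [|k _]; first by exists 0%N.
  rewrite -[X in measurable X]setTI.
  have m1 : measurable_fun setT (fun x => `|heat_deriv 0 (eta k) w x| + n.+1%:R^-1).
    by apply: measurable_funD => //; apply: measurableT_comp => //; exact: measurable_heat_deriv.
  have m2 : measurable_fun setT (fun x => `|w x|) by apply: measurableT_comp => //; exact: aw.1.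
  by have := @measurable_fun_ler _ _ _ setT _ _ m1 m2 measurableT [set true] I; apply.
have gkp x : 0 < gker 1 o x by exact: gker_gt0.
have nE n : mu (E n) = 0%E.
  have mg : measurable_fun (E n) (fun x => (gker 1 o x)%:E).
    by apply/measurable_EFinP/measurable_funTS; exact: measurable_gker.
  have I0 : (\int[mu]_(x in E n) `|(gker 1 o x)%:E| = 0)%E.
    apply/eqP; rewrite eq_le integral_ge0// andbT; apply/lee_addgt0Pr => e e0; rewrite add0e.
    have n0 : 0 < n.+1%:R^-1 :> R by rewrite invr_gt0.
    have [k _ /(_ k (leqnn k)) Hk] := cw _ (mulr_gt0 n0 e0).
    rewrite -(@lee_pmul2l _ (n.+1%:R^-1)%:E) ?lte_fin// -EFinM.
    apply: le_trans Hk; rewrite -ge0_integralZl//; last by apply: measurableT_comp.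
    apply: (@le_trans _ _ (\int[mu]_(x in E n) (gker 1 o x * `|heat_deriv 0 (eta k) w x - w x|)%:E)%E).
      have md : measurable_fun (E n) (fun x => (gker 1 o x * `|heat_deriv 0 (eta k) w x - w x|)%:E).
        by apply: measurable_funTS; apply: measurable_gker_norm; exact: measurable_recovery_error.
      apply: ge0_le_integral => //.
      - by apply: measurable_funeM; apply: measurableT_comp.
      move=> x Ex; rewrite gee0_abs ?lee_fin ?gker_ge0// mulrC ler_wpM2l ?gker_ge0//.
      have Exk : `|heat_deriv 0 (eta k) w x| + n.+1%:R^-1 <= `|w x| by exact: Ex.
      have := lerB_dist (w x) (heat_deriv 0 (eta k) w x).
      by rewrite distrC; apply: le_trans; rewrite lerBrDl.
    apply: ge0_subset_integral => //.
    - by apply: measurable_gker_norm; exact: measurable_recovery_error.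
    - by move=> x _; rewrite lee_fin mulr_ge0 ?gker_ge0.
  have /ae_eq_integral_abs := I0; move/(_ (mE n) mg) => [N [mN N0 EN]].
  apply/eqP; rewrite eq_le measure_ge0 andbT -N0; apply: le_measure; rewrite ?inE//.
  move=> x Ex; apply: EN => /= /(_ Ex) /eqP; rewrite eqe; apply/negP.
  by rewrite gt_eqF.
have : mu.-negligible (\bigcup_n E n).
  by apply: negligible_bigcup => n; exists (E n); split; [exact: mE|exact: nE|].
apply: negligibleS => x /= /existsNP[B /not_implyP[HB /negP]].
rewrite -ltNge => Bw.
have d0 : 0 < `|w x| - B by rewrite subr_gt0.
exists (Num.truncn (`|w x| - B)^-1) => // k /=.
have : (Num.truncn (`|w x| - B)^-1).+1%:R^-1 <= `|w x| - B.
  by rewrite invf_ple ?posrE// ltW// truncnS_gt.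
by rewrite lerBrDr addrC; apply: le_trans; rewrite lerD2r HB.
Qed.

End approximate_identity.

End gaussian_kernel.

(** * Recovering functions on R^n from their heat evolution *)

Lemma measurable_ramp {R : realType} d (T : measurableType d) (u : T -> R) (a c : R) :
  measurable_fun setT u ->
  measurable_fun setT (fun x => Num.min 1 (a * Num.max 0 (u x - c))).
Proof.
move=> mu; apply: measurable_minr => //; apply: measurable_funM => //.
by apply: measurable_maxr => //; exact: measurable_funB.
Qed.

Section heat_Rn.
Context {R : realType} {n : nat}.
Local Notation T := (Rn R n).
Local Notation mu := (@lebn_sf R n).

Definition sqdist (x y : T) : R := sqnorm (subT x y).
Definition half_dim : R := n%:R / 2.

Lemma Rn_gauss : gauss_kernel mu sqdist half_dim.
Proof.
split.
- by move=> x y; apply: sumr_ge0 => i _; rewrite sqr_ge0.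
- exact: sqnorm_subC.
- exact: measurable_sqnorm_sub.
- by rewrite divr_ge0.
- by move=> h x h0; exact: integral_heat_kernel_sub.
- by move=> h k x y h0 k0; exact: heat_kernel_semigroup.
Qed.

Lemma heatE (f : T -> \bar R) h x : measurable_fun setT f ->
  heat h f x = (\int[mu]_y ((gker sqdist half_dim h x y)%:E * f y))%E.
Proof.
move=> mf; rewrite -[RHS](integral_lebn_subT x).
  by apply: eq_integral => y _; rewrite /gker /sqdist subTK.
have mg : measurable_fun [set: T] (fun y => (gker sqdist half_dim h x y)%:E).
  by apply/measurable_EFinP; exact: (measurable_gker Rn_gauss).
exact: emeasurable_funM mg mf.
Qed.

Lemma measurable_coord (i : 'I_n) : measurable_fun [set: T] (fun x : T => tnth x i : R).
Proof. exact: (measurableT_comp (measurable_tnth i) measurable_to_borel). Qed.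

Section all_recoverable_set.
Variables (o : T) (eta : nat -> R).
Hypothesis eta_gt0 : forall k : nat, 0 < eta k.
Hypothesis eta_le1 : forall k : nat, eta k <= 1.
Hypothesis eta0 : eta k @[k --> \oo] --> 0.
Local Notation recoverable_set := (recoverable_set mu sqdist half_dim o eta).

(** The indicator of a half-space is the pointwise limit of Lipschitz ramps. *)
Lemma recoverable_set_ray (i : 'I_n) (c : R) : recoverable_set [set x : T | c < tnth x i].
Proof.
have mA : measurable [set x : T | c < tnth x i].
  rewrite -[X in measurable X]setTI.
  have := measurable_coord i measurableT (@measurable_itv R `]c, +oo[); congr (measurable (_ `&` _)).
  by apply/seteqP; split => x /=; rewrite in_itv/= andbT.
split => //.
pose W (j : nat) (x : T) := Num.min 1 (j%:R * Num.max 0 (tnth x i - c)).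
have W01 j x : 0 <= W j x <= 1.
  by rewrite /W ge_min lexx andbT le_min ler01 mulr_ge0// le_max lexx.
have mW j : measurable_fun setT (W j).
  exact: measurable_ramp (measurable_coord i).
have aW j : admissible mu sqdist half_dim (W j).
  apply: (admissible_le Rn_gauss (mW j) (admissible_indic Rn_gauss measurableT)) => y.
  by rewrite indicT normr1 ger0_norm; case/andP: (W01 j y).
apply: (recoverable_dct Rn_gauss eta_gt0 eta_le1 (W := W)) => //.
- exact: (admissible_indic Rn_gauss).
- move=> j; apply: (@recoverable_lipschitz _ _ _ mu sqdist half_dim Rn_gauss o eta eta_gt0 (W j) (j%:R ^+ 2)) => //.
  move=> x y.
  have lip : `|W j y - W j x| <= j%:R * `|tnth x i - tnth y i|.
    have m1 a b : `|Num.min 1 a - Num.min 1 b| <= `|a - b| :> R.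
      have h1 := ler_norm (a - b); have := ler_norm (b - a); rewrite distrC => h2.
      rewrite ler_norml; case: (leP 1 a) => ha; case: (leP 1 b) => hb;
        apply/andP; split; lra.
    have m2 a b : `|Num.max 0 a - Num.max 0 b| <= `|a - b| :> R.
      have h1 := ler_norm (a - b); have := ler_norm (b - a); rewrite distrC => h2.
      rewrite ler_norml; case: (leP 0 a) => ha; case: (leP 0 b) => hb;
        apply/andP; split; lra.
    apply: (le_trans (m1 _ _)); rewrite -mulrBr normrM ger0_norm// ler_wpM2l//.
    apply: (le_trans (m2 _ _)); apply: eq_imp_le; rewrite -normrN; congr `| _ |; ring.
  rewrite -real_normK ?num_real//.
  apply: (@le_trans _ _ ((j%:R * `|tnth x i - tnth y i|) ^+ 2)).
    by rewrite ler_sqr ?nnegrE ?mulr_ge0.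
  rewrite exprMn real_normK ?num_real// ler_wpM2l ?sqr_ge0//.
  rewrite /sqdist /sqnorm (bigD1 i)//= tnth_mktuple lerDl.
  by apply: sumr_ge0 => k _; rewrite sqr_ge0.
- move=> j y; rewrite ger0_norm; last by case/andP: (W01 j y).
  rewrite indicE; have [yA|yA] := boolP (y \in _); rewrite ?normr1.
    by case/andP: (W01 j y).
  rewrite normr0 /W (_ : Num.max 0 (tnth y i - c) = 0) ?mulr0 ?ge_min ?lexx ?orbT//.
  apply/max_idPl; rewrite subr_le0 leNgt; apply/negP => h.
  by move/negP: yA; apply; rewrite inE.
move=> y; rewrite indicE; have [|yA] := boolP (y \in _).
  rewrite inE/= => cy; apply: cvg_near_cst; near=> j.
  rewrite /W; apply/min_idPl.
  have d0 : 0 < tnth y i - c by rewrite subr_gt0.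
  rewrite (max_idPr (ltW d0)) -ler_pdivrMr// mul1r.
  by near: j; exact: nbhs_infty_ger.
apply: cvg_near_cst; near=> j.
rewrite /W (_ : Num.max 0 (tnth y i - c) = 0) ?mulr0; last first.
  apply/max_idPl; rewrite subr_le0 leNgt; apply/negP => h.
  by move/negP: yA; apply; rewrite inE.
by apply/min_idPr.
Unshelve. all: end_near. Qed.

Lemma recoverable_set_coord (i : 'I_n) (B : set (measurableTypeR R)) : measurable B ->
  recoverable_set [set x : T | B (tnth x i)].
Proof.
move=> mB; have {mB} : (@RGenOInfty.G R).-sigma.-measurable B.
  by rewrite -RGenOInfty.measurableE.
move: B; apply: smallest_sub => [|_ [c ->]]; last first.
  rewrite (_ : [set x | _] = [set x : T | c < tnth x i]); first exact: recoverable_set_ray.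
  by apply/seteqP; split => x /=; rewrite in_itv/= andbT.
split => [|A|F].
- exact: (recoverable_set0 Rn_gauss o eta).
- by move=> gA; rewrite setTD; exact: (recoverable_setC Rn_gauss eta_gt0 gA).
- move=> gF; have := recoverable_set_bigcup Rn_gauss eta_gt0 eta_le1 gF.
  by congr recoverable_set; apply/seteqP; split => x [k _ Fk]; exists k.
Qed.

Lemma recoverable_set_borel (A : set (n.-tuple (measurableTypeR R))) : measurable A -> recoverable_set (A : set T).
Proof.
move: A; apply: smallest_sub.
  split => [|A|F]; first exact: (recoverable_set0 Rn_gauss o eta).
  - by move=> gA; rewrite setTD; exact: (recoverable_setC Rn_gauss eta_gt0 gA).
  - exact: (recoverable_set_bigcup Rn_gauss eta_gt0 eta_le1).
move=> A; rewrite -bigcup_seq/= => -[i _ [B mB <-]]; rewrite setTI.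
exact: recoverable_set_coord.
Qed.

(** Approximate A from outside by a Borel set, with an excess of small measure and
    hence of small weighted L^1 norm. *)
Lemma recoverable_set_finite (A : set T) : measurable A -> (lebn R n A < +oo)%E -> recoverable_set A.
Proof.
move=> mA Afin; split => //; apply: (recoverable_approx Rn_gauss eta_gt0 eta_le1).
  exact: (admissible_indic Rn_gauss).
move=> e e0.
pose c : R := (4 * pi * 2) `^ (- half_dim).
have c0 : 0 < c by rewrite powR_gt0// !mulr_gt0 ?pi_gt0.
have ec : 0 < e / c by rewrite divr_gt0.
have Afn : lebn R n A \is a fin_num by rewrite ge0_fin_numE.
have := lb_ereal_inf_adherent ec Afn.
move=> [_ [F [mF AF] <-] FA].
pose U : set T := \bigcup_k F k.
have mU : measurable (U : set (n.-tuple (measurableTypeR R))) by exact: bigcupT_measurable.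
have mU' : measurable (U : set T) by exact: borel_measurable_Rn.
have UE : (lebn R n U <= lebn R n A + (e / c)%:E)%E.
  apply: le_trans (ltW FA); rewrite lebn_borel//.
  exact: measure_sigma_subadditive.
exists \1_U; first exact: (recoverable_set_borel mU).2.
have mD : measurable (U `\` A : set T) := measurableD mU' mA.
have DE : (lebn R n (U `\` A) <= (e / c)%:E)%E.
  rewrite -(@leeD2lE _ (lebn R n A))//; apply: le_trans UE.
  have dAU : A `&` (U `\` A) = set0 := setDIK A U.
  rewrite -(measureU _ mA mD dAU); apply: eq_imp_le; congr (lebn R n _).
  by rewrite setDUK.
have E y : \1_A y - \1_U y = - \1_(U `\` A) y :> R.
  rewrite !indicE in_setD; have [yA|yA] := boolP (y \in A); rewrite ?andbF ?andbT ?oppr0 ?sub0r//=.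
  by rewrite mem_set ?subrr//; apply: AF; exact/set_mem.
apply: (@le_trans _ _ (c%:E * lebn R n (U `\` A))%E); last first.
  apply: (le_trans (lee_wpmul2l _ DE)); first by rewrite lee_fin ltW.
  by rewrite -EFinM lee_fin mulrC divfK ?gt_eqF.
have m1 : measurable_fun [set: T] (\1_A : T -> R) by exact: measurable_indic.
have m2 : measurable_fun [set: T] (\1_U : T -> R) by exact: measurable_indic.
have wD y : `|\1_A y - \1_U y| = \1_(U `\` A) y :> R by rewrite E normrN ger0_norm ?indicE.
exact: (heat_abs_indic_le Rn_gauss o (ltr0Sn R 1) mD (measurable_funB m1 m2) wD).
Qed.

Lemma all_recoverable_set (A : set T) : measurable A -> recoverable_set A.
Proof.
move=> mA; have [F TF mF] := sigma_finiteT mu.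
have -> : A = \bigcup_k (A `&` F k) by rewrite -setI_bigcupr -TF setIT.
apply: (recoverable_set_bigcup Rn_gauss eta_gt0 eta_le1) => k.
apply: recoverable_set_finite; first by apply: measurableI => //; case: (mF k).
apply: le_lt_trans (mF k).2; apply: le_measure; rewrite ?inE//.
- by apply: measurableI => //; case: (mF k).
- by case: (mF k).
Qed.

End all_recoverable_set.

End heat_Rn.

(** * The heat evolution of the given function *)

(** The iterated derivative of phi at h only depends on phi near h, so a family
    defined for positive times identifies it there. *)
Lemma derive1n_family {R : realType} (phi : R -> R) (F : nat -> R -> R) :
  (forall h : R, 0 < h -> phi h = F 0%N h) ->
  (forall i (h : R), 0 < h -> is_derive h 1 (F i) (F i.+1 h)) ->
  forall i (h : R), 0 < h -> derive1n i phi h = F i h.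
Proof.
move=> phiF dF; elim=> [|i IH] h h0; first by rewrite derive1n0 phiF.
rewrite derive1nS derive1E.
rewrite (@near_eq_derive _ _ _ _ (F i)); last first.
  by near=> t; apply: IH; near: t; exact: lt_nbhsr.
exact: (@derive_val _ _ _ _ _ _ _ (dF i h h0)).
Unshelve. end_near. Qed.

Section heat_of_function.
Context {R : realType} {n : nat}.
Hypothesis n_gt0 : (0 < n)%N.
Local Notation T := (Rn R n).
Local Notation mu := (@lebn_sf R n).
Variable f : T -> \bar R.
Hypothesis S0f : S0 f.
Hypothesis Lf : L1_plus_Loo f.

Let f0 : T -> R := fine \o f.
Local Notation G := (@Rn_gauss R n).

Lemma ae_fineE : {ae mu, forall x, f x = (f0 x)%:E}.
Proof.
case: S0f => _ ff _; apply: filterS ff => x fx; by rewrite /f0 /= fineK.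
Qed.

(** On a level set, which has finite measure, the bounded part of f contributes a
    finite amount and the other part is integrable. *)
Lemma level_integrable_fine : level_integrable mu f0.
Proof.
case: S0f => mf ff lf; have [g [k [gL kL fgk]]] := Lf.
have mf0 : measurable_fun [set: T] f0 by have mfine : measurable_fun [set: \bar R] (@fine R) by []; exact: (measurableT_comp mfine mf).
have gi : mu.-integrable setT (EFin \o g) by apply/Lfun1_integrable.
have [K K0 kK] : exists2 K : R, 0 <= K & {ae mu, forall x, `|k x| <= K}.
  have [_] := andP kL; rewrite inE /= /finite_norm unlock.
  have [mT|] := ltP 0%E (lebn R n [set: T]); last first.
    move=> T0 _; exists 0 => //.
    exists setT; split => //.
    by apply/eqP; rewrite eq_le measure_ge0 andbT.
  move=> kfin; set s := ess_sup _ _ in kfin.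
  have s0 : (0 <= s)%E by apply: ess_sup_gee mT _; apply: aeW => x; exact: abse_ge0.
  have sfin : s \is a fin_num by rewrite ge0_fin_numE.
  exists (fine s); first exact: fine_ge0.
  have := ess_sup_ge mu (abse \o (EFin \o k)); apply: filterS => x /=.
  by rewrite -/s -lee_fin fineK.
apply: (level_integrable_split mf0 (K := K) _ gi K0).
  move=> e e0; apply: le_lt_trans (lf e e0); apply: le_outer_measure => x /=.
  by rewrite /f0 /=; case: (f x) => [y| |] //=; rewrite normr0 => /(lt_trans e0); rewrite ltxx.
apply: filterS3 ae_fineE fgk kK => x fx fgx kx.
move: fgx; rewrite fx => -[->].
by rewrite (le_trans (ler_normD _ _))// lerD2l.
Qed.

Let af0 : admissible mu (@sqdist R n) (@half_dim R n) f0 := level_integrable_admissible G level_integrable_fine.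

Lemma dheatE m (h : R) x : 0 < h -> dheat m h f x = heat_deriv mu (@sqdist R n) (@half_dim R n) m h f0 x.
Proof.
move=> h0; case: S0f => mf ff _.
have H0 k : 0 < k -> fine (heat k f x) = heat_deriv mu (@sqdist R n) (@half_dim R n) 0 k f0 x.
  by move=> k0; rewrite (heatE k x mf); exact: (heat_deriv0_fine G x k0 mf ff).
exact: (derive1n_family (F := fun i h => heat_deriv mu (@sqdist R n) (@half_dim R n) i h f0 x)
  H0 (fun i k k0 => is_derive_heat_deriv G i x k0 af0) m h0).
Qed.

End heat_of_function.

(** * A Taylor expansion along dyadic times *)

Section geometric.
Context {R : realType}.
Implicit Types (rho : R) (s : seq nat) (j : int).

Lemma geometric_nat rho s : 0 <= rho -> rho < 1 -> uniq s ->
  \sum_(i <- s) rho ^+ i <= (1 - rho)^-1.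
Proof.
move=> r0 r1 us.
pose M := (\max_(i <- s) i).+1.
have sub : {subset s <= iota 0 M}.
  by move=> i si; rewrite mem_iota /= add0n ltnS; exact: leq_bigmax_seq.
apply: (@le_trans _ _ (\sum_(i <- iota 0 M) rho ^+ i)).
  rewrite [leRHS](bigID (mem s)) -[leLHS]addr0 lerD//; last first.
    by apply: sumr_ge0 => i _; rewrite exprn_ge0.
  rewrite -[leRHS]big_filter; apply: eq_imp_le; apply: perm_big.
  apply: uniq_perm => //; first by apply: filter_uniq; exact: iota_uniq.
  move=> i; apply/idP/idP => [si|]; rewrite mem_filter; last by case/andP.
  by apply/andP; split; [exact: si|exact: sub].
have -> : \sum_(i <- iota 0 M) rho ^+ i = (1 - rho ^+ M) / (1 - rho).
  apply: (@mulIf _ (1 - rho)); first by rewrite subr_eq0 eq_sym lt_eqF.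
  rewrite divfK; last by rewrite subr_eq0 eq_sym lt_eqF.
  rewrite -{2}(expr1n _ M) subrXX mulrC; congr (_ * _).
  rewrite -[iota 0 M]/(index_iota 0 M) big_mkord.
  by apply: eq_bigr => i _; rewrite expr1n mul1r.
rewrite ler_piMl ?invr_ge0 ?subr_ge0 ?(ltW r1)//.
by rewrite gerBl exprn_ge0.
Qed.

(** Each of the half-lines l >= j and l < j contributes at most one geometric
    series. *)
Lemma geometric_int rho j (t : seq int) : 0 <= rho -> rho < 1 -> uniq t ->
  \sum_(l <- t) rho ^+ `|l - j|%N <= 2 / (1 - rho).
Proof.
move=> r0 r1 ut.
have part (P : pred int) : {in P &, injective (fun l : int => `|l - j|%N)} ->
    \sum_(l <- t | P l) rho ^+ `|l - j|%N <= (1 - rho)^-1.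
  move=> inj; rewrite -big_filter -(big_map (fun l : int => `|l - j|%N) xpredT (fun i => rho ^+ i)).
  apply: geometric_nat => //; rewrite map_inj_in_uniq ?filter_uniq//.
  by move=> x y; rewrite !mem_filter => /andP[Px _] /andP[Py _]; exact: inj.
rewrite (bigID (fun l => (j <= l)%R))/= mulr_natl mulr2n; apply: lerD; apply: part.
- move=> x y; rewrite !unfold_in /= => jx jy e.
  have : Posz `|x - j|%N = Posz `|y - j|%N by rewrite e.
  by rewrite !gez0_abs ?subr_ge0// => /addIr.
- move=> x y; rewrite !unfold_in /= -!ltNge => jx jy e.
  have : Posz `|x - j|%N = Posz `|y - j|%N by rewrite e.
  by rewrite !ltz0_abs ?subr_lt0// => /oppr_inj /addIr.
Qed.

End geometric.

Section taylor.
Context {R : realType}.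
Variables (F : nat -> R -> R) (K : R).
Hypothesis K0 : 0 < K.
Hypothesis dF : forall i (h : R), 0 < h -> is_derive h 1 (F i) (F i.+1 h).
Hypothesis decF : forall i (e : R), 0 < e ->
  exists2 M, 0 < M & forall h, M < h -> h ^+ i * `|F i h| <= e.

Let psi m (h : R) := \sum_(i < m) (K - h) ^+ i / i`!%:R * F i h.

(** The expansion psi m.+1 at time h of the value at time K: all terms of its
    derivative but the last cancel. *)
Lemma is_derive_psi m (h : R) : 0 < h ->
  is_derive h 1 (psi m.+1) ((K - h) ^+ m / m`!%:R * F m.+1 h).
Proof.
move=> h0; elim: m => [|m IH].
  have -> : psi 1 = F 0%N.
    by apply/funext => t; rewrite /psi big_ord_recl big_ord0 expr0 addr0 divr1 mul1r.
  by rewrite expr0 divr1 mul1r; exact: dF.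
have -> : psi m.+2 = (fun t => psi m.+1 t + (m.+1`!%:R)^-1 * ((K - t) ^+ m.+1 * F m.+1 t)).
  apply/funext => t; rewrite /psi big_ord_recr/=; congr (_ + _).
  by rewrite mulrCA mulrA.
have dK : is_derive h 1 (fun t => K - t) (-1).
  by have := @is_deriveB R R R (cst K) id h 1 _ _ (is_derive_cst K h 1) (is_derive_id h 1); rewrite sub0r.
have dX := @is_deriveX R R (fun t => K - t) m.+1 h 1 _ dK.
have dM := @is_deriveM R R _ _ h 1 _ _ dX (dF m.+1 h0).
have dZ := @is_deriveZ R R R _ (m.+1`!%:R)^-1 h 1 _ dM.
have dD := @is_deriveD R R R _ _ h 1 _ _ IH dZ.
have E : (fun t => psi m.+1 t + (m.+1`!%:R)^-1 * ((K - t) ^+ m.+1 * F m.+1 t)) =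
    psi m.+1 + (m.+1`!%:R)^-1 \*: ((fun t : R => K - t) ^+ m.+1 * F m.+1).
  by apply/funext => t; rewrite !fctE.
rewrite E; apply: (is_derive_eq dD); rewrite !fctE.
rewrite /GRing.scale/= factS natrM -[m.+1%:R]natr1 -mulr_natr.
rewrite exprS.
have mf : m`!%:R != 0 :> R by rewrite pnatr_eq0 -lt0n fact_gt0.
field; rewrite mf/= natr1 pnatr_eq0//.
Qed.

(** The value psi at h = K is F 0 K, psi tends to 0 at infinity, and on the block
    [K 2^i, K 2^(i+1)] the mean value theorem bounds the increment of psi by
    a constant times (K 2^i)^m a_i. *)
Lemma taylor_telescope m (a : nat -> R) (S : R) : (0 < m)%N ->
  (forall i h, K * 2 ^+ i <= h -> h <= K * 2 ^+ i.+1 -> `|F m h| <= a i) ->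
  (forall N, \sum_(i < N) (K * 2 ^+ i) ^+ m * a i <= S) ->
  `|F 0 K| <= 2 ^+ m * S.
Proof.
case: m => // m _ Fa Sa.
have psiK : psi m.+1 K = F 0 K.
  rewrite /psi big_ord_recl subrr expr0 divr1 mul1r big1 ?addr0// => i _.
  by rewrite expr0n/= !mul0r.
have Ki i : 0 < K * 2 ^+ i by rewrite mulr_gt0// exprn_gt0.
have step i : `|psi m.+1 (K * 2 ^+ i.+1) - psi m.+1 (K * 2 ^+ i)| <=
    2 ^+ m * ((K * 2 ^+ i) ^+ m.+1 * a i).
  have lt1 : K * 2 ^+ i < K * 2 ^+ i.+1.
    by rewrite exprS ltr_pM2l// ltr_pMl ?exprn_gt0// ltr1n.
  have dpsi t : t \in `](K * 2 ^+ i), (K * 2 ^+ i.+1)[ ->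
      is_derive t 1 (psi m.+1) ((K - t) ^+ m / m`!%:R * F m.+1 t).
    rewrite in_itv/= => /andP[t1 _]; apply: is_derive_psi; exact: lt_trans t1.
  have cpsi : {within `[(K * 2 ^+ i), (K * 2 ^+ i.+1)], continuous (psi m.+1)}.
    apply: derivable_within_continuous => t; rewrite in_itv/= => /andP[t1 _].
    exact: (@ex_derive _ _ _ _ _ _ _ (is_derive_psi m (lt_le_trans (Ki i) t1))).
  have [c] := MVT lt1 dpsi cpsi.
  rewrite in_itv/= => /andP[c1 c2] ->.
  have c0 : 0 < c by exact: lt_trans c1.
  have -> : K * 2 ^+ i.+1 - K * 2 ^+ i = K * 2 ^+ i by rewrite exprS; ring.
  rewrite normrM (ger0_norm (ltW (Ki i))) normrM.
  have e1 : `|(K - c) ^+ m / m`!%:R| <= (K * 2 ^+ i.+1) ^+ m.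
    rewrite normrM normfV (ger0_norm (ler0n _ _)) normrX.
    apply: (@le_trans _ _ (`|K - c| ^+ m)).
      rewrite ler_pdivrMr ?ltr0n ?fact_gt0// ler_peMr ?exprn_ge0//.
      by rewrite ler1n fact_gt0.
    rewrite lerXn2r ?nnegrE ?(ltW (Ki _))//.
    have Kc : K <= c.
      by apply: le_trans (ltW c1); rewrite ler_peMr ?(ltW K0)// exprn_ege1// ler1n.
    by rewrite ler0_norm ?subr_le0// opprB lerBlDr (le_trans (ltW c2))// lerDl ltW.
  have a0 : 0 <= a i by apply: le_trans (Fa i c (ltW c1) (ltW c2)).
  apply: (le_trans (ler_wpM2r (ltW (Ki i)) (ler_pM (normr_ge0 _) (normr_ge0 _) e1 (Fa i c (ltW c1) (ltW c2))))).
  have -> : K * 2 ^+ i.+1 = 2 * (K * 2 ^+ i) by rewrite exprS; ring.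
  by apply: eq_imp_le; rewrite exprMn [in RHS]exprS; ring.
have tele N : psi m.+1 (K * 2 ^+ N) - psi m.+1 K =
    \sum_(i < N) (psi m.+1 (K * 2 ^+ i.+1) - psi m.+1 (K * 2 ^+ i)).
  elim: N => [|N IH]; first by rewrite big_ord0 expr0 mulr1 subrr.
  by rewrite big_ord_recr/= -IH; ring.
have bd N : `|F 0 K| <= 2 ^+ m * S + `|psi m.+1 (K * 2 ^+ N)|.
  have -> : F 0 K = psi m.+1 (K * 2 ^+ N) - (psi m.+1 (K * 2 ^+ N) - psi m.+1 K) by rewrite -psiK; ring.
  apply: (le_trans (ler_normB _ _)); rewrite addrC lerD2r tele.
  apply: (le_trans (ler_norm_sum _ _ _)).
  apply: (@le_trans _ _ (\sum_(i < N) 2 ^+ m * ((K * 2 ^+ i) ^+ m.+1 * a i))).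
    by apply: ler_sum => i _; exact: step.
  by rewrite -mulr_sumr ler_wpM2l ?exprn_ge0.
have S0 : 0 <= S by have := Sa 0%N; rewrite big_ord0.
apply/ler_addgt0Pr => e e0.
have em : 0 < e / m.+1%:R by rewrite divr_gt0.
have /choice[M HM] : forall i : 'I_m.+1, exists M : R, 0 < M /\ forall h, M < h -> h ^+ i * `|F i h| <= e / m.+1%:R.
  by move=> i; have [M M0 HM] := decF i em; exists M.
pose N := Num.truncn (\sum_i M i / K).
have big : forall i, M i < K * 2 ^+ N.
  move=> i; rewrite mulrC -ltr_pdivrMr//.
  apply: (@le_lt_trans _ _ (\sum_i M i / K)).
    rewrite (bigD1 i)//= lerDl; apply: sumr_ge0 => k _.
    by rewrite divr_ge0 ?(ltW K0)// ltW// (HM k).1.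
  apply: lt_le_trans (truncnS_gt _) _.
  by rewrite -natrX ler_nat; exact: ltn_expl.
apply: (le_trans (bd N)); apply: lerD.
  by rewrite exprS -mulrA ler_peMl ?mulr_ge0 ?exprn_ge0// ler1n.
apply: (le_trans (ler_norm_sum _ _ _)).
apply: (@le_trans _ _ (\sum_(i < m.+1) e / m.+1%:R)); last first.
  by rewrite sumr_const card_ord -[leLHS]mulr_natr divfK// pnatr_eq0.
apply: ler_sum => i _.
have := (HM i).2 _ (big i); apply: le_trans.
rewrite !normrM ler_wpM2r// normfV (ger0_norm (ler0n _ _)) normrX.
apply: (@le_trans _ _ (`|K - K * 2 ^+ N| ^+ i)).
  by rewrite ler_pdivrMr ?ltr0n ?fact_gt0// ler_peMr ?exprn_ge0// ler1n fact_gt0.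
rewrite lerXn2r ?nnegrE ?(ltW (Ki _))//.
rewrite ler0_norm; first by rewrite opprB lerBlDr lerDl ltW.
by rewrite subr_le0 ler_peMr ?(ltW K0)// exprn_ege1// ler1n.
Qed.

End taylor.

(** * The estimate on level sets *)

Section dyad.
Context {R : realType}.
Implicit Types (l k : int).

Definition dyad (H0 : R) l : R := H0 * 2 `^ l%:~R.

Lemma dyad_gt0 (H0 : R) l : 0 < H0 -> 0 < dyad H0 l.
Proof. by move=> h; rewrite mulr_gt0 ?powR_gt0. Qed.

Lemma dyadD (H0 : R) l k : dyad H0 (l + k) = dyad H0 l * 2 `^ k%:~R.
Proof. by rewrite /dyad intrD powRD ?mulrA// pnatr_eq0 implybT. Qed.

Lemma dyadDn (H0 : R) l (i : nat) : dyad H0 (l + i%:Z) = dyad H0 l * 2 ^+ i.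
Proof. by rewrite dyadD -powR_mulrn. Qed.

Lemma dyadS (H0 : R) l : dyad H0 (l + 1) = 2 * dyad H0 l.
Proof. by rewrite (dyadDn H0 l 1) expr1 mulrC. Qed.

Lemma dyad_le (H0 : R) l k : 0 < H0 -> (l <= k)%R -> dyad H0 l <= dyad H0 k.
Proof. by move=> h lk; rewrite ler_pM2l// ler_powR ?ler1n// ler_int. Qed.

Lemma dyad_powR (H0 : R) l (a : R) : 0 < H0 -> dyad H0 l `^ a = H0 `^ a * 2 `^ (l%:~R * a).
Proof. by move=> h; rewrite powRM ?powR_ge0 ?(ltW h)// -powRrM. Qed.

Lemma dyad_small (H0 : R) : 0 < H0 -> exists l, dyad H0 l <= 1.
Proof.
move=> h; exists (- (Num.truncn H0).+1%:Z).
rewrite /dyad mulrNz powRN ler_pdivrMr ?powR_gt0// mul1r.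
rewrite -[X in 2 `^ X]/((Num.truncn H0).+1%:R) powR_mulrn//.
apply: ltW; apply: lt_le_trans (truncnS_gt _) _.
by rewrite -natrX ler_nat ltnW// ltn_expl.
Qed.

Lemma dyad_cvg0 (H0 : R) l : (dyad H0 (l - i%:Z)) @[i --> \oo] --> (0 : R).
Proof.
have E : (fun i : nat => dyad H0 (l - i%:Z)) = (fun i => dyad H0 l * (2^-1) ^+ i).
  apply/funext => i; rewrite dyadD mulrNz powRN; congr (_ * _).
  by rewrite -[X in 2 `^ X]/(i%:R) powR_mulrn// exprVn.
rewrite E -[X in _ --> X](mulr0 (dyad H0 l)); apply: cvgMr.
by apply: cvg_expr; rewrite ger0_norm ?invr_ge0// invf_lt1// ltr1n.
Qed.

End dyad.

Section heat_weak_estimate.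
Context {R : realType} {n : nat}.
Local Notation T := (Rn R n).
Local Notation mu := (@lebn_sf R n).

Definition supheat m (s : R) (f : T -> \bar R) (x : T) : \bar R :=
  ereal_sup [set (h `^ (m%:R - s / 2) * `|dheat m h f x|)%:E
            | h in [set h : R | 0 < h]].

Lemma supheat_le m s f x (g h : R) : (supheat m s f x <= g%:E)%E -> 0 < h ->
  `|dheat m h f x| <= g * h `^ (s / 2 - m%:R).
Proof.
move=> Gg h0.
have : ((h `^ (m%:R - s / 2) * `|dheat m h f x|)%:E <= g%:E)%E.
  by apply: le_trans Gg; apply: ereal_sup_ubound; exists h.
have -> : s / 2 - m%:R = - (m%:R - s / 2) by ring.
by rewrite lee_fin powRN ler_pdivlMr ?powR_gt0// mulrC.
Qed.

Lemma supheat_ge0 m s f x : (0 <= supheat m s f x)%E.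
Proof.
apply: le_trans (ereal_sup_ubound _ ); last by exists 1 => //; exact: ltr01.
by rewrite lee_fin mulr_ge0 ?powR_ge0.
Qed.

Hypothesis n_gt0 : (0 < n)%N.
Variables (p1 : \bar R) (r s : R) (m : nat).
Hypotheses (hp1 : (1 <= p1)%E) (hr : 0 < r) (hs : s < 0) (m_gt0 : (0 < m)%N).

Let P1 := fine p1^-1.
Let rho : R := 2 `^ (- (r / 8)).
Let rho' : R := Num.max (2 `^ (- (r / 4))) (2 `^ (s / 2)).
Let X : R := 4 `^ (@half_dim R n) / (1 - rho).
Let C : R := 2 ^+ m * ((X + 1) * (2 / (1 - rho'))).

Let P1_01 : 0 <= P1 <= 1.
Proof.
rewrite /P1; move: hp1; case: p1 => [x| |]//=; last by rewrite ?invey lexx ler01.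
rewrite lee_fin => x1; have x0 : 0 < x by exact: lt_le_trans x1.
by rewrite inver gt_eqF//= invr_ge0 (ltW x0)/= invf_le1.
Qed.

Lemma powR2_lt1 (a : R) : 0 < a -> 2 `^ (- a) < 1.
Proof.
move=> a0; rewrite /powR pnatr_eq0/= expR_lt1 pmulr_llt0 ?oppr_lt0//.
by rewrite ln_gt0// ltr1n.
Qed.

Let rho_lt1 : rho < 1. Proof. by apply: powR2_lt1; rewrite divr_gt0. Qed.

Let rho_gt0 : 0 < rho. Proof. by rewrite powR_gt0. Qed.

Let rho'_lt1 : rho' < 1.
Proof.
rewrite gt_max powR2_lt1 ?divr_gt0//=.
by rewrite -(opprK (s / 2)) powR2_lt1// oppr_gt0 pmulr_llt0// invr_gt0.
Qed.

Let rho'_gt0 : 0 < rho'.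
Proof. by rewrite lt_max powR_gt0. Qed.

Let X_gt0 : 0 < X.
Proof. by rewrite divr_gt0 ?powR_gt0// subr_gt0. Qed.

Let C_gt0 : 0 < C.
Proof. by rewrite !mulr_gt0 ?exprn_gt0 ?addr_gt0 ?invr_gt0 ?subr_gt0. Qed.

Section one_function.
Variable f : T -> \bar R.
Hypotheses (S0f : S0 f) (Lf : L1_plus_Loo f).
Let f0 : T -> R := fine \o f.
Local Notation G := (@Rn_gauss R n).
Local Notation D i h := (heat_deriv mu (@sqdist R n) (@half_dim R n) i h f0).
Local Notation gs h w := (heat_abs mu (@sqdist R n) (@half_dim R n) h w).
Let sf0 : level_integrable mu f0 := level_integrable_fine S0f Lf.
Let af0 : admissible mu (@sqdist R n) (@half_dim R n) f0 := level_integrable_admissible G sf0.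

Variables (H0 t b g : R) (j : int).
Hypotheses (H0_gt0 : 0 < H0) (t_gt0 : 0 < t) (b_gt0 : 0 < b) (g_gt0 : 0 < g).
Let H := dyad H0.
Let H_gt0 l : 0 < H l. Proof. exact: dyad_gt0. Qed.
(** The share of the measure t granted to the exceptional set of block j - i. *)
Let tau (i : nat) : R := t * (1 - rho) * rho ^+ i.
(** The hypothesis allows b to grow by 2^(r/8) per block away from j: it will be a
    slowly varying sequence. *)
Let beta (i : nat) : R := b * 2 `^ (r / 8 * i%:R) * H (j - i%:Z) `^ (r / 2 - m%:R).

Let tau_gt0 i : 0 < tau i.
Proof. by rewrite !mulr_gt0 ?exprn_gt0// subr_gt0. Qed.

Let beta_gt0 i : 0 < beta i.
Proof. by rewrite !mulr_gt0 ?powR_gt0. Qed.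

Hypothesis besov_block : forall i : nat, exists h' : R,
  [/\ H (j - i%:Z - 2) <= h', h' <= H (j - i%:Z - 1) &
     ('N[lebn R n]_p1 [EFin \o dheat m h' f] <=
       (b * 2 `^ (r / 8 * i%:R) * H (j - i%:Z) `^ (r / 2 - m%:R))%:E)%E].

(** For a time h' two blocks earlier with small norm, every h in the block is
    reached from h' after a time comparable to H_l, so [heat_deriv_block] and
    [heat_abs_weak_type] apply. The measures [tau i] sum to t. *)
Lemma block_exceptional_set (i : nat) : exists2 B : set T,
  (lebn R n B <= (tau i)%:E)%E & forall x h, ~ B x ->
    H (j - i%:Z) <= h -> h <= H (j - i%:Z + 1) ->
    `|D m h x| <= 4 `^ (@half_dim R n) * (beta i * tau i `^ (- P1)).
Proof.
have [h' [h1 h2 hN]] := besov_block i.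
set l := (j - i%:Z)%R in h1 h2 hN *.
have Hl1 : H l = 2 * H (l - 1) by have := dyadS H0 (l - 1); rewrite subrK.
have e2 : l - 1 = l - 2 + 1 by ring.
have Hl2 : H (l - 1) = 2 * H (l - 2) := etrans (congr1 H e2) (dyadS H0 (l - 2)).
have Hl3 : H (l + 1) = 2 * H l := dyadS H0 l.
have h'0 : 0 < h' by exact: lt_le_trans h1.
have mD : measurable_fun [set: T] (D m h') := measurable_heat_deriv G m af0 h'0.
have NE : (EFin \o dheat m h' f) = EFin \o D m h'.
  by apply/funext => x /=; rewrite (dheatE S0f Lf m x h'0).
rewrite NE in hN.
exists [set x | ((beta i * tau i `^ (- P1))%:E < gs (H (l + 1)) (D m h') x)%E].
  exact: (heat_abs_weak_type G hp1 (H_gt0 (l + 1)) mD (beta_gt0 i) (tau_gt0 i) hN).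
move=> x h /= /negP; rewrite -leNgt => Bx lh hl.
have k1 : h' + H (l - 1) <= h by lra.
have k2 : h <= h' + H (l + 1) by lra.
have := heat_deriv_block G m x af0 h'0 (H_gt0 (l - 1)) k1 k2.
have -> : H (l + 1) / H (l - 1) = 4 by rewrite Hl3 Hl1; field; rewrite gt_eqF.
move/le_trans/(_ (lee_wpmul2l _ Bx)); rewrite lee_fin powR_ge0 => /(_ isT).
by rewrite -EFinM lee_fin.
Qed.

Let alpha (l : int) : R :=
  if (l <= j)%R then 4 `^ (@half_dim R n) * (beta `|l - j|%N * tau `|l - j|%N `^ (- P1))
  else g * H l `^ (s / 2 - m%:R).

Let Q : R := X * (b * t `^ (- P1) * H j `^ (r / 2)) + g * H j `^ (s / 2).

Let Q_ge0 : 0 <= Q.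
Proof.
apply: addr_ge0; last by rewrite mulr_ge0 ?powR_ge0// ltW.
rewrite mulr_ge0 ?(ltW X_gt0)// mulr_ge0 ?powR_ge0// mulr_ge0 ?powR_ge0//.
exact: ltW.
Qed.

(** The powers of H_l balance to H_l^(r/2) below j and H_l^(s/2) above j, so that
    both decay away from j; the decay r/2 beats the losses 2^(r/8 i), one from
    the hypothesis and one from the size of the exceptional sets. *)
Lemma alpha_bound (l : int) : H l ^+ m * alpha l <= Q * rho' ^+ `|l - j|%N.
Proof.
have X0 : 0 <= X * (b * t `^ (- P1) * H j `^ (r / 2)).
  rewrite mulr_ge0 ?(ltW X_gt0)// mulr_ge0 ?powR_ge0// mulr_ge0 ?powR_ge0//.
  exact: ltW.
have Y0 : 0 <= g * H j `^ (s / 2) by rewrite mulr_ge0 ?powR_ge0 ?(ltW g_gt0).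
have Hm (a : R) : H l ^+ m * H l `^ (a - m%:R) = H l `^ a.
  rewrite -powR_mulrn ?(ltW (H_gt0 _))// -powRD; first by congr (_ `^ _); ring.
  by rewrite (gt_eqF (H_gt0 _)) implybT.
rewrite /alpha; case: ifPn => lj; last first.
  rewrite -ltNge in lj.
  set d := `|l - j|%N.
  have dE : d%:Z = l - j by rewrite /d gez0_abs// subr_ge0 ltW.
  have lE : l = j + d%:Z by rewrite dE addrC subrK.
  rewrite mulrCA Hm {1}lE /H dyad_powR// intrD mulrDl powRD ?pnatr_eq0 ?implybT//.
  rewrite [X in g * X]mulrA -dyad_powR//.
  have -> : 2 `^ (d%:~R * (s / 2)) = (2 `^ (s / 2)) ^+ d.
    by rewrite mulrC [LHS]powRrM -powR_mulrn ?powR_ge0.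
  rewrite -/H mulrA; apply: ler_pM; rewrite ?exprn_ge0 ?powR_ge0//.
    by rewrite lerDr.
  by rewrite lerXn2r ?nnegrE ?powR_ge0 ?(ltW rho'_gt0)// le_max lexx orbT.
set d := `|l - j|%N.
have dE : d%:Z = - (l - j) by rewrite /d lez0_abs// subr_le0.
have lE : l = j - d%:Z by rewrite dE opprK addrC subrK.
rewrite /beta -lE.
have -> : H l ^+ m * (4 `^ (@half_dim R n) * (b * 2 `^ (r / 8 * d%:R) * H l `^ (r / 2 - m%:R) * tau d `^ (- P1))) =
   4 `^ (@half_dim R n) * b * 2 `^ (r / 8 * d%:R) * tau d `^ (- P1) * (H l ^+ m * H l `^ (r / 2 - m%:R)) by ring.
rewrite Hm {1}lE /H dyad_powR//.
have -> : (j - d%:Z)%:~R * (r / 2) = j%:~R * (r / 2) + d%:R * (- (r / 2)) :> R.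
  by rewrite intrD mulrNz -[(Posz d)%:~R]/(d%:R : R); ring.
rewrite powRD ?pnatr_eq0 ?implybT// [H0 `^ _ * _]mulrA -dyad_powR// -/H.
have tE : tau d `^ (- P1) <= t `^ (- P1) * (1 - rho)^-1 * 2 `^ (r / 8 * d%:R).
  have [P0 P11] := andP P1_01.
  have r1 : 0 < 1 - rho by rewrite subr_gt0.
  rewrite /tau powRM ?exprn_ge0 ?mulr_ge0 ?(ltW t_gt0) ?(ltW r1) ?(ltW rho_gt0)//.
  rewrite powRM ?(ltW t_gt0) ?(ltW r1)//.
  apply: ler_pM; rewrite ?mulr_ge0 ?powR_ge0//.
    rewrite ler_wpM2l ?powR_ge0// powRN lef_pV2 ?posrE ?powR_gt0//.
    rewrite -[leLHS]powRr1 ?(ltW r1)// /powR gt_eqF// ler_expR ler_wnM2r//.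
    by apply: ln_le0; rewrite gerBl (ltW rho_gt0).
  have -> : (rho ^+ d) `^ (- P1) = 2 `^ (r / 8 * d%:R * P1).
    by rewrite -powR_mulrn ?(ltW rho_gt0)// /rho -!powRrM; congr (_ `^ _); ring.
  rewrite ler_powR ?ler1n//.
  by rewrite ler_piMr ?mulr_ge0 ?divr_ge0 ?(ltW hr).
apply: (@le_trans _ _ (4 `^ (@half_dim R n) * b * 2 `^ (r / 8 * d%:R) *
   (t `^ (- P1) * (1 - rho)^-1 * 2 `^ (r / 8 * d%:R)) * (H j `^ (r / 2) * 2 `^ (d%:R * - (r / 2))))).
  by rewrite ler_wpM2r ?mulr_ge0 ?powR_ge0// ler_wpM2l ?mulr_ge0 ?powR_ge0 ?(ltW b_gt0).
have -> : 4 `^ (@half_dim R n) * b * 2 `^ (r / 8 * d%:R) *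
   (t `^ (- P1) * (1 - rho)^-1 * 2 `^ (r / 8 * d%:R)) * (H j `^ (r / 2) * 2 `^ (d%:R * - (r / 2))) =
   X * (b * t `^ (- P1) * H j `^ (r / 2)) * (2 `^ (- (r / 4))) ^+ d.
  have -> : (2 `^ (- (r / 4))) ^+ d = 2 `^ (r / 8 * d%:R) * 2 `^ (r / 8 * d%:R) * 2 `^ (d%:R * - (r / 2)) :> R.
    rewrite -powR_mulrn ?powR_ge0// -powRrM -!powRD ?pnatr_eq0 ?implybT//.
    by congr (_ `^ _); field.
  by rewrite /X; field; rewrite subr_eq0 gt_eqF.
apply: ler_pM; rewrite ?exprn_ge0 ?powR_ge0//; first by rewrite lerDl.
by rewrite lerXn2r ?nnegrE ?powR_ge0 ?(ltW rho'_gt0)// le_max lexx.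
Qed.

Lemma pointwise_estimate (x : T) :
  (forall (i : nat) h, H (j - i%:Z) <= h -> h <= H (j - i%:Z + 1) ->
    `|D m h x| <= 4 `^ (@half_dim R n) * (beta i * tau i `^ (- P1))) ->
  (supheat m s f x <= g%:E)%E ->
  forall l : int, `|D 0%N (H l) x| <= C * (b * t `^ (- P1) * H j `^ (r / 2) + g * H j `^ (s / 2)).
Proof.
move=> Bx Gx l.
have nu_gt0 : 0 < @half_dim R n by rewrite divr_gt0// ltr0n.
have blk i : H l * 2 ^+ i = H (l + i%:Z) by rewrite /H dyadDn.
have blkS i : H l * 2 ^+ i.+1 = H (l + i%:Z + 1).
  by rewrite exprS mulrCA blk /H dyadS.
have hblock : forall i h, H l * 2 ^+ i <= h -> h <= H l * 2 ^+ i.+1 ->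
    `|D m h x| <= alpha (l + i%:Z).
  move=> i h; rewrite blk blkS; move: (l + i%:Z) => k h1 h2.
  have h0 : 0 < h by exact: lt_le_trans h1.
  rewrite /alpha; case: ifPn => kj.
    have dE : (`|k - j|%N)%:Z = - (k - j) by rewrite lez0_abs// subr_le0.
    have kE : k = j - (`|k - j|%N)%:Z by rewrite dE opprK addrC subrK.
    by apply: Bx; rewrite -kE.
  rewrite -(dheatE S0f Lf m x h0).
  apply: (le_trans (supheat_le Gx h0)); rewrite ler_wpM2l ?(ltW g_gt0)//.
  have -> : s / 2 - m%:R = - (m%:R - s / 2) by ring.
  rewrite !powRN lef_pV2 ?posrE ?powR_gt0//.
  have ms : 0 <= m%:R - s / 2 by rewrite subr_ge0 (@le_trans _ _ 0)// pmulr_lle0 ?invr_gt0// ltW.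
  by rewrite ge0_ler_powR ?nnegrE ?(ltW h0) ?(ltW (H_gt0 _)).
have hsum : forall N, \sum_(i < N) (H l * 2 ^+ i) ^+ m * alpha (l + i%:Z) <= Q * (2 / (1 - rho')).
  move=> N; apply: (@le_trans _ _ (\sum_(i < N) Q * rho' ^+ (absz (l + i%:Z - j)%R))).
    by apply: ler_sum => i _; rewrite blk; exact: alpha_bound.
  rewrite -mulr_sumr ler_wpM2l//.
  rewrite -(big_mkord xpredT (fun i => rho' ^+ absz (l + i%:Z - j)%R)).
  rewrite -(big_map (fun i : nat => l + i%:Z) xpredT (fun k : int => rho' ^+ `|k - j|%N)).
  apply: geometric_int; [exact: ltW|exact: rho'_lt1|].
  rewrite map_inj_uniq ?iota_uniq// => i1 i2 /addrI; by case.
have dF i (h : R) : 0 < h -> is_derive h 1 (fun h => D i h x) (D i.+1 h x).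
  by move=> h0; exact: (is_derive_heat_deriv G i x h0 af0).
have decF i (e : R) : 0 < e -> exists2 M, 0 < M & forall h : R, M < h -> h ^+ i * `|D i h x| <= e.
  by move=> e0; exact: (heat_deriv_decay G i x nu_gt0 sf0 e0).
have := @taylor_telescope R (fun i h => D i h x) (H l) (H_gt0 l) dF decF m _ _ m_gt0 hblock hsum.
have c0 : 0 <= 2 / (1 - rho') by rewrite divr_ge0// subr_ge0 ltW.
move/le_trans; apply.
set u := b * t `^ (- P1) * H j `^ (r / 2); set v := g * H j `^ (s / 2).
have u0 : 0 <= u by rewrite mulr_ge0 ?powR_ge0// mulr_ge0 ?powR_ge0// ltW.
have v0 : 0 <= v by rewrite mulr_ge0 ?powR_ge0// ltW.
have -> : C * (u + v) = 2 ^+ m * ((X + 1) * (u + v) * (2 / (1 - rho'))).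
  by rewrite /C; set z := 2 / _; ring.
rewrite ler_wpM2l ?exprn_ge0// ler_wpM2r// /Q -/u -/v.
have Xv : 0 <= X * v by rewrite mulr_ge0 ?(ltW X_gt0).
by rewrite mulrDl mul1r mulrDr; lra.
Qed.

(** Off the exceptional sets and the set where [supheat] exceeds g,
    [pointwise_estimate] bounds the heat evolution at all dyadic times, hence
    almost everywhere f itself by [ae_le_heat_deriv]. *)
Lemma lambda_estimate :
  (lambda f (C * (b * t `^ (- P1) * H j `^ (r / 2) + g * H j `^ (s / 2))) <=
    t%:E + lambda (supheat m s f) g)%E.
Proof.
set A := C * _.
have /choice[B HB] : forall i : nat, exists B : set T,
    (lebn R n B <= (tau i)%:E)%E /\ forall x h, ~ B x ->
    H (j - i%:Z) <= h -> h <= H (j - i%:Z + 1) ->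
    `|D m h x| <= 4 `^ (@half_dim R n) * (beta i * tau i `^ (- P1)).
  by move=> i; have [B B1 B2] := block_exceptional_set i; exists B.
have [l0 Hl0] := dyad_small H0_gt0.
pose eta (k : nat) := H (l0 - k%:Z).
have eta_gt0 k : 0 < eta k by exact: H_gt0.
have eta_le1 k : eta k <= 1.
  by apply: le_trans Hl0; apply: dyad_le => //; rewrite gerBl.
have eta0 : eta k @[k --> \oo] --> 0 by exact: dyad_cvg0.
pose o : T := [tuple 0 | i < n].
have aef := ae_le_heat_deriv G eta_gt0 eta_le1 (all_recoverable_set o eta_gt0 eta_le1 eta0) af0.
have [N [mN N0 NP]] := filterI aef (ae_fineE S0f).
pose U1 := \bigcup_i B i.
pose U2 := [set x : T | (g%:E < `|supheat m s f x|)%E].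
have sub : [set x : T | (A%:E < `|f x|)%E] `<=` (U1 `|` U2) `|` N.
  move=> x /= Ax; apply: contrapT => /not_orP[/not_orP[nU1 nU2] nN].
  have [P1x P2x] : (forall B : R, (forall k : nat, `|D 0%N (eta k) x| <= B) -> `|f0 x| <= B) /\
      f x = (f0 x)%:E.
    by apply: contrapT => nP; apply: nN; exact: NP.
  move: Ax; rewrite P2x; apply/negP; rewrite -leNgt lee_fin.
  apply: P1x => k; apply: pointwise_estimate.
    by move=> i h; apply: (HB i).2 => Bi; apply: nU1; exists i.
  rewrite leNgt; apply/negP => gx; apply: nU2.
  by rewrite /U2/= gee0_abs// supheat_ge0.
rewrite /lambda; apply: (le_trans (le_outer_measure (mu_ext (borel_leb R n)) _ _ sub)).
apply: (le_trans (outer_measureU2 (mu_ext (borel_leb R n)) _ _)).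
have N0' : (lebn R n N <= 0)%E by exact: eq_imp_le N0.
rewrite -[leRHS]adde0; apply: leeD; last exact: N0'.
apply: (le_trans (outer_measureU2 (mu_ext (borel_leb R n)) _ _)).
apply: leeD => //.
apply: (le_trans (outer_measure_sigma_subadditive (mu_ext (borel_leb R n)) B)).
apply: lime_le; first exact: is_cvg_nneseries.
apply: nearW => K.
apply: (@le_trans _ _ (\sum_(0 <= i < K) (tau i)%:E)%E).
  by apply: lee_sum => i _; exact: (HB i).1.
rewrite sumEFin lee_fin /tau -mulr_sumr.
have r1 : 0 < 1 - rho by rewrite subr_gt0.
have gN := @geometric_nat R rho (index_iota 0 K) (ltW rho_gt0) rho_lt1 (iota_uniq _ _).
apply: (le_trans (ler_wpM2l _ gN)); first by rewrite mulr_ge0 ?(ltW t_gt0) ?(ltW r1).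
by rewrite mulfK// gt_eqF.
Qed.

End one_function.

Theorem level_set_estimate : exists2 K : R, 0 < K & forall f : T -> \bar R,
  S0 f -> L1_plus_Loo f -> forall (H0 t b g : R) (j : int),
  0 < H0 -> 0 < t -> 0 < b -> 0 < g ->
  (forall i : nat, exists h' : R,
    [/\ dyad H0 (j - i%:Z - 2) <= h', h' <= dyad H0 (j - i%:Z - 1) &
       ('N[lebn R n]_p1 [EFin \o dheat m h' f] <=
        (b * 2 `^ (r / 8 * i%:R) * dyad H0 (j - i%:Z) `^ (r / 2 - m%:R))%:E)%E]) ->
  (lambda f (K * (b * t `^ (- fine p1^-1) * dyad H0 j `^ (r / 2) +
                  g * dyad H0 j `^ (s / 2))) <=
    t%:E + lambda (supheat m s f) g)%E.
Proof.
exists C; first exact: C_gt0.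
move=> f S0f Lf H0 t b g j H00 t0 b0 g0 hb.
exact (@lambda_estimate f S0f Lf H0 t b g j H00 t0 b0 g0 hb).
Qed.

End heat_weak_estimate.

(** * Sequences with bounded l^q norm *)

Section sequence_bounds.
Context {R : realType}.
Implicit Types (c : int -> R) (K : R) (q : \bar R).

(** Bounding the finite partial sums of the l^q norm avoids any summability
    hypothesis. *)
Definition lq_bound q c K : Prop :=
  match q with
  | q'%:E => forall s : seq int, uniq s -> \sum_(l <- s) c l `^ q' <= K `^ q'
  | _ => forall l, c l <= K
  end.

Lemma ler_powRl (q : R) : 0 < q -> {in Num.nneg &, {mono @powR R ^~ q : x y / x <= y}}.
Proof.
move=> q0 x y; rewrite !nnegrE => x0 y0; apply/idP/idP => [|xy].
  apply: contraTT; rewrite -!ltNge => yx.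
  by rewrite gt0_ltr_powR ?nnegrE.
by rewrite ge0_ler_powR ?nnegrE// ltW.
Qed.

Lemma powRX (x q : R) (d : nat) : 0 <= x -> (x ^+ d) `^ q = (x `^ q) ^+ d.
Proof.
by move=> x0; rewrite -(powR_mulrn _ x0) -(powR_mulrn _ (powR_ge0 x q)) -!powRrM mulrC.
Qed.

Lemma lq_bound_le q c K l : (0 < q)%E -> (forall i, 0 <= c i) -> 0 <= K ->
  lq_bound q c K -> c l <= K.
Proof.
case: q => [q| |]//= + c0 K0; rewrite ?lte_fin => q0 H.
by have := H [:: l] isT; rewrite big_seq1 ler_powRl ?nnegrE.
Qed.

Lemma lq_bound_mono q c c' K : (0 < q)%E -> (forall i, 0 <= c' i) ->
  (forall i, c' i <= c i) -> lq_bound q c K -> lq_bound q c' K.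
Proof.
case: q => [q| |]//= + c0 cc; rewrite ?lte_fin => q0 H; last by move=> l; exact: le_trans (H l).
move=> s us; apply: le_trans (H s us); apply: ler_sum => i _.
by rewrite ler_powRl ?nnegrE// (le_trans (c0 i)).
Qed.

Lemma lq_boundZ q c K a : 0 <= a -> 0 <= K -> (forall i, 0 <= c i) ->
  lq_bound q c K -> lq_bound q (fun l => a * c l) (a * K).
Proof.
case: q => [q| |]/= a0 K0 c0 H.
- move=> s us; rewrite powRM// (eq_bigr (fun l => a `^ q * c l `^ q)); last first.
    by move=> i _; rewrite powRM.
  by rewrite -mulr_sumr ler_wpM2l ?powR_ge0// H.
- by move=> l; rewrite ler_wpM2l.
- by move=> l; rewrite ler_wpM2l.
Qed.

Lemma lq_bound_inj q c K (phi : int -> int) : injective phi ->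
  lq_bound q c K -> lq_bound q (c \o phi) K.
Proof.
case: q => [q| |]/= inj H; [|by move=> l..].
move=> s us; rewrite -(big_map phi xpredT (fun l => c l `^ q)).
by apply: H; rewrite map_inj_uniq.
Qed.

Lemma lq_bound_max q c c' K : (0 < q)%E -> (forall i, 0 <= c i) -> (forall i, 0 <= c' i) ->
  0 <= K -> lq_bound q c K -> lq_bound q c' K ->
  lq_bound q (fun l => Num.max (c l) (c' l)) (2 `^ fine q^-1 * K).
Proof.
case: q => [q| |]//=; rewrite ?lte_fin => q0 c0 c'0 K0 H H'.
- move=> s us; rewrite inver gt_eqF//= powRM ?powR_ge0// -powRrM mulVf ?gt_eqF// powRr1//.
  rewrite mulr_natl mulr2n; apply: le_trans (lerD (H s us) (H' s us)).
  rewrite -big_split; apply: ler_sum => i _ /=.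
  by rewrite maxEle; case: ifP => _; [rewrite lerDr|rewrite lerDl]; rewrite powR_ge0.
- by move=> l; rewrite ?invey/= powRr0 mul1r ge_max H H'.
Qed.

Section smoothing.
Variable kappa : R.
Hypothesis kappa_gt1 : 1 < kappa.

Let k0 : 0 < kappa. Proof. exact: lt_trans kappa_gt1. Qed.
Let ki0 : 0 < kappa^-1. Proof. by rewrite invr_gt0. Qed.
Let ki1 : kappa^-1 < 1. Proof. by rewrite invf_lt1. Qed.

Definition slowly_varying c := forall i j : int, c i <= kappa ^+ `|i - j|%N * c j.

Let peak (l : int) : R := kappa^-1 ^+ `|l|%N.

Lemma lq_bound_peak q : (0 < q)%E -> exists2 D : R, 0 < D & lq_bound q peak D.
Proof.
case: q => [q| |]//=; rewrite ?lte_fin => q0; last first.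
  exists 1; rewrite ?ltr01// => l; rewrite /peak exprn_ile1 ?(ltW ki1)//.
  exact: ltW.
set rho := (kappa^-1) `^ q.
have rho0 : 0 <= rho by rewrite powR_ge0.
have rho1 : rho < 1.
  rewrite -(congr1 (fun g => g q) (powR1 R)) /rho gt0_ltr_powR ?nnegrE ?ler01 ?(ltW ki0)//.
exists ((2 / (1 - rho)) `^ q^-1).
  by rewrite powR_gt0// divr_gt0// subr_gt0.
move=> s us; rewrite -powRrM mulVf ?gt_eqF// powRr1; last first.
  by rewrite divr_ge0// subr_ge0 ltW.
apply: le_trans (geometric_int 0 rho0 rho1 us).
by apply: ler_sum => l _; rewrite subr0 /peak (powRX _ _ (ltW ki0)).
Qed.

(** Take c'_j = sup_i kappa^(-|i-j|) max (c_i) (K kappa^(-|i|)); the second entry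
    of the maximum makes c' positive. An index i almost attaining the supremum
    for j is charged, over all j, at most a geometric series times its own term. *)
Lemma smoothing q : (0 < q)%E -> exists2 D : R, 0 < D &
  forall c K, 0 < K -> (forall i, 0 <= c i) -> lq_bound q c K ->
  exists c', [/\ forall i, 0 < c' i, forall i, c i <= c' i,
    slowly_varying c' & lq_bound q c' (D * K)].
Proof.
move=> q0.
have [D0 D00 HD0] := lq_bound_peak q0.
pose D1 := 2 `^ fine q^-1 * (1 + D0).
have D10 : 0 < D1 by rewrite mulr_gt0 ?powR_gt0// addr_gt0.
pose D2 : R := if q is q'%:E then
   (2 / (1 - (kappa^-1) `^ q')) `^ q'^-1 * 2 else 1.
have rho1 (q' : R) : 0 < q' -> (kappa^-1) `^ q' < 1.
  by move=> q'0; rewrite -(congr1 (fun g => g q') (powR1 R)) gt0_ltr_powR ?nnegrE ?ler01 ?(ltW ki0).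
have D20 : 0 < D2.
  rewrite /D2; move: q0; case: q {HD0 D1 D10 D2} => [q'| |]//=; rewrite lte_fin => q'0.
  by rewrite mulr_gt0// powR_gt0// divr_gt0// subr_gt0 rho1.
exists (D2 * D1); first exact: mulr_gt0.
move=> c K K0 c0 Hc.
pose b l := Num.max (c l) (K * peak l).
have pk0 l : 0 < peak l by rewrite exprn_gt0.
have b0 l : 0 < b l by rewrite lt_max [X in _ || X]mulr_gt0// orbT.
have Hb : lq_bound q b (D1 * K).
  rewrite /D1 -mulrA [(1 + D0) * K]mulrC; apply: lq_bound_max => //.
  - by move=> i; rewrite mulr_ge0 ?(ltW K0)// ltW.
  - by rewrite mulr_ge0 ?addr_ge0 ?(ltW K0) ?(ltW D00).
  - move: Hc q0; case: q {HD0 D1 D10 D2 D20} => [q'| |]//=; rewrite ?lte_fin => + q'0.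
      move=> Hc s us; apply: (le_trans (Hc s us)).
      by rewrite ler_powRl ?nnegrE ?mulr_ge0 ?addr_ge0 ?(ltW K0) ?(ltW D00)// ler_peMr ?(ltW K0)// lerDl ltW.
    move=> Hc l; apply: (le_trans (Hc l)); rewrite ler_peMr ?(ltW K0)// lerDl ltW//.
  - apply: (@lq_bound_mono _ (fun l => K * peak l)) => //.
      by move=> i; rewrite mulr_ge0 ?(ltW K0)// ltW.
    have := @lq_boundZ q peak D0 K (ltW K0) (ltW D00) (fun i => ltW (pk0 i)) HD0.
    move: q0; case: q {HD0 D1 D10 D2 D20 Hc} => [q'| |]//=; rewrite ?lte_fin => q'0 H.
      move=> s us; apply: (le_trans (H s us)).
      rewrite ler_powRl ?nnegrE ?mulr_ge0 ?addr_ge0 ?(ltW K0) ?(ltW D00)//.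
      by rewrite ler_wpM2l ?(ltW K0)// lerDr.
    by move=> l; apply: (le_trans (H l)); rewrite ler_wpM2l ?(ltW K0)// lerDr.
have DK0 : 0 <= D1 * K by rewrite ltW// mulr_gt0.
have bK l : b l <= D1 * K := lq_bound_le l q0 (fun i => ltW (b0 i)) DK0 Hb.
pose S (j : int) := [set kappa^-1 ^+ `|i - j|%N * b i | i in [set: int]].
have kge (d : nat) : 0 < kappa^-1 ^+ d by rewrite exprn_gt0.
have kle (d : nat) : kappa^-1 ^+ d <= 1 by rewrite exprn_ile1 ?(ltW ki1)// ltW.
have Sub j : ubound (S j) (D1 * K).
  move=> _ [i _ <-]; apply: le_trans (bK i).
  by rewrite ler_piMl// ltW.
have Ssup j : has_sup (S j).
  by split; [exists (kappa^-1 ^+ `|j - j|%N * b j); exists j|exists (D1 * K)].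
pose c' j := sup (S j).
have c'ge i j : kappa^-1 ^+ `|i - j|%N * b i <= c' j.
  by apply: sup_upper_bound; [exact: Ssup|exists i].
have c'b j : b j <= c' j by have := c'ge j j; rewrite subrr expr0 mul1r.
exists c'; split.
- by move=> i; exact: lt_le_trans (c'b i).
- by move=> i; apply: le_trans (c'b i); rewrite le_max lexx.
- move=> i j; apply: ge_sup; first by case: (Ssup i).
  move=> _ [l _ <-].
  rewrite -ler_pdivrMl ?exprn_gt0// -exprVn; apply: le_trans (c'ge l j).
  rewrite mulrA ler_wpM2r ?(ltW (b0 _))// -exprD.
  by rewrite ler_wiXn2l ?(ltW ki0) ?(ltW ki1)// addnC leqD_dist.
have c'K j : c' j <= D1 * K by apply: ge_sup; [case: (Ssup j)|exact: Sub].
have c'0 j : 0 < c' j by exact: lt_le_trans (c'b j).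
have /choice[iota Hiota] : forall j, exists i, c' j <= 2 * (kappa^-1 ^+ `|i - j|%N * b i).
  move=> j; have h : 0 < c' j / 2 by rewrite divr_gt0.
  have [_ [i _ <-] hi] := sup_adherent h (Ssup j).
  exists i; rewrite -/(c' j) in hi; lra.
rewrite /D2 -mulrA.
clear D2 D20; clearbody D1.
move: q0 Hb; case: q {Hc HD0} => [q'| |]//=; rewrite ?lte_fin => q'0 Hb; last first.
  by move=> l; rewrite mul1r.
move=> s us.
set rho := (kappa^-1) `^ q'.
have r1 : rho < 1 by exact: rho1.
have r0 : 0 <= rho by exact: powR_ge0.
have r10 : 0 <= 2 / (1 - rho) by rewrite divr_ge0// subr_ge0 ltW.
pose Fn (i j : int) := 2 `^ q' * (rho ^+ `|j - i|%N * b i `^ q').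
have Fn0 i j : 0 <= Fn i j by rewrite !mulr_ge0 ?exprn_ge0 ?powR_ge0.
have step1 j : c' j `^ q' <= Fn (iota j) j.
  have -> : Fn (iota j) j = (2 * (kappa^-1 ^+ `|iota j - j|%N * b (iota j))) `^ q'.
    rewrite /Fn powRM ?mulr_ge0 ?(ltW (kge _)) ?(ltW (b0 _))// powRM ?(ltW (kge _)) ?(ltW (b0 _))//.
    by rewrite (powRX _ _ (ltW ki0)) distnC.
  by rewrite ler_powRl// nnegrE ?(ltW (c'0 _))// !mulr_ge0 ?(ltW (kge _)) ?(ltW (b0 _)).
pose U := undup (map iota s).
have step2 : \sum_(j <- s) c' j `^ q' <= \sum_(i <- U) \sum_(j <- s) Fn i j.
  rewrite exchange_big/= big_seq [leRHS]big_seq; apply: ler_sum => j js.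
  apply: (le_trans (step1 j)).
  rewrite (bigD1_seq (iota j))/= ?undup_uniq ?mem_undup ?map_f//.
  by rewrite lerDl sumr_ge0.
apply: (le_trans step2).
apply: (@le_trans _ _ (\sum_(i <- U) (2 `^ q' * (2 / (1 - rho))) * b i `^ q')).
  apply: ler_sum => i _; rewrite /Fn -mulr_sumr -mulr_suml -mulrA.
  rewrite ler_wpM2l ?powR_ge0// ler_wpM2r ?powR_ge0//.
  exact: geometric_int.
rewrite -mulr_sumr.
apply: (@le_trans _ _ ((2 `^ q' * (2 / (1 - rho))) * (D1 * K) `^ q')).
  apply: ler_wpM2l; first by rewrite mulr_ge0 ?powR_ge0.
  by apply: Hb; rewrite undup_uniq.
have A0 : 0 <= (2 / (1 - rho)) `^ q'^-1 by exact: powR_ge0.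
rewrite [leRHS]powRM//; last by rewrite mulr_ge0.
rewrite [X in _ <= X * _]powRM// -powRrM mulVf ?gt_eqF// powRr1//.
by rewrite [_ * 2 `^ q']mulrC.
Qed.

End smoothing.

End sequence_bounds.

(** * Balancing two sequences *)

Section selection.
Context {R : realType}.
Variables (kappa lam : R).
Hypotheses (kappa_gt1 : 1 < kappa) (lam_ge : kappa ^+ 2 <= lam).

Let k0 : 0 < kappa. Proof. exact: lt_trans kappa_gt1. Qed.
Let lk : kappa < lam.
Proof. by apply: lt_le_trans lam_ge; rewrite expr2 ltr_pMr. Qed.
Let l0 : 0 < lam. Proof. exact: lt_trans lk. Qed.
Let l1 : 1 < lam. Proof. exact: lt_trans lk. Qed.

Lemma geometric_growth (mu : R) (c : int -> R) (i : nat) l : 0 <= mu ->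
  (forall j, mu * c j <= c (j + 1)) -> mu ^+ i * c l <= c (l + i%:Z).
Proof.
move=> m0 H; elim: i => [|i IH]; first by rewrite mul1r addr0.
rewrite exprS -mulrA (le_trans (ler_wpM2l m0 IH))// (le_trans (H _))//.
by rewrite -addrA -[(i%:Z + 1)%R]/((i + 1)%N%:Z) addn1.
Qed.

Lemma powR_intD (a b : int) : lam `^ (a + b)%:~R = lam `^ a%:~R * lam `^ b%:~R.
Proof. by rewrite intrD powRD// (gt_eqF l0) implybT. Qed.

(** As u grows at least geometrically, it tends to 0 and to infinity at the two
    ends. *)
Lemma bracket (mu : R) (u : int -> R) (v : R) : 1 < mu -> (forall j, 0 < u j) ->
  (forall j, mu * u j <= u (j + 1)) -> 0 < v -> exists j, u j <= v < u (j + 1).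
Proof.
move=> m1 u0 H v0.
have m0 : 0 < mu by exact: lt_trans m1.
have big (A : R) : exists N : nat, A < mu ^+ N.
  have : (mu^-1 ^+ N @[N --> \oo] --> 0).
    by apply: cvg_expr; rewrite ger0_norm ?invr_ge0 ?(ltW m0)// invf_lt1.
  move=> /cvgrPdist_lt/(_ (Num.max A 1)^-1).
  have A0 : 0 < Num.max A 1 by rewrite lt_max ltr01 orbT.
  rewrite invr_gt0 => /(_ A0) [N _ /(_ N (leqnn _))] /=.
  rewrite sub0r normrN ger0_norm ?exprn_ge0 ?invr_ge0 ?(ltW m0)// exprVn.
  rewrite ltf_pV2 ?posrE ?exprn_gt0// => h; exists N; apply: le_lt_trans h.
  by rewrite le_max lexx.
have [N1 HN1] := big (u 0 / v); have [N2 HN2] := big (v / u 0).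
have low : u (- N1%:Z) <= v.
  have := geometric_growth N1 (- N1%:Z) (ltW m0) H; rewrite addNr => h.
  rewrite -(ler_pM2l (exprn_gt0 N1 m0)) (le_trans h)//.
  by rewrite -ler_pdivrMr// ltW.
have ex : exists i : nat, v < u (- N1%:Z + i%:Z).
  exists (N1 + N2)%N; rewrite PoszD addrA addNr add0r.
  apply: lt_le_trans (geometric_growth N2 0 (ltW m0) H).
  by rewrite -ltr_pdivrMr.
case: (ex_minnP ex) => -[|i] hi mi.
  by move: hi; rewrite addr0 ltNge low.
exists (- N1%:Z + i%:Z); apply/andP; split.
  by rewrite leNgt; apply/negP => /mi; rewrite ltnn.
by rewrite -addrA -[(i%:Z + 1)%R]/((i + 1)%N%:Z) addn1.
Qed.

Lemma slowly_varyingS (c : int -> R) j : slowly_varying kappa c ->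
  c j <= kappa * c (j + 1) /\ c (j + 1) <= kappa * c j.
Proof.
move=> sv; split; [have := sv j (j + 1)|have := sv (j + 1) j].
  by rewrite opprD addrA subrr add0r abszN expr1.
by rewrite addrC addrA addNr add0r expr1.
Qed.

(** Take phi k with u_(phi k) <= v_k < u_(phi k + 1), where u_j = lam^j b_j and
    v_k = lam^(4k) g_k. One step of v multiplies it by at least lam kappa, and
    one step of u multiplies it by at most lam kappa, so no bracket is used
    twice. *)
Lemma selection (b g : int -> R) : (forall i, 0 < b i) -> (forall i, 0 < g i) ->
  slowly_varying kappa b -> slowly_varying kappa g ->
  exists2 phi : int -> int, injective phi & forall k,
    lam `^ (phi k - 4 * k)%:~R * b (phi k) <= g k /\
    g k <= lam `^ (phi k - 4 * k)%:~R * (lam * kappa) * b (phi k).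
Proof.
move=> b0 g0 sb sg.
pose u j := lam `^ j%:~R * b j.
pose v k := lam `^ (4 * k)%:~R * g k.
have u0 j : 0 < u j by rewrite mulr_gt0 ?powR_gt0.
have v0 k : 0 < v k by rewrite mulr_gt0 ?powR_gt0.
have pS j : lam `^ (j + 1)%:~R = lam * lam `^ j%:~R.
  by rewrite powR_intD powRr1 ?(ltW l0)// mulrC.
have uS1 j : lam / kappa * u j <= u (j + 1).
  have [h _] := slowly_varyingS j sb.
  have -> : lam / kappa * u j = lam * lam `^ j%:~R * (b j / kappa) by rewrite /u; ring.
  rewrite /u pS ler_wpM2l ?mulr_ge0 ?powR_ge0 ?(ltW l0)// ler_pdivrMr//.
  by rewrite mulrC.
have uS2 j : u (j + 1) <= lam * kappa * u j.
  have [_ h] := slowly_varyingS j sb.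
  have -> : lam * kappa * u j = lam * lam `^ j%:~R * (kappa * b j) by rewrite /u; ring.
  by rewrite /u pS ler_wpM2l ?mulr_ge0 ?powR_ge0 ?(ltW l0).
have vS k : lam * kappa * v k <= v (k + 1).
  have [h _] := slowly_varyingS k sg.
  have -> : v (k + 1) = lam ^+ 4 * (lam `^ (4 * k)%:~R * g (k + 1)).
    by rewrite /v mulrDr powR_intD mulr1 powR_mulrn ?(ltW l0)// mulrA [lam ^+ 4 * _]mulrC.
  have -> : lam * kappa * v k = lam `^ (4 * k)%:~R * (lam * kappa) * g k.
    by rewrite /v mulrA [lam * kappa * _]mulrC.
  apply: (le_trans (ler_wpM2l _ h)); first by rewrite !mulr_ge0 ?powR_ge0 ?(ltW l0) ?(ltW k0).
  have -> : lam `^ (4 * k)%:~R * (lam * kappa) * (kappa * g (k + 1)) =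
      lam * kappa ^+ 2 * (lam `^ (4 * k)%:~R * g (k + 1)) by ring.
  rewrite ler_wpM2r ?mulr_ge0 ?powR_ge0 ?(ltW (g0 _))//.
  rewrite (exprS _ 3) ler_wpM2l ?(ltW l0)// (le_trans lam_ge)//.
  by rewrite ler_eXnr// ltW.
have lk1 : 1 < lam / kappa by rewrite ltr_pdivlMr// mul1r.
have /choice[phi Hphi] k := bracket lk1 u0 uS1 (v0 k).
have vmono k k' : k < k' -> lam * kappa * v k <= v k'.
  move=> kk; apply: (le_trans (vS k)).
  have K1 : 1 <= lam * kappa by rewrite mulr_ege1// ltW.
  have -> : k' = k + 1 + (absz (k' - (k + 1))%R)%:Z.
    by rewrite gez0_abs ?subr_ge0 ?lezD1// addrC subrK.
  have := geometric_growth (absz (k' - (k + 1))%R) (k + 1) (le_trans ler01 K1) vS.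
  apply: le_trans; rewrite ler_peMl ?(ltW (v0 _))//.
  by rewrite exprn_ege1.
exists phi.
  have main k k' : k < k' -> phi k <> phi k'.
    move=> kk e; have /andP[h1 _] := Hphi k; have /andP[_ h2] := Hphi k'.
    have := lt_le_trans h2 (uS2 (phi k')); rewrite -e ltNge => /negP; apply.
    apply: le_trans (vmono _ _ kk); rewrite ler_wpM2l// mulr_ge0 ?(ltW l0) ?(ltW k0)//.
  move=> k k' e; case: (ltgtP k k') => // kk; exfalso.
    exact: main kk e.
  exact: main kk (esym e).
move=> k; have /andP[h1 h2] := Hphi k; split.
  rewrite powR_intD mulrNz powRN mulrAC ler_pdivrMr ?powR_gt0//.
  by rewrite [X in _ <= X]mulrC.
rewrite powR_intD mulrNz powRN.
have h3 := le_trans (ltW h2) (uS2 (phi k)).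
rewrite -(ler_pM2l (powR_gt0 (4 * k)%:~R l0)).
move/le_trans: h3; apply; rewrite /u.
set x := lam `^ (phi k)%:~R; set y := lam `^ (4 * k)%:~R.
have y0 : y != 0 by rewrite gt_eqF ?powR_gt0.
by apply: eq_imp_le; field.
Qed.

End selection.

Section interpolation.
Context {R : realType}.

(** The hypotheses say that z is comparable to g/b, the value at which the two
    terms are equal. *)
Lemma interpolate_pair (theta z b g L : R) : 0 < b -> 0 < g -> 0 < z -> 1 <= L ->
  0 <= theta <= 1 -> z * b <= g -> g <= z * L * b ->
  z `^ theta * b + z `^ (- (1 - theta)) * g <= (1 + L) * (b `^ (1 - theta) * g `^ theta).
Proof.
move=> b0 g0 z0 L1 /andP[t0 t1] h1 h2.
have split1 (x : R) : 0 < x -> x = x `^ theta * x `^ (1 - theta).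
  by move=> x0; rewrite -powRD ?(gt_eqF x0) ?implybT// addrC subrK powRr1// ltW.
rewrite mulrDl mul1r; apply: lerD.
  rewrite {1}(split1 b b0) mulrA -powRM ?(ltW z0) ?(ltW b0)// mulrC.
  by rewrite ler_wpM2l ?powR_ge0// ge0_ler_powR ?nnegrE ?mulr_ge0 ?(ltW z0) ?(ltW b0) ?(ltW g0).
rewrite {1}(split1 g g0) powRN.
have -> : (z `^ (1 - theta))^-1 * (g `^ theta * g `^ (1 - theta)) =
  g `^ (1 - theta) / z `^ (1 - theta) * g `^ theta by ring.
rewrite mulrA ler_wpM2r ?powR_ge0// ler_pdivrMr ?powR_gt0//.
have L0 : 0 <= L by exact: le_trans L1.
apply: (@le_trans _ _ ((z * L * b) `^ (1 - theta))).
  by rewrite ge0_ler_powR ?nnegrE ?subr_ge0 ?mulr_ge0 ?(ltW z0) ?(ltW b0) ?(ltW g0).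
rewrite !powRM ?mulr_ge0 ?(ltW z0) ?(ltW b0)//.
have -> : L * b `^ (1 - theta) * z `^ (1 - theta) = z `^ (1 - theta) * L * b `^ (1 - theta) by ring.
rewrite ler_wpM2r ?powR_ge0// ler_wpM2l ?powR_ge0//.
by apply: ler1_powR; rewrite // gerBl.
Qed.

Let wt (q : \bar R) (c : int -> R) k : R := if q is q'%:E then c k `^ q' else 0.

Let wt_ge0 q c k : 0 <= wt q c k.
Proof. by rewrite /wt; case: q => // x; rewrite powR_ge0. Qed.

Let wt_sum q c (s : seq int) : (0 < q)%E -> lq_bound q c 1 -> uniq s -> \sum_(k <- s) wt q c k <= 1.
Proof.
case: q => [q| |]/= q0 H us; rewrite /wt; [|by rewrite big1..].
by apply: le_trans (H s us) _; rewrite (congr1 (fun g => g q) (powR1 R)).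
Qed.

Let wt_le q c k (M : R) : (0 < q)%E -> (forall i, 0 <= c i) -> lq_bound q c 1 ->
  wt q c k <= M -> c k <= M `^ fine q^-1.
Proof.
case: q => [q| |]//=; rewrite ?lte_fin => q0 c0 H; last first.
  by move=> _; rewrite ?invey/= powRr0.
move=> wM; rewrite inver gt_eqF//=.
have -> : c k = (c k `^ q) `^ q^-1 by rewrite -powRrM mulfV ?gt_eqF// powRr1.
by rewrite ler_powRl ?nnegrE ?invr_gt0 ?powR_ge0// (le_trans (powR_ge0 _ _) wM).
Qed.

(** With M_k the sum of b_k^q1 and g_k^q2, where an infinite exponent contributes
    0, each sequence is at most M_k to the inverse of its exponent; so the
    product is at most M_k^(1/q), and M sums to at most 2. *)
Lemma lq_bound_interpolate (q1 q2 q : \bar R) (theta : R) (b g : int -> R) :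
  (0 < q1)%E -> (0 < q2)%E -> (0 < q)%E -> 0 <= theta <= 1 ->
  fine q^-1 = (1 - theta) * fine q1^-1 + theta * fine q2^-1 ->
  (forall i, 0 <= b i) -> (forall i, 0 <= g i) ->
  lq_bound q1 b 1 -> lq_bound q2 g 1 ->
  lq_bound q (fun k => b k `^ (1 - theta) * g k `^ theta) (2 `^ fine q^-1).
Proof.
move=> q10 q20 q0 /andP[t0 t1] qE b0 g0 Hb Hg.
pose M k := wt q1 b k + wt q2 g k.
have M0 k : 0 <= M k by rewrite addr_ge0.
have P0 (x : \bar R) : (0 < x)%E -> 0 <= fine x^-1.
  by move=> x0; rewrite fine_ge0// inve_ge0 ltW.
have step k : b k `^ (1 - theta) * g k `^ theta <= M k `^ fine q^-1.
  have [u0|u0] := eqVneq (fine q^-1) 0.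
    have : b k `^ (1 - theta) * g k `^ theta <= (M k `^ fine q1^-1) `^ (1 - theta) * (M k `^ fine q2^-1) `^ theta.
      apply: ler_pM; rewrite ?powR_ge0// ge0_ler_powR ?nnegrE ?powR_ge0 ?subr_ge0//.
        by apply: wt_le => //; rewrite lerDl.
      by apply: wt_le => //; rewrite lerDr.
    move/le_trans; apply; rewrite u0 powRr0 -!powRrM.
    have e1 : 0 <= (1 - theta) * fine q1^-1 by rewrite mulr_ge0 ?subr_ge0// P0.
    have e2 : 0 <= theta * fine q2^-1 by rewrite mulr_ge0// P0.
    move: qE; rewrite u0 => /esym/eqP; rewrite paddr_eq0// => /andP[/eqP f1 /eqP f2].
    by rewrite [_ * (1 - theta)]mulrC [_ * theta]mulrC f1 f2 !powRr0 mulr1.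
  have : b k `^ (1 - theta) * g k `^ theta <= (M k `^ fine q1^-1) `^ (1 - theta) * (M k `^ fine q2^-1) `^ theta.
    apply: ler_pM; rewrite ?powR_ge0// ge0_ler_powR ?nnegrE ?powR_ge0 ?subr_ge0//.
      by apply: wt_le => //; rewrite lerDl.
    by apply: wt_le => //; rewrite lerDr.
  move/le_trans; apply; rewrite -!powRrM -powRD.
    by rewrite qE [_ * (1 - theta)]mulrC [_ * theta]mulrC.
  by rewrite [X in X == 0](_ : _ = fine q^-1) ?(negbTE u0)// qE [_ * (1 - theta)]mulrC [_ * theta]mulrC.
move: q0 step; case: q {qE} => [q| |]//=; rewrite ?lte_fin => q0 step; last first.
  by move=> l; have := step l; rewrite ?invey/= !powRr0.
rewrite inver gt_eqF//= in step *.
move=> s us; rewrite -powRrM mulVf ?gt_eqF// powRr1//.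
apply: (@le_trans _ _ (\sum_(k <- s) M k)).
  apply: ler_sum => k _; have -> : M k = (M k `^ q^-1) `^ q by rewrite -powRrM mulVf ?gt_eqF// powRr1.
  by rewrite ler_powRl ?nnegrE ?mulr_ge0 ?powR_ge0.
by rewrite big_split -[2]/(1 + 1 : R) lerD ?wt_sum.
Qed.

End interpolation.

(** * Integrals against dt/t and sums over geometric blocks *)

Section unmeasured_integral.
Context d (T : measurableType d) (R : realType) (mu : {measure set T -> \bar R}).

(** The integral of a nonnegative function is a supremum over simple functions
    below it, hence monotone even without measurability. The norms of the heat
    evolution are integrated over time, and this saves proving them measurable. *)
Lemma ge0_le_integral_unmeasured (D : set T) (f g : T -> \bar R) :
  (forall x, D x -> 0 <= f x)%E -> (forall x, D x -> f x <= g x)%E ->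
  (\int[mu]_(x in D) f x <= \int[mu]_(x in D) g x)%E.
Proof.
move=> f0 fg.
have g0 x : D x -> (0 <= g x)%E by move=> Dx; apply: le_trans (f0 x Dx) (fg x Dx).
rewrite !ge0_integralE//; apply: le_ereal_sup => _ [h hf <-].
exists h => //= x; apply: (le_trans (hf x)); rewrite /patch; case: ifPn => // xD.
by apply: fg; rewrite inE in xD.
Qed.

End unmeasured_integral.

Section mult_norm.
Context {R : realType}.
Local Notation D := [set` `]0%R, +oo[ : interval R].

(** The L^q norm on the multiplicative half-line, for the measure dt/t. Both
    quasinorms of the theorem and the one they bound are of this form. *)
Definition mult_norm (q : \bar R) (Phi : R -> \bar R) : \bar R :=
  (match q with
   | q'%:E => (\int[lebesgue_measure]_(t in `]0%R, +oo[)
                (Phi t `^ q' * (t^-1)%:E)) `^ q'^-1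
   | +oo => ereal_sup [set Phi t | t in [set t : R | (0 < t)%R]]
   | -oo => 0
   end)%E.

Lemma eq_mult_norm q Phi Psi : (forall t, 0 < t -> Phi t = Psi t) -> mult_norm q Phi = mult_norm q Psi.
Proof.
move=> e; rewrite /mult_norm; case: q => [q| |]//.
  congr (_ `^ _)%E; apply: eq_integral => t; rewrite inE/= in_itv/= andbT => t0.
  by rewrite e.
congr ereal_sup; apply/seteqP; split => _ [t t0 <-]; exists t => //.
  by rewrite e.
by rewrite e.
Qed.

Variables (T0 rho : R).
Hypotheses (T00 : 0 < T0) (rho1 : 1 < rho).
Let rho0 : 0 < rho. Proof. exact: lt_trans rho1. Qed.

Definition geo (l : int) : R := T0 * rho `^ l%:~R.

Lemma geo_gt0 l : 0 < geo l. Proof. by rewrite mulr_gt0 ?powR_gt0. Qed.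

Lemma geoS l : geo (l + 1) = rho * geo l.
Proof.
rewrite /geo intrD powRD ?(gt_eqF rho0) ?implybT// powRr1 ?(ltW rho0)//; ring.
Qed.

Lemma geo_le l k : (l <= k)%R -> geo l <= geo k.
Proof. by move=> lk; rewrite ler_pM2l// ler_powR ?ler_int// ltW. Qed.

Definition block l : set R := [set` `[geo l, geo (l + 1)[ ].

Lemma block_disjoint l k t : block l t -> block k t -> l = k.
Proof.
rewrite /block /= !in_itv/= => /andP[h1 h2] /andP[h3 h4].
apply/eqP; rewrite eq_le; apply/andP; split; rewrite leNgt; apply/negP => h.
  have := le_trans (@geo_le (k + 1) l _) h1; rewrite lezD1 => /(_ h).
  by rewrite leNgt h4.
have := le_trans (@geo_le (l + 1) k _) h3; rewrite lezD1 => /(_ h).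
by rewrite leNgt h2.
Qed.

Lemma block_gt0 l t : block l t -> 0 < t.
Proof. by rewrite /block/= in_itv/= => /andP[h _]; apply: lt_le_trans h; exact: geo_gt0. Qed.

Lemma block_exists t : 0 < t -> exists l, block l t.
Proof.
move=> t0; (* The block of t is read off from the logarithm of t to base rho. *)
 exists (Num.floor (ln (t / T0) / ln rho)).
have lr : 0 < ln rho by rewrite ln_gt0.
have tT : 0 < t / T0 by rewrite divr_gt0.
have e (k : int) : geo k = T0 * expR (k%:~R * ln rho).
  by rewrite /geo /powR gt_eqF.
have et : t = T0 * expR (ln (t / T0)) by rewrite lnK ?posrE// mulrC divfK// gt_eqF.
rewrite /block/= in_itv/= !e {2 3}et; apply/andP; split.
  by rewrite ler_pM2l// ler_expR -ler_pdivlMr// (andP (floor_itv _)).1.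
by rewrite ltr_pM2l// ltr_expR -ltr_pdivrMr// (andP (floor_itv _)).2.
Qed.

Let mblock l : measurable (block l). Proof. exact: measurable_itv. Qed.

Let mD : measurable D. Proof. exact: measurable_itv. Qed.

Lemma integral_block (a : R) l : 0 <= a ->
  (\int[lebesgue_measure]_(t in D) (a%:E * (\1_(block l) t)%:E) =
   (a * (geo l * (rho - 1)))%:E)%E.
Proof.
move=> a0.
rewrite ge0_integralZl_EFin//; last first.
  apply/measurable_EFinP. apply: (@measurable_indic _ _ R _ _ (mblock l)).
rewrite integral_indic; [|exact: mD|exact: mblock].
rewrite setIidl; last first.
  by move=> t /block_gt0; rewrite /= in_itv/= andbT.
have := @lebesgue_measure_itv R `[geo l, geo (l + 1)[.
rewrite /= lte_fin geoS ltr_pMl ?geo_gt0// rho1 => e.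
rewrite [X in (_ * X)%E](_ : _ = (rho * geo l)%:E - (geo l)%:E)%E; last by rewrite -e /block geoS.
by rewrite -EFinD -EFinM; congr (_%:E); ring.
Qed.

(** Compare with the step function that is [c l] on [block l], using
    1/t >= 1 / geo (l+1). *)
Lemma mult_norm_lower (q : \bar R) : (0 < q)%E ->
  forall (Phi : R -> \bar R) (c : int -> R) (B : R), 0 <= B ->
  (forall t : R, 0 < t -> (0 <= Phi t)%E) ->
  (mult_norm q Phi <= B%:E)%E -> (forall l, 0 <= c l) ->
  (forall l t, block l t -> ((c l)%:E <= Phi t)%E) ->
  lq_bound q c ((rho / (rho - 1)) `^ fine q^-1 * B).
Proof.
case: q => [q| |]//; rewrite ?lte_fin => q0; last first.
  move=> Phi c B B0 P0 nB c0 cP l.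
  rewrite /= powRr0 mul1r -lee_fin; apply: le_trans nB => /=.
  have gl : block l (geo l) by rewrite /block/= in_itv/= lexx geoS ltr_pMl ?geo_gt0.
  apply: (le_trans (cP l _ gl)); apply: ereal_sup_ubound; exists (geo l) => //.
  exact: geo_gt0.
have r10 : 0 < rho / (rho - 1) by rewrite divr_gt0// subr_gt0.
move=> Phi c B B0 P0 nB c0 cP s us.
rewrite inver gt_eqF//= powRM ?powR_ge0// -powRrM mulVf ?gt_eqF// powRr1 ?(ltW r10)//.
pose I := (\int[lebesgue_measure]_(t in D) (Phi t `^ q * (t^-1)%:E))%E.
have I0 : (0 <= I)%E.
  apply: integral_ge0 => t /=; rewrite in_itv/= andbT => t0.
  by rewrite mule_ge0 ?poweR_ge0// lee_fin invr_ge0 ltW.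
have IB : (I <= (B `^ q)%:E)%E.
  have -> : I = ((I `^ q^-1) `^ q)%E by rewrite -poweRrM mulVf ?gt_eqF// poweRe1.
  rewrite -poweR_EFin; apply: gt0_ler_poweR; rewrite ?in_itv/= ?leey ?poweR_ge0 ?lee_fin ?(ltW q0) ?B0//.
pose a l := c l `^ q / geo (l + 1).
have a0 l : 0 <= a l by rewrite divr_ge0 ?powR_ge0// ltW// geo_gt0.
have low : (\int[lebesgue_measure]_(t in D) (\sum_(l <- s) ((a l)%:E * (\1_(block l) t)%:E)) <= I)%E.
  apply: ge0_le_integral_unmeasured => t; rewrite /= in_itv/= andbT => t0.
    by apply: sume_ge0 => l _; rewrite mule_ge0// lee_fin.
  have tail0 : (0 <= Phi t `^ q * (t^-1)%:E)%E.
    by rewrite mule_ge0 ?poweR_ge0// lee_fin invr_ge0 ltW.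
  have [l bl] := block_exists t0.
  have zero k : k != l -> ((a k)%:E * (\1_(block k) t)%:E = 0)%E.
    move=> kl; rewrite indicE memNset ?mule0// => bk.
    by move/eqP: kl; apply; exact: block_disjoint bk bl.
  have [ls|ls] := boolP (l \in s); last first.
    rewrite big_seq big1// => k ks; apply: zero.
    by apply: contraNneq ls => <-.
  rewrite (bigD1_seq l)//= big1 ?adde0; last by move=> k /zero.
  rewrite indicE mem_set// mule1 /a EFinM; apply: lee_pmul.
  - by rewrite lee_fin powR_ge0.
  - by rewrite lee_fin invr_ge0 ltW// geo_gt0.
  - rewrite -poweR_EFin; apply: gt0_ler_poweR; rewrite ?in_itv/= ?leey ?lee_fin ?(ltW q0) ?c0 ?P0//.
    exact: cP.
  - rewrite lee_fin lef_pV2 ?posrE ?geo_gt0//; move: bl; rewrite /block/= in_itv/= => /andP[_ /ltW].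
    by [].
move: low; rewrite ge0_integral_sum//; last 2 first.
  - move=> l; apply: measurable_funeM; apply/measurable_EFinP.
    apply: (@measurable_indic _ _ R _ _ (mblock l)).
  - by move=> l t _; rewrite mule_ge0// lee_fin.
rewrite (eq_bigr (fun l => (a l * (geo l * (rho - 1)))%:E)); last first.
  by move=> l _; exact: integral_block.
move/le_trans => /(_ _ IB); rewrite sumEFin lee_fin => h.
rewrite -ler_pdivrMl// (le_trans _ h)// mulr_sumr; apply: ler_sum => l _.
rewrite /a geoS; apply: eq_imp_le; have := geo_gt0 l => gl.
by field; rewrite ?gt_eqF// ?subr_gt0.
Qed.

(** The infimum of Phi on a block is finite, since otherwise [mult_norm_lower]
    would bound every real number. *)
Lemma mult_norm_block_infs (q : \bar R) (Phi : R -> \bar R) (B : R) : (0 < q)%E -> 0 <= B ->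
  (forall t : R, 0 < t -> (0 <= Phi t)%E) -> (mult_norm q Phi <= B%:E)%E ->
  exists c : int -> R, [/\ forall l, 0 <= c l,
    lq_bound q c ((rho / (rho - 1)) `^ fine q^-1 * B) &
    forall l e, 0 < e -> exists2 t, block l t & (Phi t <= (c l + e)%:E)%E].
Proof.
move=> q0 B0 P0 nB.
have low := mult_norm_lower q0 B0 P0 nB.
set K := _ * B in low *.
have K0 : 0 <= K by rewrite mulr_ge0 ?powR_ge0.
pose S l := [set Phi t | t in block l].
have S0 l : (0 <= ereal_inf (S l))%E.
  by apply: le_ereal_inf_tmp => _ [t bt <-]; apply: P0; exact: block_gt0 bt.
have Sfin l : ereal_inf (S l) \is a fin_num.
  rewrite ge0_fin_numE// ltey; apply/eqP => Soo.
  pose c k : R := if k == l then K + 1 else 0.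
  have c0 k : 0 <= c k by rewrite /c; case: ifP => // _; rewrite addr_ge0.
  have cP k t : block k t -> ((c k)%:E <= Phi t)%E.
    move=> bt; rewrite /c; case: eqP => [kl|_]; last by apply: P0; exact: block_gt0 bt.
    have : (ereal_inf (S l) <= Phi t)%E by apply: ereal_inf_lbound; exists t => //; rewrite -kl.
    by rewrite Soo leye_eq => /eqP ->; rewrite leey.
  have := lq_bound_le l q0 c0 K0 (low c c0 cP).
  by rewrite /c eqxx gerDl ler10.
exists (fun l => fine (ereal_inf (S l))); split.
- by move=> l; rewrite fine_ge0.
- apply: low => [l|l t bt]; first by rewrite fine_ge0.
  by rewrite fineK//; apply: ereal_inf_lbound; exists t.
- move=> l e e0; have [_ [t bt <-] ht] := lb_ereal_inf_adherent e0 (Sfin l).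
  by exists t => //; rewrite EFinD fineK// ltW.
Qed.

(** The majorising step function has countably many steps, which [pickle_inv]
    enumerates; each finite part of the series is a sum without repetition. *)
Lemma mult_norm_upper (q : \bar R) : (0 < q)%E ->
  forall (Phi : R -> \bar R) (c : int -> R) (B : R), 0 <= B ->
  (forall t : R, 0 < t -> (0 <= Phi t)%E) -> (forall l, 0 <= c l) ->
  (forall l t, block l t -> (Phi t <= (c l)%:E)%E) ->
  lq_bound q c B -> (mult_norm q Phi <= ((rho - 1) `^ fine q^-1 * B)%:E)%E.
Proof.
case: q => [q| |]//; rewrite ?lte_fin => q0; last first.
  move=> Phi c B B0 P0 c0 cP cB.
  rewrite /= powRr0 mul1r; apply: ge_ereal_sup => _ [t t0 <-].
  have [l bl] := block_exists t0.
  by apply: (le_trans (cP l t bl)); rewrite lee_fin.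
have r10 : 0 < rho - 1 by rewrite subr_gt0.
move=> Phi c B B0 P0 c0 cP cB; rewrite inver gt_eqF//=.
pose a l := c l `^ q / geo l.
have a0 l : 0 <= a l by rewrite divr_ge0 ?powR_ge0// ltW// geo_gt0.
pose fn (i : nat) (t : R) : \bar R :=
  if @pickle_inv int i is Some l then ((a l)%:E * (\1_(block l) t)%:E)%E else 0%E.
have fn0 i t : (0 <= fn i t)%E.
  by rewrite /fn; case: pickle_inv => // l; rewrite mule_ge0// lee_fin.
have mfn i : measurable_fun D (fn i).
  rewrite /fn; case: pickle_inv => [l|]; last exact: measurable_cst.
  apply: measurable_funeM; apply/measurable_EFinP.
  apply: (@measurable_indic _ _ R _ _ (mblock l)).
pose I := (\int[lebesgue_measure]_(t in D) (Phi t `^ q * (t^-1)%:E))%E.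
have up : (I <= \int[lebesgue_measure]_(t in D) (\sum_(i <oo) fn i t))%E.
  apply: ge0_le_integral_unmeasured => t; rewrite /= in_itv/= andbT => t0.
    by rewrite mule_ge0 ?poweR_ge0// lee_fin invr_ge0 ltW.
  have [l bl] := block_exists t0.
  apply: (@le_trans _ _ (fn (pickle l) t)); last first.
    apply: le_trans (nneseries_lim_ge (pickle l).+1 _); last by move=> *; exact: fn0.
    by rewrite big_nat_recr//= leeDr// sume_ge0.
  rewrite /fn pickleK_inv indicE mem_set// mule1 /a EFinM; apply: lee_pmul.
  - exact: poweR_ge0.
  - by rewrite lee_fin invr_ge0 ltW.
  - rewrite -poweR_EFin; apply: gt0_ler_poweR; rewrite ?in_itv/= ?leey ?lee_fin ?(ltW q0) ?c0 ?P0//.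
    exact: cP.
  - rewrite lee_fin lef_pV2 ?posrE ?geo_gt0//; move: bl; rewrite /block/= in_itv/= => /andP[+ _].
    by [].
have I0 : (0 <= I)%E.
  apply: integral_ge0 => t /=; rewrite in_itv/= andbT => t0.
  by rewrite mule_ge0 ?poweR_ge0// lee_fin invr_ge0 ltW.
have IB : (I <= ((rho - 1) * B `^ q)%:E)%E.
  apply: (le_trans up); rewrite integral_nneseries//.
  apply: lime_le; first by apply: is_cvg_nneseries => *; exact: integral_ge0.
  apply: nearW => N.
  rewrite (eq_bigr (fun i => oapp (fun l => (c l `^ q * (rho - 1))%:E) 0%E (@pickle_inv int i))); last first.
    move=> i _; rewrite /fn; case: pickle_inv => [l|]/=; last by rewrite integral0.
    rewrite integral_block// /a; congr (_%:E); have := geo_gt0 l => gl.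
    by field; rewrite gt_eqF.
  rewrite -(big_pmap (@pickle_inv int) (fun l => (c l `^ q * (rho - 1))%:E)).
  rewrite sumEFin lee_fin -mulr_suml mulrC ler_wpM2l ?(ltW r10)//.
  by apply: cB; apply: pmap_uniq (iota_uniq _ _); exact: pickle_invK.
rewrite /mult_norm -/I.
have -> : (((rho - 1) `^ q^-1 * B)%:E = ((rho - 1) * B `^ q)%:E `^ q^-1)%E.
  rewrite poweR_EFin powRM ?powR_ge0 ?(ltW r10)// -powRrM mulfV ?gt_eqF// powRr1//.
by apply: gt0_ler_poweR; rewrite ?in_itv/= ?leey ?I0 ?invr_ge0 ?(ltW q0)// lee_fin mulr_ge0 ?powR_ge0 ?(ltW r10).
Qed.

End mult_norm.

(** * From level sets to quasinorms *)

Lemma powR_shift (R : realType) (x y : R) (l : int) : 0 < x ->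
  x `^ y * (x `^ l%:~R) `^ (- y) = (x `^ (l - 1)%:~R) `^ (- y).
Proof.
move=> x0; rewrite -!powRrM -powRD; last by rewrite (gt_eqF x0) implybT.
by congr (_ `^ _); rewrite intrD; ring.
Qed.

Section rearrangement_inequality.
Context {R : realType}.
Variables (P1 P2 r s mm C : R) (q1 q2 q : \bar R) (theta P : R).
Hypotheses (P10 : 0 <= P1) (P20 : 0 <= P2) (P12 : P1 != P2) (hr : 0 < r) (hs : s < 0)
  (hmm : r / 2 <= mm) (C0 : 0 < C)
  (q10 : (0 < q1)%E) (q20 : (0 < q2)%E) (q0 : (0 < q)%E)
  (htheta : theta = r / (r - s)) (hP : P = (1 - theta) * P1 + theta * P2)
  (hq : fine q^-1 = (1 - theta) * fine q1^-1 + theta * fine q2^-1).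

Let rs0 : 0 < r - s. Proof. by rewrite subr_gt0 (lt_trans hs). Qed.

Lemma theta_gt0 : 0 < theta. Proof. by rewrite htheta divr_gt0. Qed.

Lemma theta_lt1 : theta < 1.
Proof. by rewrite htheta ltr_pdivrMr// mul1r ltrDl oppr_gt0. Qed.

Variables (a lam kappa delta rho A1 A2 : R).
Hypotheses (aE : a = (r - s) / 2) (lamE : lam = 2 `^ a) (kappaE : kappa = 2 `^ (r / 8))
  (deltaE : delta = P1 - P2) (rhoE : rho = lam `^ (4 / `|delta|))
  (A1E : A1 = 2 * kappa ^+ 2 * 4 `^ (mm - r / 2)) (A2E : A2 = 3 * kappa * rho `^ P2).

Let a_theta : a * theta = r / 2.
Proof. by rewrite aE htheta; field; rewrite gt_eqF. Qed.

Let a_theta' : a * (1 - theta) = - (s / 2).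
Proof. by rewrite mulrBr a_theta mulr1 aE; field. Qed.

Let a0 : 0 < a. Proof. by rewrite aE divr_gt0. Qed.

Let gt1_powR (x y : R) : 1 < x -> 0 < y -> 1 < x `^ y.
Proof.
move=> x1 y0; rewrite /powR gt_eqF ?(lt_trans ltr01)// -expR0 ltr_expR.
by rewrite mulr_gt0// ln_gt0.
Qed.

Let lam1 : 1 < lam. Proof. by rewrite lamE gt1_powR// ltr1n. Qed.
Let lam0 : 0 < lam. Proof. exact: lt_trans lam1. Qed.
Let kappa1 : 1 < kappa. Proof. by rewrite kappaE gt1_powR ?ltr1n// divr_gt0. Qed.
Let kappa0 : 0 < kappa. Proof. exact: lt_trans kappa1. Qed.
Let delta0 : 0 < `|delta|. Proof. by rewrite normr_gt0 deltaE subr_eq0. Qed.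
Let rho1 : 1 < rho. Proof. by rewrite rhoE gt1_powR// divr_gt0. Qed.
Let rho0 : 0 < rho. Proof. exact: lt_trans rho1. Qed.

Let kappa2_lam : kappa ^+ 2 <= lam.
Proof.
rewrite kappaE lamE -powR_mulrn ?powR_ge0// -powRrM ler_powR ?ler1n// aE.
by rewrite -subr_ge0; have := hr; have := hs; lra.
Qed.

Let pos : bool := 0 < delta.
Let sgd (l : int) : int := if pos then l else - l.

Let sgdK : involutive sgd.
Proof. by move=> l; rewrite /sgd; case: pos; rewrite ?opprK. Qed.

Let rho_sgd (l : int) (x : R) :
  (rho `^ l%:~R) `^ (x * delta) = lam `^ (4 * (sgd l)%:~R * x).
Proof.
rewrite rhoE -!powRrM; congr (_ `^ _); rewrite /sgd /pos.
case: ifPn => d0; first by rewrite gtr0_norm//; field; rewrite gt_eqF.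
have d0' : delta < 0.
  by rewrite lt_neqAle leNgt d0 andbT -normr_gt0.
by rewrite ltr0_norm// mulrNz; field; rewrite lt_eqF.
Qed.

Let A10 : 0 < A1. Proof. by rewrite A1E !mulr_gt0 ?exprn_gt0 ?powR_gt0. Qed.
Let A20 : 0 < A2. Proof. by rewrite A2E !mulr_gt0 ?powR_gt0. Qed.

Section one_triple.
Variables (N Gs Fs : R -> \bar R).
Hypotheses (F0 : forall t, (0 <= Fs t)%E)
  (Gdec : forall t t', 0 < t -> t <= t' -> (Gs t' <= Gs t)%E)
  (Fdec : forall t t', 0 < t -> t <= t' -> (Fs t' <= Fs t)%E).
Hypothesis Fmain : forall (H0 t b g : R) (j : int), 0 < H0 -> 0 < t -> 0 < b -> 0 < g ->
  (forall i : nat, exists h' : R,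
    [/\ dyad H0 (j - i%:Z - 2) <= h', h' <= dyad H0 (j - i%:Z - 1) &
     (N h' <= (b * 2 `^ (r / 8 * i%:R) * dyad H0 (j - i%:Z) `^ (r / 2 - mm))%:E)%E]) ->
  (Gs t < g%:E)%E ->
  (Fs (2 * t)%R <= (C * (b * t `^ (- P1) * dyad H0 j `^ (r / 2) + g * dyad H0 j `^ (s / 2)))%:E)%E.

Variables (B F D1 D2 H0 : R).
Hypotheses (B0 : 0 < B) (Fp0 : 0 < F) (H00 : 0 < H0) (hH0 : H0 `^ a = F / B).
Variables (b g : int -> R).
Hypotheses (b0 : forall l, 0 < b l) (g0 : forall l, 0 < g l)
  (bsv : slowly_varying kappa b) (gsv : slowly_varying kappa g).
Hypothesis Nblock : forall l, exists2 h, block H0 2 l h &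
  ((h `^ (mm - r / 2))%:E * N h <= (2 * (B * b l))%:E)%E.
Hypothesis Gblock : forall l, exists2 t, block 1 rho l t &
  ((t `^ P2)%:E * Gs t <= (2 * (F * g l))%:E)%E.

Let besov_block (j : int) (i : nat) : exists h' : R,
    [/\ dyad H0 (j - i%:Z - 2) <= h', h' <= dyad H0 (j - i%:Z - 1) &
     (N h' <= (A1 * (B * b j) * 2 `^ (r / 8 * i%:R) * dyad H0 (j - i%:Z) `^ (r / 2 - mm))%:E)%E].
Proof.
set l := (j - i%:Z - 2)%R.
have [h + hN] := Nblock l.
rewrite /block/= in_itv/= => /andP[h1 h2].
have l1 : (j - i%:Z - 1)%R = l + 1 by rewrite /l; ring.
have l2 : (j - i%:Z)%R = l + 2%:Z by rewrite /l; ring.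
exists h; split; [exact: h1|by rewrite l1 ltW|].
have hp : 0 < h by apply: lt_le_trans h1; exact: dyad_gt0.
have mr : 0 <= mm - r / 2 by rewrite subr_ge0.
have hb : h `^ (- (mm - r / 2)) <= 4 `^ (mm - r / 2) * dyad H0 (l + 2%:Z) `^ (r / 2 - mm).
  have -> : r / 2 - mm = - (mm - r / 2) by ring.
  have Hl0 : 0 < dyad H0 l by exact: dyad_gt0.
  have -> : dyad H0 (l + 2%:Z) = 4 * dyad H0 l.
    by rewrite dyadDn mulrC; congr (_ * _); ring.
  rewrite !powRN -ler_pdivrMl ?powR_gt0// -invfM.
  rewrite lef_pV2 ?posrE ?powR_gt0// ?mulr_gt0 ?powR_gt0//.
  rewrite powRM ?(ltW Hl0)// ler_wpM2l ?powR_ge0//.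
  by rewrite ge0_ler_powR ?nnegrE ?(ltW Hl0) ?(ltW hp).
have bl : b l <= kappa ^+ 2 * 2 `^ (r / 8 * i%:R) * b j.
  apply: (le_trans (bsv l j)); rewrite ler_wpM2r ?(ltW (b0 _))//.
  have -> : l - j = - (i + 2)%N%:Z by rewrite /l PoszD; ring.
  rewrite abszN absz_nat exprD mulrC ler_wpM2l ?exprn_ge0 ?(ltW kappa0)//.
  by rewrite kappaE -powR_mulrn ?powR_ge0// -powRrM.
have : (N h <= (2 * (B * b l) * h `^ (- (mm - r / 2)))%:E)%E.
  rewrite powRN EFinM -lee_pdivlMl ?powR_gt0// in hN *.
  by move: hN; rewrite muleC -EFinM; apply: le_trans; rewrite lexx.
move/le_trans; apply; rewrite lee_fin l2.
apply: (@le_trans _ _ (2 * (B * (kappa ^+ 2 * 2 `^ (r / 8 * i%:R) * b j)) *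
   (4 `^ (mm - r / 2) * dyad H0 (l + 2%:Z) `^ (r / 2 - mm)))).
  apply: ler_pM => //; rewrite ?powR_ge0 ?mulr_ge0 ?(ltW B0) ?(ltW (b0 _))//.
  by rewrite ler_wpM2l// ler_wpM2l ?(ltW B0).
by rewrite A1E; apply: eq_imp_le; ring.
Qed.

Let Gs_bound (l : int) :
  (Gs (rho `^ l%:~R) < (A2 * (F * g l) * (rho `^ l%:~R) `^ (- P2))%:E)%E.
Proof.
have [t + tG] := Gblock (l - 1).
rewrite /block/= in_itv/= subrK /geo !mul1r => /andP[t1 t2].
have t0 : 0 < t by apply: lt_le_trans t1; rewrite powR_gt0.
have R0 : 0 < rho `^ l%:~R by exact: powR_gt0.
apply: (le_lt_trans (Gdec t0 (ltW t2))).
have : (Gs t <= (2 * (F * g (l - 1)) * t `^ (- P2))%:E)%E.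
  rewrite powRN EFinM -lee_pdivlMl ?powR_gt0// in tG *.
  by move: tG; rewrite muleC -EFinM; apply: le_trans; rewrite lexx.
move/le_lt_trans; apply; rewrite lte_fin.
have gl : g (l - 1) <= kappa * g l.
  apply: (le_trans (gsv (l - 1) l)).
  by rewrite addrAC subrr add0r abszN expr1.
have tl : t `^ (- P2) <= rho `^ P2 * (rho `^ l%:~R) `^ (- P2).
  rewrite (powR_shift P2 l rho0).
  rewrite !powRN lef_pV2 ?posrE ?powR_gt0//.
  by rewrite ge0_ler_powR ?nnegrE ?(ltW t0) ?powR_ge0.
apply: (@le_lt_trans _ _ (2 * (F * (kappa * g l)) * (rho `^ P2 * (rho `^ l%:~R) `^ (- P2)))).
  apply: ler_pM => //; rewrite ?powR_ge0 ?mulr_ge0 ?(ltW Fp0) ?(ltW (g0 _))//.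
  by rewrite ler_wpM2l// ler_wpM2l ?(ltW Fp0).
have Fg0 : 0 < F * (kappa * g l) * (rho `^ P2 * (rho `^ l%:~R) `^ (- P2)).
  by rewrite !mulr_gt0 ?powR_gt0.
rewrite A2E.
have -> : 3 * kappa * rho `^ P2 * (F * g l) * (rho `^ l%:~R) `^ (- P2) =
  2 * (F * (kappa * g l)) * (rho `^ P2 * (rho `^ l%:~R) `^ (- P2)) +
  F * (kappa * g l) * (rho `^ P2 * (rho `^ l%:~R) `^ (- P2)) by ring.
by rewrite ltrDl.
Qed.

Let M : R := C * (A1 + A2) * (1 + lam * kappa) * (B `^ (1 - theta) * F `^ theta).

(** The powers of t and H_j combine to powers of
    z = lam^(j - 4 sgd l), which [selection] has balanced against b_j and g_l.
    The index l runs over the grid t = rho^l with rho > 1, and [sgd] gives it the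
    orientation that the sign of 1/p1 - 1/p2 prescribes. *)
Lemma discrete_bound : exists2 psi : int -> int, injective psi &
  forall l : int, ((rho `^ l%:~R `^ P)%:E * Fs (2 * rho `^ l%:~R) <=
    (M * (b (psi l) `^ (1 - theta) * g l `^ theta))%:E)%E.
Proof.
have gsv' : slowly_varying kappa (g \o sgd).
  move=> i j /=; apply: (le_trans (gsv _ (sgd j))); rewrite /sgd; case: pos => //.
  by rewrite -opprD abszN.
have [phi phiI Hphi] := selection kappa1 kappa2_lam b0 (fun l => g0 (sgd l)) bsv gsv'.
exists (phi \o sgd); first by apply: inj_comp => //; exact: inv_inj sgdK.
move=> l /=; have [h1 h2] := Hphi (sgd l); rewrite /= sgdK in h1 h2.
set j := phi (sgd l) in h1 h2 *.
have [z zdef] : exists z, z = lam `^ (j - 4 * sgd l)%:~R by eexists.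
have [t tdef] : exists t, t = rho `^ l%:~R by eexists.
rewrite -zdef in h1 h2.
have Gl := Gs_bound l.
rewrite -tdef in Gl *.
have t0 : 0 < t by rewrite tdef; exact: powR_gt0.
have z0 : 0 < z by rewrite zdef; exact: powR_gt0.
have := Fmain H00 t0 (mulr_gt0 A10 (mulr_gt0 B0 (b0 j)))
  (mulr_gt0 (mulr_gt0 A20 (mulr_gt0 Fp0 (g0 l))) (powR_gt0 (- P2) t0)) (besov_block j) Gl.
move=> /(@lee_wpmul2l _ (t `^ P)%:E); rewrite lee_fin powR_ge0 => /(_ isT).
move/le_trans; apply; rewrite -EFinM lee_fin.
have Hj : dyad H0 j `^ a = F / B * lam `^ j%:~R.
  by rewrite dyad_powR// hH0 lamE -powRrM [j%:~R * a]mulrC.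
have FB0 : 0 < F / B by rewrite divr_gt0.
have zE : z = lam `^ j%:~R * lam `^ (- (4 * (sgd l)%:~R)).
  rewrite zdef -powRD; last by rewrite (gt_eqF lam0) implybT.
  by rewrite intrD mulrNz intrM.
have zpow e : z `^ e = (lam `^ j%:~R) `^ e * lam `^ (4 * (sgd l)%:~R * (- e)).
  rewrite zE (powRM e (powR_ge0 _ _) (powR_ge0 _ _)) -(powRrM lam (- (4 * (sgd l)%:~R)) e).
  by rewrite mulNr mulrN.
have Hpow e : dyad H0 j `^ (a * e) = (F / B) `^ e * (lam `^ j%:~R) `^ e.
  by rewrite powRrM Hj (powRM e (ltW FB0) (powR_ge0 _ _)).
have tpow Pi e : P - Pi = - e * delta ->
    t `^ P * t `^ (- Pi) = lam `^ (4 * (sgd l)%:~R * (- e)).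
  move=> PE; rewrite -(powRD (x := t)); last by rewrite (gt_eqF t0) implybT.
  by rewrite PE tdef rho_sgd.
have E1 : t `^ P * (t `^ (- P1) * dyad H0 j `^ (r / 2)) = (F / B) `^ theta * z `^ theta.
  have e1 : P - P1 = - theta * delta by rewrite hP deltaE; ring.
  rewrite -a_theta Hpow zpow mulrA (tpow _ _ e1).
  set u := (F / B) `^ theta; set v := (lam `^ _) `^ theta; set w := lam `^ _.
  by rewrite [LHS]mulrC [RHS]mulrA.
have E2 : t `^ P * (t `^ (- P2) * dyad H0 j `^ (s / 2)) =
    (F / B) `^ (- (1 - theta)) * z `^ (- (1 - theta)).
  have -> : s / 2 = a * (- (1 - theta)) by rewrite mulrN a_theta' opprK.
  have e2 : P - P2 = - - (1 - theta) * delta by rewrite hP deltaE; ring.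
  rewrite Hpow zpow mulrA (tpow _ _ e2).
  by rewrite [LHS]mulrC [RHS]mulrA.
have S1 : B * (F / B) `^ theta = B `^ (1 - theta) * F `^ theta.
  rewrite powRM ?invr_ge0 ?(ltW B0) ?(ltW Fp0)// -powR_inv1 ?(ltW B0)// -powRrM.
  rewrite -{1}(powRr1 (ltW B0)) mulrCA mulrC; congr (_ * _).
  by rewrite -powRD ?(gt_eqF B0) ?implybT//; congr (_ `^ _); ring.
have S2 : F * (F / B) `^ (- (1 - theta)) = B `^ (1 - theta) * F `^ theta.
  rewrite powRM ?invr_ge0 ?(ltW B0) ?(ltW Fp0)// -powR_inv1 ?(ltW B0)// -powRrM.
  rewrite -{1}(powRr1 (ltW Fp0)) mulrA mulrC; congr (_ * _).
    by congr (_ `^ _); ring.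
  by rewrite -powRD ?(gt_eqF Fp0) ?implybT//; congr (_ `^ _); ring.
set W := B `^ (1 - theta) * F `^ theta in S1 S2.
have W0 : 0 < W by rewrite mulr_gt0 ?powR_gt0.
have -> : t `^ P * (C * (A1 * (B * b j) * t `^ (- P1) * dyad H0 j `^ (r / 2) +
    A2 * (F * g l) * t `^ (- P2) * dyad H0 j `^ (s / 2))) =
  C * (A1 * B * b j * (t `^ P * (t `^ (- P1) * dyad H0 j `^ (r / 2))) +
       A2 * F * g l * (t `^ P * (t `^ (- P2) * dyad H0 j `^ (s / 2)))) by ring.
rewrite E1 E2.
have -> : C * (A1 * B * b j * ((F / B) `^ theta * z `^ theta) +
      A2 * F * g l * ((F / B) `^ (- (1 - theta)) * z `^ (- (1 - theta)))) =
  C * (A1 * (B * (F / B) `^ theta) * (z `^ theta * b j) +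
       A2 * (F * (F / B) `^ (- (1 - theta))) * (z `^ (- (1 - theta)) * g l)) by ring.
rewrite S1 S2.
have lk1 : 1 <= lam * kappa by rewrite mulr_ege1// ltW.
have th01 : 0 <= theta <= 1 by rewrite (ltW theta_gt0) (ltW theta_lt1).
have ip := interpolate_pair (b0 j) (g0 l) z0 lk1 th01 h1 h2.
set x := z `^ theta * b j in ip *; set y := z `^ (- (1 - theta)) * g l in ip *.
have x0 : 0 <= x by rewrite mulr_ge0 ?powR_ge0 ?(ltW (b0 _)).
have y0 : 0 <= y by rewrite mulr_ge0 ?powR_ge0 ?(ltW (g0 _)).
apply: (@le_trans _ _ (C * (A1 + A2) * W * (x + y))).
  have -> : C * (A1 + A2) * W * (x + y) = C * (A1 * W * x + A2 * W * y) + C * W * (A1 * y + A2 * x) by ring.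
  rewrite lerDl; apply: mulr_ge0; first by apply: ltW; exact: mulr_gt0.
  by apply: addr_ge0; apply: mulr_ge0 => //; exact: ltW.
apply: (le_trans (ler_wpM2l _ ip)).
  by apply: ltW; apply: mulr_gt0 => //; apply: mulr_gt0 => //; exact: addr_gt0.
by rewrite /M -/W; apply: eq_imp_le; ring.
Qed.

Hypotheses (blq : lq_bound q1 b 1) (glq : lq_bound q2 g 1).

Lemma continuous_bound :
  (mult_norm q (fun t => (t `^ P)%:E * Fs t)%E <=
    ((rho - 1) `^ fine q^-1 * ((2 * rho) `^ P * M * 2 `^ fine q^-1))%:E)%E.
Proof.
have [psi psiI Hpsi] := discrete_bound.
have P0 : 0 <= P.
  rewrite hP; apply: addr_ge0; apply: mulr_ge0 => //; last exact: ltW theta_gt0.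
  by rewrite subr_ge0 (ltW theta_lt1).
have th01 : 0 <= theta <= 1 by rewrite (ltW theta_gt0) (ltW theta_lt1).
have M0 : 0 <= M.
  apply: mulr_ge0; last by apply: mulr_ge0; exact: powR_ge0.
  apply: ltW; apply: mulr_gt0; first by apply: mulr_gt0 => //; exact: addr_gt0.
  by apply: addr_gt0 => //; exact: mulr_gt0.
pose c l := b (psi l) `^ (1 - theta) * g l `^ theta.
have c0 l : 0 <= c l by rewrite mulr_ge0 ?powR_ge0.
have clq : lq_bound q c (2 `^ fine q^-1).
  apply: (@lq_bound_interpolate _ q1 q2 q theta (b \o psi) g) => //.
  - by move=> i; exact: ltW (b0 _).
  - by move=> i; exact: ltW (g0 _).
  - exact: lq_bound_inj.
have L0 : 0 <= (2 * rho) `^ P * M by rewrite mulr_ge0 ?powR_ge0.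
apply: (@mult_norm_upper _ 2 rho _ rho1 q q0 _ (fun l => (2 * rho) `^ P * M * c l)) => //.
- by rewrite mulr_ge0 ?powR_ge0.
- by move=> t t0; rewrite mule_ge0// lee_fin powR_ge0.
- by move=> l; rewrite mulr_ge0.
- move=> l t; rewrite /block/= in_itv/= => /andP[t1 t2].
  have g0' : 0 < geo 2 rho l by exact: geo_gt0.
  have tt : 0 < t by exact: lt_le_trans t1.
  apply: (le_trans (lee_wpmul2l _ (Fdec g0' t1))); first by rewrite lee_fin powR_ge0.
  have tP : t `^ P <= (2 * rho) `^ P * (rho `^ l%:~R) `^ P.
    rewrite -powRM ?powR_ge0 ?mulr_ge0 ?(ltW rho0)//.
    apply: ge0_ler_powR; rewrite ?nnegrE ?mulr_ge0 ?powR_ge0 ?(ltW tt) ?(ltW rho0)//.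
    apply: (le_trans (ltW t2)); rewrite geoS// /geo; apply: eq_imp_le; ring.
  have tPE : ((t `^ P)%:E <= ((2 * rho) `^ P * (rho `^ l%:~R) `^ P)%:E)%E by rewrite lee_fin.
  apply: (le_trans (lee_wpmul2r (F0 _) tPE)).
  rewrite -[X in (_ <= X%:E)%E]mulrA [X in (X * _ <= _)%E]EFinM [X in (_ <= X)%E]EFinM -muleA.
  apply: lee_wpmul2l; first by rewrite lee_fin powR_ge0.
  exact: Hpsi.
- exact: lq_boundZ.
Qed.

End one_triple.

(** The hypothesis on N, Gs and Fs is the rearranged form of [level_set_estimate].
    The parameters a, ..., A2 are tied by equations instead of being
    unfolded, which keeps the expressions small. *)
Theorem mult_norm_interpolation : exists2 c : R, 0 < c &
  forall (N Gs Fs : R -> \bar R),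
  (forall t, (0 <= N t)%E) -> (forall t, (0 <= Gs t)%E) -> (forall t, (0 <= Fs t)%E) ->
  (forall t t', 0 < t -> t <= t' -> (Gs t' <= Gs t)%E) ->
  (forall t t', 0 < t -> t <= t' -> (Fs t' <= Fs t)%E) ->
  (forall (H0 t b g : R) (j : int), 0 < H0 -> 0 < t -> 0 < b -> 0 < g ->
    (forall i : nat, exists h' : R,
      [/\ dyad H0 (j - i%:Z - 2) <= h', h' <= dyad H0 (j - i%:Z - 1) &
      (N h' <= (b * 2 `^ (r / 8 * i%:R) * dyad H0 (j - i%:Z) `^ (r / 2 - mm))%:E)%E]) ->
    (Gs t < g%:E)%E ->
    (Fs (2 * t)%R <= (C * (b * t `^ (- P1) * dyad H0 j `^ (r / 2) + g * dyad H0 j `^ (s / 2)))%:E)%E) ->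
  forall B F : R, 0 < B -> 0 < F ->
  (mult_norm q1 (fun h => (h `^ (mm - r / 2))%:E * N h) <= B%:E)%E ->
  (mult_norm q2 (fun t => (t `^ P2)%:E * Gs t) <= F%:E)%E ->
  (mult_norm q (fun t => (t `^ P)%:E * Fs t) <= (c * (B `^ (1 - theta) * F `^ theta))%:E)%E.
Proof.
have [D1 D10 HD1] := smoothing kappa1 q10.
have [D2 D20 HD2] := smoothing kappa1 q20.
pose K1 : R := (2 / (2 - 1)) `^ fine q1^-1.
pose K2 : R := (rho / (rho - 1)) `^ fine q2^-1.
have K10 : 0 < K1 by rewrite powR_gt0// divr_gt0// subr_gt0 ltr1n.
have K20 : 0 < K2 by rewrite powR_gt0// divr_gt0// subr_gt0.
have DK1 : 0 < D1 * K1 by rewrite mulr_gt0.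
have DK2 : 0 < D2 * K2 by rewrite mulr_gt0.
pose c := (rho - 1) `^ fine q^-1 * ((2 * rho) `^ P *
  (C * (A1 + A2) * (1 + lam * kappa) * ((D1 * K1) `^ (1 - theta) * (D2 * K2) `^ theta)) * 2 `^ fine q^-1).
exists c.
  by rewrite !mulr_gt0 ?powR_gt0 ?subr_gt0 ?addr_gt0 ?mulr_gt0.
move=> N Gs Fs N0 G0 F0 Gdec Fdec Fmain B F B0 Fp0 NB GF.
set B' := D1 * K1 * B; set F' := D2 * K2 * F.
have B'0 : 0 < B' by rewrite mulr_gt0.
have F'0 : 0 < F' by rewrite mulr_gt0.
pose H0 := (F' / B') `^ a^-1.
have FB0 : 0 < F' / B' by rewrite divr_gt0.
have H00 : 0 < H0 by rewrite powR_gt0.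
have hH0 : H0 `^ a = F' / B' by rewrite /H0 -powRrM mulVf ?gt_eqF// powRr1// ltW.
have r2 : (1 < 2 :> R) by rewrite ltr1n.
have [b' [b'0 b'lq b'e]] := mult_norm_block_infs H00 r2 q10 (ltW B0)
  (fun t _ => mule_ge0 (powR_ge0 t (mm - r / 2) : (0 <= (t `^ (mm - r / 2))%:E)%E) (N0 t)) NB.
have [b1 [b10 bb1 b1sv b1lq]] := HD1 _ _ (mulr_gt0 K10 B0) b'0 b'lq.
have [g' [g'0 g'lq g'e]] := mult_norm_block_infs (@ltr01 R) rho1 q20 (ltW Fp0)
  (fun t _ => mule_ge0 (powR_ge0 t P2 : (0 <= (t `^ P2)%:E)%E) (G0 t)) GF.
have [g1 [g10 gg1 g1sv g1lq]] := HD2 _ _ (mulr_gt0 K20 Fp0) g'0 g'lq.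
rewrite mulrA -/B' in b1lq; rewrite mulrA -/F' in g1lq.
have norm1 (x : int -> R) (y : \bar R) (A : R) : 0 < A -> (forall i, 0 < x i) ->
    slowly_varying kappa x -> lq_bound y x A ->
    [/\ forall i, 0 < A^-1 * x i, slowly_varying kappa (fun i => A^-1 * x i)
      & lq_bound y (fun i => A^-1 * x i) 1].
  move=> A0 x0 sv lq; split.
  - by move=> i; rewrite mulr_gt0 ?invr_gt0.
  - by move=> i j; rewrite mulrCA ler_wpM2l ?invr_ge0 ?(ltW A0).
  - rewrite -(mulVf (lt0r_neq0 A0)); apply: lq_boundZ => //; rewrite ?invr_ge0 ?(ltW A0)//.
    by move=> i; exact: ltW.
have [n1 n2 n3] := norm1 _ _ _ B'0 b10 b1sv b1lq.
have [k1 k2 k3] := norm1 _ _ _ F'0 g10 g1sv g1lq.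
have Nb l : exists2 h, block H0 2 l h &
  ((h `^ (mm - r / 2))%:E * N h <= (2 * (B' * (B'^-1 * b1 l)))%:E)%E.
  have [h bh hN] := b'e l (b1 l) (b10 l); exists h => //.
  apply: (le_trans hN); rewrite lee_fin mulVKf ?gt_eqF// mulr_natl mulr2n.
  by rewrite lerD2r.
have GG l : exists2 t, block 1 rho l t &
  ((t `^ P2)%:E * Gs t <= (2 * (F' * (F'^-1 * g1 l)))%:E)%E.
  have [h bh hN] := g'e l (g1 l) (g10 l); exists h => //.
  apply: (le_trans hN); rewrite lee_fin mulVKf ?gt_eqF// mulr_natl mulr2n.
  by rewrite lerD2r.
have := continuous_bound F0 Gdec Fdec Fmain B'0 F'0 H00 hH0 n1 k1 n2 k2 Nb GG n3 k3.
move/le_trans; apply; rewrite lee_fin; apply: eq_imp_le; rewrite /c.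
rewrite /B' /F' (powRM (1 - theta) (ltW DK1) (ltW B0)) (powRM theta (ltW DK2) (ltW Fp0)).
by set u := (D1 * K1) `^ _; set v := (D2 * K2) `^ _; ring.
Qed.

End rearrangement_inequality.

(** * Rearrangements and vanishing quasinorms *)

Section rearrangements.
Context {R : realType} {n : nat}.
Local Notation T := (Rn R n).
Implicit Types (f : T -> \bar R) (a b t : R).
Local Open Scope ereal_scope.

Lemma lambda_antitone f a b : (a <= b)%R -> lambda f b <= lambda f a.
Proof.
move=> ab; apply: (@le_outer_measure _ _ (mu_ext (borel_leb R n))) => x /=.
by apply: le_lt_trans; rewrite lee_fin.
Qed.

Lemma rearrangement_ge0 f t : 0 <= rearrangement f t.
Proof. by apply: le_ereal_inf_tmp => _ [a [a0 _] <-]; rewrite lee_fin ltW. Qed.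

Lemma rearrangement_antitone f t t' : (t <= t')%R -> rearrangement f t' <= rearrangement f t.
Proof.
move=> tt; apply: ereal_inf_le_tmp => _ [a [a0 la] <-]; exists a => //; split => //.
by apply: lt_le_trans la _; rewrite lee_fin.
Qed.

Lemma rearrangement_le f a t : (0 < a)%R -> lambda f a < t%:E -> rearrangement f t <= a%:E.
Proof. by move=> a0 la; apply: ereal_inf_lbound; exists a. Qed.

Lemma lambda_lt_rearrangement f t b : rearrangement f t < b%:E -> lambda f b < t%:E.
Proof.
move/ereal_inf_lt => [_ [a [a0 la] <-]]; rewrite lte_fin => ab.
by apply: le_lt_trans la; apply: lambda_antitone; exact: ltW.
Qed.

Lemma rearrangement_eq0 f t : (0 < t)%R -> (forall a, (0 < a)%R -> lambda f a <= 0) ->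
  rearrangement f t = 0.
Proof.
move=> t0 H; apply/eqP; rewrite eq_le rearrangement_ge0 andbT.
apply/lee_addgt0Pr => e e0; rewrite add0e.
by apply: rearrangement_le => //; apply: le_lt_trans (H e e0) _.
Qed.

Lemma lorentz_normE (p q : \bar R) f :
  lorentz_norm p q f = mult_norm q (fun t => (t `^ fine p^-1)%:E * rearrangement f t).
Proof. by []. Qed.

Lemma besov_normE m (s : R) (p q : \bar R) f :
  besov_norm m s p q f = mult_norm q (fun h => (h `^ (m%:R - s / 2))%:E *
    'N[lebn R n]_p [EFin \o dheat m h f]).
Proof.
case: q => [q| |]//=; congr (_ `^ _); apply: eq_integral => h _.
by rewrite poweRM ?Lnorm_ge0 ?lee_fin ?powR_ge0// poweR_EFin -powRrM.
Qed.

Lemma mult_norm_ge0 q (Phi : R -> \bar R) : (forall t, (0 < t)%R -> 0 <= Phi t) -> 0 <= mult_norm q Phi.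
Proof.
move=> P0; case: q => [q| |]//=; first exact: poweR_ge0.
by apply: le_trans (P0 1%R ltr01) _; apply: ereal_sup_ubound; exists 1%R => //; exact: ltr01.
Qed.

End rearrangements.

Section vanishing.
Local Open Scope ereal_scope.

Lemma Lnorm_ae_eq0 d (T : measurableType d) (R : realType)
    (mu : {measure set T -> \bar R}) (p : \bar R) (f : T -> \bar R) :
  1 <= p -> measurable_fun setT f -> {ae mu, forall x, f x = 0} -> 'N[mu]_p[f] = 0.
Proof.
move=> p1 mf f0; rewrite unlock /Lnorm; case: p p1 => [p| |]//=.
  rewrite lee_fin => p1; have p0 : (0 < p)%R by exact: lt_le_trans p1.
  rewrite (@ae_eq_integral _ _ _ mu setT (cst 0))//.
  - by rewrite integral_cst// mul0e poweR0r// gt_eqF// invr_gt0.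
  - by apply: (@measurableT_comp _ _ _ _ _ _ (fun y => poweR y p)); [exact: measurable_poweR|exact: measurableT_comp].
  - by apply: filterS f0 => x /= -> _; rewrite abse0 poweR0r// gt_eqF.
move=> _; case: ifPn => // mu0.
by apply: ess_sup_ae_cst => //; apply: filterS f0 => x /= ->; rewrite abse0.
Qed.

End vanishing.

Section degenerate.
Context {R : realType} {n : nat}.
Local Notation T := (Rn R n).
Variables (p1 : \bar R) (r s : R) (m : nat) (f : T -> \bar R).
Hypotheses (hp1 : (1 <= p1)%E) (hr : 0 < r) (S0f : S0 f) (Lf : L1_plus_Loo f).

(** [supheat] vanishes almost everywhere, and so does the derivative at each
    time. *)
Lemma Lnorm_dheat_eq0 (h : R) : 0 < h ->
  (forall a, 0 < a -> (lambda (supheat m s f) a <= 0)%E) ->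
  ('N[lebn R n]_p1 [EFin \o dheat m h f] = 0)%E.
Proof.
move=> h0 H.
have af0 := level_integrable_admissible Rn_gauss (level_integrable_fine S0f Lf).
apply: (Lnorm_ae_eq0 hp1).
  have -> : EFin \o dheat m h f = EFin \o heat_deriv (@lebn_sf R n) (@sqdist R n) (@half_dim R n) m h (fine \o f).
    by apply/funext => x /=; rewrite (dheatE S0f Lf m x h0).
  apply/measurable_EFinP; exact: (measurable_heat_deriv Rn_gauss m af0 h0).
pose U (k : nat) := [set x : T | ((k.+1%:R^-1)%:E < `|supheat m s f x|)%E].
have U0 k : lebn R n (U k) = 0%E.
  have k0 : 0 < k.+1%:R^-1 :> R by rewrite invr_gt0.
  apply/eqP; rewrite eq_le; apply/andP; split; first exact: H.
  exact: (outer_measure_ge0 (mu_ext (borel_leb R n))).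
have negU k : (lebn R n).-negligible (U k).
  exists (U k); split; [|exact: U0|exact: subset_refl].
  suff : caratheodory_measurable (mu_ext (borel_leb R n)) (U k) by [].
  apply: le_caratheodory_measurable => X.
  rewrite -[leRHS]add0e; apply: leeD.
    apply: (le_trans _ (eq_imp_le (U0 k))).
    exact: (@le_outer_measure _ _ (mu_ext (borel_leb R n))).
  exact: (@le_outer_measure _ _ (mu_ext (borel_leb R n))).
apply: (negligibleS _ (negligible_bigcup negU)).
move=> x /= nx.
have d0 : 0 < `|dheat m h f x|.
  by rewrite normr_gt0; apply/eqP => e; apply: nx; rewrite e.
have hp : 0 < h `^ (m%:R - s / 2) by exact: powR_gt0.
set y := h `^ (m%:R - s / 2) * `|dheat m h f x|.
have y0 : 0 < y by exact: mulr_gt0.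
have [k _ hk] : exists2 k : nat, True & k.+1%:R^-1 < y.
  exists (Num.truncn y^-1) => //.
  by rewrite -[ltRHS]invrK ltf_pV2 ?posrE ?invr_gt0// truncnS_gt.
exists k => //=; rewrite /U/= gee0_abs ?supheat_ge0//.
apply: (@lt_le_trans _ _ y%:E); first by rewrite lte_fin.
by apply: ereal_sup_ubound; exists h.
Qed.

(** Were [supheat] to exceed a at x, some derivative at a time in some block l
    would be large. On each block this happens only on a set of measure as small
    as desired, by [block_exceptional_set] with b tending to 0, and countably many
    blocks cover all times. *)
Lemma supheat_null : (forall l b, 0 < b -> exists h' : R,
    [/\ dyad 1 (l - 2) <= h', h' <= dyad 1 (l - 1) &
      ('N[lebn R n]_p1 [EFin \o dheat m h' f] <= b%:E)%E]) ->
  forall a, 0 < a -> (lambda (supheat m s f) a <= 0)%E.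
Proof.
move=> NB a a0.
pose rho : R := 2 `^ (- (r / 8)).
have r1 : 0 < 1 - rho by rewrite subr_gt0 powR2_lt1// divr_gt0.
have H10 : (0 < 1 :> R) by exact: ltr01.
have one_block (l : int) (tau : R) : 0 < tau -> exists2 B : set T,
    (lebn R n B <= tau%:E)%E & forall x h, ~ B x -> dyad 1 l <= h -> h <= dyad 1 (l + 1) ->
    h `^ (m%:R - s / 2) * `|dheat m h f x| <= a.
  move=> tau0.
  pose w := Num.max (dyad 1 l `^ (m%:R - s / 2)) (dyad 1 (l + 1) `^ (m%:R - s / 2)).
  have w0 : 0 < w by rewrite lt_max powR_gt0 ?dyad_gt0.
  pose K := 4 `^ (@half_dim R n) * (dyad 1 l `^ (r / 2 - m%:R) * tau `^ (- fine p1^-1)) * w.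
  have K0 : 0 < K by rewrite !mulr_gt0 ?powR_gt0 ?dyad_gt0.
  have b0 : 0 < a / K by rewrite divr_gt0.
  have t0 : 0 < tau / (1 - rho) by rewrite divr_gt0.
  have hyp (i : nat) : exists h' : R,
    [/\ dyad 1 (l - i%:Z - 2) <= h', h' <= dyad 1 (l - i%:Z - 1) &
       ('N[lebn R n]_p1 [EFin \o dheat m h' f] <=
        (a / K * 2 `^ (r / 8 * i%:R) * dyad 1 (l - i%:Z) `^ (r / 2 - m%:R))%:E)%E].
    apply: NB; apply: mulr_gt0; last by apply: powR_gt0; exact: dyad_gt0.
    by apply: mulr_gt0 => //; exact: powR_gt0.
  have [B B1 B2] := @block_exceptional_set R n p1 r m hp1 hr f S0f Lf 1 (tau / (1 - rho))
    (a / K) l H10 t0 b0 hyp 0%N.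
  have tE : tau / (1 - rho) * (1 - rho) * rho ^+ 0 = tau by rewrite mulr1 divfK// gt_eqF.
  have l0E : l - 0%:Z = l by rewrite subr0.
  cbv beta in B1, B2; rewrite -/rho tE in B1 B2; rewrite l0E in B2.
  exists B => // x h Bx h1 h2.
  have hp : 0 < h by apply: lt_le_trans h1; exact: dyad_gt0.
  rewrite (dheatE S0f Lf m x hp).
  have hw : h `^ (m%:R - s / 2) <= w.
    rewrite /w le_max; apply/orP; have [e0|e0] := leP 0 (m%:R - s / 2); [right|left].
      by apply: ge0_ler_powR => //; rewrite nnegrE ltW// dyad_gt0.
    rewrite -(opprK (m%:R - s / 2)) !(powRN _ (- _)) lef_pV2 ?posrE ?powR_gt0 ?dyad_gt0//.
    by apply: ge0_ler_powR; rewrite ?nnegrE ?oppr_ge0 ?(ltW e0) ?(ltW hp)// ltW// dyad_gt0.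
  apply: (le_trans (ler_pM (powR_ge0 _ _) (normr_ge0 _) hw (B2 x h Bx h1 h2))).
  rewrite mulr0 powRr0 mulr1; apply: eq_imp_le.
  by rewrite [RHS](_ : a = a / K * K); [rewrite /K; ring|rewrite divfK// gt_eqF].
apply/lee_addgt0Pr => e e0; rewrite add0e.
have /choice[B HB] : forall k : nat, exists B : set T,
    (lebn R n B <= (e * 2^-1 / 2 ^+ k)%:E)%E /\
    forall l, @pickle_inv int k = Some l -> forall x h, ~ B x -> dyad 1 l <= h ->
      h <= dyad 1 (l + 1) -> h `^ (m%:R - s / 2) * `|dheat m h f x| <= a.
  move=> k; have ek : 0 < e * 2^-1 / 2 ^+ k by rewrite !mulr_gt0 ?invr_gt0 ?exprn_gt0.
  have [B B1 B2] := one_block (odflt 0 (@pickle_inv int k)) _ ek.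
  by exists B; split => // l kl; rewrite kl in B2.
have sub : [set x : T | (a%:E < `|supheat m s f x|)%E] `<=` \bigcup_k B k.
  move=> x /=; rewrite gee0_abs ?supheat_ge0// => ax.
  have [_ [h h0 <-]] := ereal_sup_gt ax; rewrite lte_fin => ah.
  have [l] := @block_exists R 1 2 ltr01 (ltr1n _ _) h h0.
  rewrite /block/= in_itv/= => /andP[h1 h2].
  exists (pickle l) => //; apply: contrapT => nB.
  have := (HB (pickle l)).2 l (pickleK_inv l) x h nB h1 (ltW h2).
  by rewrite leNgt ah.
apply: (le_trans (le_outer_measure (mu_ext (borel_leb R n)) _ _ sub)).
apply: (le_trans (outer_measure_sigma_subadditive (mu_ext (borel_leb R n)) B)).
apply: lime_le; first exact: is_cvg_nneseries.
apply: nearW => K.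
apply: (@le_trans _ _ (\sum_(0 <= i < K) (e * 2^-1 / 2 ^+ i)%:E)%E).
  by apply: lee_sum => i _; exact: (HB i).1.
rewrite sumEFin lee_fin.
have half1 : 2^-1 < 1 :> R by rewrite invf_lt1// ltr1n.
have half0 : 0 <= 2^-1 :> R by rewrite invr_ge0.
have gN := @geometric_nat R 2^-1 (index_iota 0 K) half0 half1 (iota_uniq _ _).
rewrite (eq_bigr (fun i => e * 2^-1 * 2^-1 ^+ i)); last by move=> i _; rewrite exprVn.
rewrite -mulr_sumr; apply: (le_trans (ler_wpM2l _ gN)); first by rewrite mulr_ge0// ltW.
have -> : (1 - 2^-1)^-1 = 2 :> R by field.
by rewrite divfK.
Qed.

End degenerate.

(** * The interpolation inequality *)

Section zero_norm.
Context {R : realType}.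
Local Open Scope ereal_scope.

(** A block on which Phi stayed above e would contribute a positive amount to the
    norm, by [mult_norm_block_infs]. *)
Lemma mult_norm0_small (q : \bar R) (Phi : R -> \bar R) : 0 < q ->
  (forall t, (0 < t)%R -> 0 <= Phi t) -> mult_norm q Phi <= 0 ->
  forall (l : int) (e : R), (0 < e)%R -> exists2 t, block 1 2 l t & Phi t <= e%:E.
Proof.
move=> q0 P0 n0 l e e0.
have [c [c0 clq ce]] := mult_norm_block_infs (@ltr01 R) (ltr1n _ 2) q0 (lexx 0%R) P0 n0.
rewrite mulr0 in clq.
have cl : c l = 0%R.
  by apply/eqP; rewrite eq_le c0 (lq_bound_le l q0 c0 (lexx 0%R) clq).
by have [t bt ht] := ce l e e0; exists t => //; rewrite cl add0r in ht.
Qed.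

Lemma mult_norm0 (q : \bar R) (Phi : R -> \bar R) : 0 < q ->
  (forall t, (0 < t)%R -> Phi t = 0) -> mult_norm q Phi = 0.
Proof.
move=> q0 P0; rewrite (@eq_mult_norm _ q _ (cst 0))//; move: q0; case: q => [q| |]//=.
  rewrite lte_fin => q0; rewrite (@eq_integral _ _ _ _ _ (cst 0)).
    by rewrite integral0 poweR0r// gt_eqF// invr_gt0.
  by move=> t _ /=; rewrite powR0 ?gt_eqF// mul0e.
move=> _; rewrite (_ : [set _ | _ in _] = [set 0]) ?ereal_sup1//.
apply/seteqP; split => [_ [t t0 <-]//|_ ->]; exists 1%R => //=; exact: ltr01.
Qed.

Lemma inve_pos (x : \bar R) : 0 < x -> x^-1 = (fine x^-1)%:E /\ (0 <= fine x^-1)%R.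
Proof.
case: x => [x| |]//; rewrite ?lte_fin => x0.
by rewrite inver gt_eqF//=; split => //; rewrite invr_ge0 ltW.
Qed.

Lemma inve_pos_inv (x : \bar R) (u : R) : (0 <= u)%R -> x^-1 = u%:E -> 0 < x.
Proof.
move=> u0 xu; have : 0 <= x^-1 by rewrite xu lee_fin.
rewrite inve_ge0 le_eqVlt => /orP[/eqP x0|//].
by move: xu; rewrite -x0 inve0.
Qed.

End zero_norm.

Theorem theorem6p10 (R : realType) (n : nat) (n_gt0 : (0 < n)%N)
    (p1 : \bar R) (p2 : R) (q1 q2 : \bar R) (r s : R) (m : nat)
    (hp1 : (1 <= p1)%E) (hp2 : 0 < p2)
    (hq1 : (1 <= q1)%E) (hq2 : (0 < q2)%E)
    (hr : 0 < r) (hs : s < 0) (p1_neq_p2 : p1 <> p2%:E)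
    (hm : r < (2 * m)%:R)
    (theta : R) (p q : \bar R)
    (htheta : theta = r / (r - s))
    (hp : (p^-1 = (1 - theta)%:E / p1 + theta%:E / p2%:E)%E)
    (hq : (q^-1 = (1 - theta)%:E / q1 + theta%:E / q2)%E) :
  exists c : R, forall f : Rn R n -> \bar R, S0 f -> L1_plus_Loo f ->
    (lorentz_norm p q f <=
       c%:E * besov_norm m r p1 q1 f `^ (1 - theta)
            * triebel_lizorkin_lorentz_norm m s p2%:E q2 f `^ theta)%E.
Proof.
have th0 : 0 < theta := theta_gt0 hr hs htheta.
have th1 : theta < 1 := theta_lt1 hr hs htheta.
have th'0 : 0 < 1 - theta by rewrite subr_gt0.
have p10 : (0 < p1)%E by exact: lt_le_trans hp1.
have q10 : (0 < q1)%E by exact: lt_le_trans hq1.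
have [p1E P10] := inve_pos p10.
have [q1E Q10] := inve_pos q10.
have [q2E Q20] := inve_pos hq2.
have p2E : (p2%:E^-1 = (p2^-1)%:E)%E by rewrite inver gt_eqF.
have P20 : 0 <= p2^-1 by rewrite invr_ge0 ltW.
have P12 : fine p1^-1 != p2^-1.
  by apply/eqP => e; apply: p1_neq_p2; rewrite -(inveK p1) p1E e -p2E inveK.
have hP : fine p^-1 = (1 - theta) * fine p1^-1 + theta * p2^-1.
  by rewrite hp p1E p2E.
have hq' : (q^-1 = ((1 - theta) * fine q1^-1 + theta * fine q2^-1)%:E)%E.
  by rewrite hq {1}q1E {1}q2E.
have hQ : fine q^-1 = (1 - theta) * fine q1^-1 + theta * fine q2^-1 by rewrite hq'.
have q0 : (0 < q)%E.
  by apply: inve_pos_inv hq'; rewrite addr_ge0// mulr_ge0// ltW.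
have m_gt0 : (0 < m)%N.
  by rewrite lt0n; apply/eqP => m0; move: hm; rewrite m0 muln0 ltNge (ltW hr).
have hmm : r / 2 <= m%:R.
  by rewrite ler_pdivrMr// -natrM mulnC ltW.
have [C C0 HC] := level_set_estimate n_gt0 hp1 hr hs m_gt0.
have [c c0 Hc] := mult_norm_interpolation P10 P20 P12 hr hs hmm C0 q10 hq2 q0 htheta hP hQ
  (erefl _) (erefl _) (erefl _) (erefl _) (erefl _) (erefl _) (erefl _).
exists c => f S0f Lf.
pose G := supheat m s f.
have key : forall B F : R, 0 < B -> 0 < F ->
    (besov_norm m r p1 q1 f <= B%:E)%E ->
    (triebel_lizorkin_lorentz_norm m s p2%:E q2 f <= F%:E)%E ->
    (lorentz_norm p q f <= (c * (B `^ (1 - theta) * F `^ theta))%:E)%E.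
  move=> B F B0 F0; rewrite besov_normE => NB GF.
  rewrite lorentz_normE.
  apply: (Hc _ (rearrangement G) (rearrangement f) _ _ _ _ _ _ B F B0 F0 NB).
  - by move=> h; exact: Lnorm_ge0.
  - by move=> t; exact: rearrangement_ge0.
  - by move=> t; exact: rearrangement_ge0.
  - by move=> t t' _; exact: rearrangement_antitone.
  - by move=> t t' _; exact: rearrangement_antitone.
  - move=> H0 t b g j H00 t0 b0 g0 hb Gt.
    apply: rearrangement_le.
      apply: mulr_gt0 => //; apply: addr_gt0; apply: mulr_gt0; rewrite ?powR_gt0 ?dyad_gt0//.
      by apply: mulr_gt0 => //; exact: powR_gt0.
    apply: (le_lt_trans (HC f S0f Lf H0 t b g j H00 t0 b0 g0 hb)).
    rewrite mulr_natl mulr2n EFinD lteD2lE//.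
    exact: lambda_lt_rearrangement.
  - by move: GF; rewrite /triebel_lizorkin_lorentz_norm lorentz_normE p2E.
have B0 : (0 <= besov_norm m r p1 q1 f)%E.
  rewrite besov_normE; apply: mult_norm_ge0 => t t0.
  by rewrite mule_ge0 ?Lnorm_ge0// lee_fin powR_ge0.
have F0 : (0 <= triebel_lizorkin_lorentz_norm m s p2%:E q2 f)%E.
  apply: mult_norm_ge0 => t t0.
  by rewrite mule_ge0 ?rearrangement_ge0// lee_fin powR_ge0.
have FB : triebel_lizorkin_lorentz_norm m s p2%:E q2 f = 0%E -> besov_norm m r p1 q1 f = 0%E.
  rewrite /triebel_lizorkin_lorentz_norm lorentz_normE p2E /= -/(supheat m s f) -/G => Feq0.
  have small := @mult_norm0_small R q2 _ hq2
    (fun t _ => mule_ge0 (powR_ge0 t p2^-1 : (0 <= (t `^ p2^-1)%:E)%E) (rearrangement_ge0 G t))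
    (eq_imp_le Feq0).
  have Gnull a : 0 < a -> (lambda G a <= 0)%E.
    move=> a0; apply/lee_addgt0Pr => e e0; rewrite add0e.
    have [l [+ _]] : exists l, dyad 1 (l + 1) <= e /\ true.
      have [l hl] := dyad_small (divr_gt0 (@ltr01 R) e0).
      exists (l - 1); split => //; rewrite subrK /dyad mul1r.
      move: hl; rewrite /dyad mul1r mulrC ler_pdivrMr// mul1r.
      by [].
    move=> le.
    have w0 : 0 < dyad 1 l `^ p2^-1 :> R by rewrite powR_gt0// dyad_gt0.
    have [t + ht] := small l (a / 2 * dyad 1 l `^ p2^-1) (mulr_gt0 (divr_gt0 a0 (ltr0n _ 2)) w0).
    rewrite /block/= in_itv/= => /andP[t1 t2].
    have t0 : 0 < t by apply: lt_le_trans t1; exact: dyad_gt0.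
    have : (rearrangement G t < a%:E)%E.
      have : ((dyad 1 l `^ p2^-1)%:E * rearrangement G t <= (a / 2 * dyad 1 l `^ p2^-1)%:E)%E.
        apply: le_trans ht; apply: lee_wpmul2r; first exact: rearrangement_ge0.
        rewrite lee_fin; apply: ge0_ler_powR; rewrite ?nnegrE ?(ltW t0)//.
        by rewrite ltW// dyad_gt0.
      rewrite -lee_pdivlMl// -EFinM => h; apply: (le_lt_trans h); rewrite lte_fin.
      by rewrite mulrCA mulVf ?gt_eqF// mulr1 ltr_pdivrMr// mulr_natr mulr2n ltrDl.
    move/lambda_lt_rearrangement/ltW/le_trans; apply; rewrite lee_fin.
    by apply: le_trans le; exact: ltW.
  rewrite besov_normE; apply: mult_norm0 => // h h0.
  by rewrite (Lnorm_dheat_eq0 hp1 S0f Lf h0 Gnull) mule0.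
have BF : besov_norm m r p1 q1 f = 0%E -> triebel_lizorkin_lorentz_norm m s p2%:E q2 f = 0%E.
  rewrite besov_normE => Beq0.
  have small := @mult_norm0_small R q1 _ q10
    (fun t _ => mule_ge0 (powR_ge0 t (m%:R - r / 2) : (0 <= (t `^ (m%:R - r / 2))%:E)%E)
      (Lnorm_ge0 (lebn R n) p1 (EFin \o dheat m t f)))
    (eq_imp_le Beq0).
  have Gnull : forall a, 0 < a -> (lambda G a <= 0)%E.
    rewrite /G; apply: (@supheat_null R n p1 r s m f hp1 hr S0f Lf) => l b b0.
    have w0 : 0 < dyad 1 (l - 2) `^ (m%:R - r / 2) :> R by rewrite powR_gt0// dyad_gt0.
    have [h + hh] := small (l - 2) (b * dyad 1 (l - 2) `^ (m%:R - r / 2)) (mulr_gt0 b0 w0).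
    rewrite /block/= in_itv/= => /andP[h1 h2].
    have h0 : 0 < h by apply: lt_le_trans h1; exact: dyad_gt0.
    exists h; split; [exact: h1|by rewrite (_ : l - 1 = l - 2 + 1) ?ltW//; ring|].
    have : ((dyad 1 (l - 2) `^ (m%:R - r / 2))%:E * 'N[lebn R n]_p1 [EFin \o dheat m h f] <=
       (b * dyad 1 (l - 2) `^ (m%:R - r / 2))%:E)%E.
      apply: le_trans hh; apply: lee_wpmul2r; first exact: Lnorm_ge0.
      rewrite lee_fin; apply: ge0_ler_powR; rewrite ?nnegrE ?subr_ge0 ?(ltW h0)//.
      by rewrite ltW// dyad_gt0.
    rewrite -lee_pdivlMl// -EFinM => /le_trans; apply; rewrite lee_fin.
    by rewrite mulrCA mulVf ?gt_eqF// mulr1.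
  rewrite /triebel_lizorkin_lorentz_norm lorentz_normE; apply: mult_norm0 => // t t0.
  by rewrite (rearrangement_eq0 t0 Gnull) mule0.
move: B0 F0 FB BF key.
set NB := besov_norm m r p1 q1 f; set NF := triebel_lizorkin_lorentz_norm m s p2%:E q2 f.
case: NB => [B| |]//; case: NF => [F| |]//; rewrite ?lee_fin => B0 F0 FB BF key.
- have [B00|Bn0] := eqVneq B 0.
    have F00 : F = 0 by have [] := BF (congr1 _ B00).
    rewrite B00 F00 !poweR_EFin !powR0 ?gt_eqF// mule0.
    apply/lee_addgt0Pr => e e0; rewrite add0e.
    have ec0 : 0 < e / c by rewrite divr_gt0.
    have := key _ _ ec0 ec0; rewrite B00 F00 lee_fin (ltW ec0) => /(_ isT isT).
    rewrite -powRD; last by rewrite (gt_eqF ec0) implybT.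
    by rewrite subrK powRr1 ?(ltW ec0)// mulrC divfK// gt_eqF.
  have Fn0 : F != 0 by apply: contra_neq Bn0 => F00; have [] := FB (congr1 _ F00).
  have Bp : 0 < B by rewrite lt_neqAle eq_sym Bn0.
  have Fp : 0 < F by rewrite lt_neqAle eq_sym Fn0.
  by have := key B F Bp Fp (lexx _) (lexx _); rewrite !poweR_EFin -!EFinM mulrA.
- have Bn0 : B != 0 by apply/eqP => B00; have := BF (congr1 _ B00).
  have Bp : 0 < B by rewrite lt_neqAle eq_sym Bn0.
  by rewrite poweRyr ?gt_eqF// poweR_EFin -EFinM gt0_muley ?leey// lte_fin mulr_gt0 ?powR_gt0.
- have Fn0 : F != 0 by apply/eqP => F00; have := FB (congr1 _ F00).
  have Fp : 0 < F by rewrite lt_neqAle eq_sym Fn0.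
  by rewrite poweRyr ?gt_eqF// poweR_EFin gt0_muley ?lte_fin// gt0_mulye ?leey// lte_fin powR_gt0.
- by rewrite !poweRyr ?gt_eqF// [(c%:E * _)%E]gt0_muley ?lte_fin// gt0_mulye ?leey.
Qed.
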